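(* Let $X$ be an infinite-dimensional complex Banach space and let $T: X \to X$ be a bounded linear operator. Then there exists a bounded linear operator $F: X \to X$ of rank at most one such that $T+F$ has an invariant subspace of infinite dimension and infinite codimension; that is, there is a norm-closed linear subspace $Y \subseteq X$ with $\dim Y = \infty$, $\dim (X/Y) = \infty$ and $(T+F)Y \subseteq Y$.
   Context: Convention: ''subspace'' of a Banach space means norm-closed linear subspace. The space $X$ is not assumed separable or reflexive. *)

(* Defs.v *)
From HB Require Import structures.
From mathcomp Require Import all_boot all_order all_algebra.
From mathcomp Require Import generic_quotient ring_quotient complex.
From mathcomp Require Import all_classical all_reals all_analysis.

Set Implicit Arguments.
Unset Strict Implicit.
Unset Printing Implicit Defensive.

Import Order.TTheory GRing.Theory Num.Theory numFieldNormedType.Exports.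

Local Open Scope ring_scope.
Local Open Scope classical_set_scope.
Local Open Scope quotient_scope.

Section Quotient_lmodule.
Context {K : pzRingType} {V : lmodType K}.

(* A submodClosed predicate over a ring is closed under opposite, but the
   library does not register it as a zmodClosed predicate; this alias does. *)
Definition zmod_of_submod (Y : submodClosed V) : {pred V} := [in Y].

Fact zmod_of_submod_closed Y : zmod_closed (zmod_of_submod Y).
Proof. exact: submodClosedP Y. Qed.

HB.instance Definition _ (Y : submodClosed V) :=
  GRing.isZmodClosed.Build V (zmod_of_submod Y) (zmod_of_submod_closed Y).

(* V / Y, with canonical projection \pi_(quot_lmod Y). *)
Definition quot_lmod (Y : submodClosed V) := Quotient.quot (zmod_of_submod Y).

Variable Y : submodClosed V.

HB.instance Definition _ := ZmodQuotient.on (quot_lmod Y).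

Lemma eq_quot_lmod (x y : V) :
  (\pi_(quot_lmod Y) x == \pi_(quot_lmod Y) y) = (x - y \in Y).
Proof. by rewrite -(Quotient.idealrBE (zmod_of_submod Y)). Qed.

Definition quot_scale (a : K) (u : quot_lmod Y) : quot_lmod Y :=
  \pi_(quot_lmod Y) (a *: repr u).

Lemma pi_quot_scale a :
  {morph \pi_(quot_lmod Y) : x / a *: x >-> quot_scale a x}.
Proof.
move=> x; rewrite /quot_scale; apply/eqP; rewrite eq_quot_lmod -scalerBr.
by apply: rpredZ; rewrite -eq_quot_lmod reprK.
Qed.

Fact quot_scaleA a b (u : quot_lmod Y) :
  quot_scale a (quot_scale b u) = quot_scale (a * b) u.
Proof. by rewrite -[u]reprK -(pi_quot_scale b) -!pi_quot_scale scalerA. Qed.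

Fact quot_scale1 : left_id 1 quot_scale.
Proof. by move=> u; rewrite -[u]reprK -pi_quot_scale scale1r. Qed.

Fact quot_scaleDr : right_distributive quot_scale +%R.
Proof.
move=> a u v; rewrite -[u]reprK -[v]reprK -raddfD -!pi_quot_scale.
by rewrite -raddfD scalerDr.
Qed.

Fact quot_scaleDl (u : quot_lmod Y) :
  {morph quot_scale^~ u : a b / a + b}.
Proof.
by move=> a b; rewrite /= -[u]reprK -!pi_quot_scale scalerDl raddfD.
Qed.

HB.instance Definition _ := GRing.Zmodule_isLmodule.Build K (quot_lmod Y)
  quot_scaleA quot_scale1 quot_scaleDr quot_scaleDl.

End Quotient_lmodule.

Section Dimension.
Context {K : fieldType} {V : lmodType K}.

(* For a linear subspace A, the assertion that dim A <= n: A is spanned by n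
   of its vectors, not necessarily distinct or independent. *)
Definition dim_le (A : set V) (n : nat) : Prop :=
  exists2 v : 'I_n -> V, forall i, A (v i) &
    forall x, A x -> exists c : 'I_n -> K, x = \sum_(i < n) c i *: v i.

Definition infinite_dim (A : set V) : Prop := forall n, ~ dim_le A n.

End Dimension.

Definition infinite_codim (K : fieldType) (V : lmodType K)
  (Y : submodClosed V) : Prop := infinite_dim [set: quot_lmod Y].

(* For K = R[i] norms are K-valued and <= only relates numbers with a real
   difference, so M is automatically a nonnegative real unless V = 0. *)
Definition bounded_op (K : numFieldType) (V W : normedModType K)
  (T : {linear V -> W}) : Prop :=
  exists M : K, forall x, `|T x| <= M * `|x|.

(* Main.v *)
From HB Require Import structures.
Require Import Defs.
From mathcomp Require Import all_boot all_order all_algebra.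
From mathcomp Require Import generic_quotient ring_quotient complex.
From mathcomp Require Import all_classical all_reals all_analysis.
From mathcomp Require Import ring lra.

(** Call a half-space a closed subspace of infinite dimension and codimension.
If [(l_n - T) x_n = e] for infinitely many [l_n], the closed span [Y] of the
[x_n] satisfies [T Y <= Y + <e>], so a rank-one operator makes [Y] invariant;
dually for functionals [g_n] with [T* g_n] in [<g_n> + <u>] and the common kernel
of the [g_n]. The difficulty is to ensure that [Y] is a half-space.

Every bounded sequence of vectors (or of functionals) that does not accumulate
in norm has a subsequence that admits a biorthogonal sequence; discarding every
other term then gives a half-space. We apply this to normalised resolvents
[(T - l_n)^-1 e] or [u (T - l_n)^-1], where [l_n] tends to a boundary point [l]
of the set of scalars for which [T - l] is invertible on some closed invariant
subspace of finite codimension. Liouville's theorem and a compactness argument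
show that this set is not the whole plane. Take [l = 0]. If the kernel of [T] has
infinite dimension it contains invariant half-spaces. Otherwise the subspaces
[ker T /\ T^j X] stabilise, say at [W]. If [W <> 0], the closure of the
intersection of the [T^j X] is infinite dimensional, hence may be assumed of
finite codimension, and [T] has dense range in it; then the functionals cannot
accumulate. If [W = 0], the kernels of the [T^j] stabilise at a finite-dimensional
space modulo which [T] is injective; then the vectors cannot accumulate. *)

Set Implicit Arguments.
Unset Strict Implicit.
Unset Printing Implicit Defensive.

Import Order.TTheory GRing.Theory Num.Theory numFieldNormedType.Exports.
Import Normc.

Local Open Scope ring_scope.
Local Open Scope classical_set_scope.
Local Open Scope complex_scope.

(** * Norms and the Hahn-Banach theorem *)

(** Since [X] need be neither reflexive nor separable, limits of functionals are taken pointwise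
    along an ultrafilter, and vectors are read as functionals on the dual. The elements biorthogonal
    to them are then functionals on [X], not members of a bidual, so one extraction theorem serves
    both cases. Invertibility on invariant subspaces of finite codimension takes the place of
    Fredholm theory. It passes to smaller such subspaces, because a surjection of a
    finite-dimensional quotient is injective, and it survives small changes of the scalar. Close to
    any scalar where it holds there are scalars for which [T - l] is invertible on all of [X]; hence
    resolvents on [X] exist at points tending to a boundary point, where their boundedness would
    contradict irregularity. Uniform boundedness then yields a single vector [e], or a single
    functional [u], along which the resolvents are unbounded. That it is the same one for all
    resolvents is what makes the perturbation of rank one. *)

Lemma subr_swap (G : zmodType) (u v w z : G) : u - v - (w - z) = u - w - (v - z).
Proof. by rewrite !opprB addrACA [RHS]addrACA [- v - w]addrC. Qed.

Section Modulus.
Variable R : realType.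
Implicit Types (z w : R[i]) (t : R).

Lemma normc_ge0 z : 0 <= normc z.
Proof. by case: z => a b; apply: sqrtr_ge0. Qed.

Lemma normc_real t : normc t%:C = `|t|.
Proof. by rewrite /normc /= expr0n addr0 sqrtr_sqr. Qed.

Lemma normc_eq0 z : (normc z == 0) = (z == 0).
Proof.
by apply/eqP/eqP => [/eq0_normc //|->]; rewrite (normc0 R).
Qed.

Lemma normc_gt0 z : (0 < normc z) = (z != 0).
Proof. by rewrite lt_neqAle normc_ge0 andbT eq_sym normc_eq0. Qed.

Lemma normcX z n : normc (z ^+ n) = normc z ^+ n.
Proof.
by elim: n => [|n IH]; rewrite ?expr0 ?normc1 ?exprS ?normcM ?IH// -normc1.
Qed.

Lemma normc_Re z : `|complex.Re z| <= normc z.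
Proof.
case: z => a b /=; rewrite -sqrtr_sqr ler_wsqrtr// lerDl; exact: sqr_ge0.
Qed.

Lemma normc_Im z : `|complex.Im z| <= normc z.
Proof.
case: z => a b /=; rewrite -sqrtr_sqr ler_wsqrtr// lerDr; exact: sqr_ge0.
Qed.

Lemma normc_le_ReIm z : normc z <= `|complex.Re z| + `|complex.Im z|.
Proof.
case: z => a b /=; rewrite -[leRHS]ger0_norm ?addr_ge0//.
rewrite -sqrtr_sqr ler_wsqrtr// sqrrD !real_normK ?num_real//.
rewrite -addrA [X in _ <= _ + X]addrC addrA lerDl.
by rewrite mulrn_wge0// mulr_ge0.
Qed.

End Modulus.

Section Seminorm.
Variable R : realType.

(** Norms are bare real-valued functions, so that [X], its dual and the scalars are handled by the
    same lemmas. Nonnegativity follows from the two clauses. *)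
Definition seminorm (V : lmodType R[i]) (N : V -> R) :=
  (forall x y, N (x + y) <= N x + N y) /\
  (forall a x, N (a *: x) = normc a * N x).

Lemma seminorm_normc : @seminorm R[i]^o (@normc R).
Proof. by split=> [x y|a x]; [exact: le_normcD|exact: normcM]. Qed.

Variables (V : lmodType R[i]) (N : V -> R).
Hypothesis sN : seminorm N.

Lemma sn_le x y : N (x + y) <= N x + N y. Proof. by case: sN. Qed.
Lemma snZ a x : N (a *: x) = normc a * N x. Proof. by case: sN. Qed.

Lemma sn0 : N 0 = 0.
Proof. by rewrite -(scale0r 0) snZ normc0 mul0r. Qed.

Lemma snN x : N (- x) = N x.
Proof. by rewrite -scaleN1r snZ normcN normc1 mul1r. Qed.

Lemma sn_ge0 x : 0 <= N x.
Proof.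
have := sn_le x (- x); rewrite subrr sn0 snN; lra.
Qed.

Lemma sn_leB x y : N (x - y) <= N x + N y.
Proof. by rewrite -(snN y) sn_le. Qed.

Lemma snC x y : N (x - y) = N (y - x).
Proof. by rewrite -snN opprB. Qed.

Lemma sn_tri y x z : N (x - z) <= N (x - y) + N (y - z).
Proof. by rewrite (le_trans _ (sn_le _ _))// addrA subrK. Qed.

Lemma sn_diff x y : N x - N y <= N (x - y).
Proof. by rewrite lerBlDr (le_trans _ (sn_le _ _))// subrK. Qed.

Lemma snZr (t : R) x : N (t%:C *: x) = `|t| * N x.
Proof. by rewrite snZ normc_real. Qed.

End Seminorm.

Definition linear_of (K : pzRingType) (U V : lmodType K) (f : U -> V)
  (lf : linear f) : {linear U -> V} := HB.pack f (GRing.isLinear.Build _ _ _ _ f lf).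

Section HahnBanach.
Variable R : realType.
Variable V : lmodType R[i].
Implicit Types (p q : V -> R) (x y : V) (t : R).

Definition sublinear p :=
  (forall x y, p (x + y) <= p x + p y) /\
  (forall t x, 0 <= t -> p (t%:C *: x) = t * p x).

Lemma sublinear0 p : sublinear p -> p 0 = 0.
Proof. by case=> _ pZ; rewrite -(scale0r 0) (pZ 0)// mul0r. Qed.

Lemma sublinear_opp p x : sublinear p -> - p (- x) <= p x.
Proof.
move=> sp; have := sp.1 x (- x); rewrite subrr (sublinear0 sp); lra.
Qed.

(* Sublinear, below [p], and additive in the direction [x0]. A minimal sublinear
   functional equals all its slides, hence is linear. *)
Definition slide p x0 x := inf [set p (x + t%:C *: x0) - t * p x0 | t in [set t | 0 <= t]].

Section slide.
Variables (p : V -> R) (x0 : V).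
Hypothesis sp : sublinear p.

Let slide_lb x :
  lbound [set p (x + t%:C *: x0) - t * p x0 | t in [set t | 0 <= t]] (- p (- x)).
Proof.
move=> _ [t /= t0 <-]; have := sp.1 (x + t%:C *: x0) (- x).
rewrite addrAC subrr add0r sp.2//; lra.
Qed.

Let slide_has x :
  has_inf [set p (x + t%:C *: x0) - t * p x0 | t in [set t | 0 <= t]].
Proof.
split; last by exists (- p (- x)); exact: slide_lb.
by exists (p (x + 0%:C *: x0) - 0 * p x0), 0 => /=.
Qed.

Lemma slide_le t x : 0 <= t -> slide p x0 x <= p (x + t%:C *: x0) - t * p x0.
Proof. by move=> t0; apply: (ge_inf (slide_has x).2); exists t. Qed.

Lemma slide_ge x c : (forall t, 0 <= t -> c <= p (x + t%:C *: x0) - t * p x0) ->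
  c <= slide p x0 x.
Proof.
move=> H; apply: lb_le_inf; first by case: (slide_has x).
by move=> _ [t t0 <-]; exact: H.
Qed.

Lemma sublinear_slide : sublinear (slide p x0).
Proof.
(* The reverse inequality is this one for [t^-1] and the vector [t x]. *)
have Z t x : 0 < t -> t * slide p x0 x <= slide p x0 (t%:C *: x).
  move=> t0; apply: slide_ge => s s0.
  have -> : p (t%:C *: x + s%:C *: x0) - s * p x0 =
      t * (p (x + (s / t)%:C *: x0) - s / t * p x0).
    have e : t * (s / t) = s by rewrite mulrC divfK ?lt0r_neq0.
    rewrite mulrBr -(sp.2 t) ?(ltW t0)// scalerDr scalerA -rmorphM/=.
    by rewrite [t * (s / t * _)]mulrA e.
  by rewrite ler_pM2l// slide_le// divr_ge0// ltW.
split=> [x y|t x].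
  rewrite -lerBlDr; apply: slide_ge => t t0; rewrite lerBlDr -lerBlDl.
  apply: slide_ge => s s0; rewrite lerBlDr.
  apply: le_trans (slide_le (x + y) (addr_ge0 s0 t0)) _.
  have := sp.1 (y + s%:C *: x0) (x + t%:C *: x0).
  rewrite addrACA -scalerDl -rmorphD/= [y + x]addrC; lra.
rewrite le_eqVlt => /predU1P[<-|t0].
  rewrite scale0r mul0r; apply/eqP; rewrite eq_le; apply/andP; split.
    apply: le_trans (slide_le 0 (lexx 0)) _.
    by rewrite scale0r addr0 mul0r subr0 (sublinear0 sp).
  by apply: slide_ge => s s0; rewrite add0r sp.2// subrr.
apply/eqP; rewrite eq_le Z// andbT.
have ti : 0 < t^-1 by rewrite invr_gt0.
have := Z _ (t%:C *: x) ti.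
rewrite scalerA -rmorphM/= mulVf ?lt0r_neq0// scale1r.
by rewrite ler_pdivrMl.
Qed.

End slide.

(** Zorn's lemma for the reversed pointwise order. The infimum over a chain is finite because
    [s <= p] gives [- p (- x) <= s x]. It is subadditive because, of two members of the chain, the
    smaller one serves both arguments. *)
Lemma minimal_sublinear p : sublinear p -> exists q,
  [/\ sublinear q, forall x, q x <= p x &
   forall r, sublinear r -> (forall x, r x <= q x) -> r = q].
Proof.
move=> sp; pose T := {q : V -> R | sublinear q /\ forall x, q x <= p x}.
pose le (s t : T) := `[< forall x, sval t x <= sval s x >].
have p0 : T by exists p.
have [| | |[q [sq qp]] qmin] := @ZL_preorder T p0 le.
- by move=> t; apply/asboolP.
- move=> r s t /asboolP rs /asboolP st; apply/asboolP => x.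
  exact: le_trans (st x) (rs x).
- move=> A Atot; have [[a Aa]|A0] := pselect (A !=set0); last first.
    by exists p0 => s As; exfalso; apply: A0; exists s.
  pose B x := [set sval s x | s in A].
  have lbB x : lbound (B x) (- p (- x)).
    move=> _ [s As <-]; have [ss sp'] := svalP s.
    apply: le_trans (sublinear_opp x ss); rewrite lerN2; exact: sp'.
  have hB x : has_inf (B x).
    by split; [exists (sval a x), a|exists (- p (- x)); exact: lbB].
  pose m x := inf (B x).
  have mle s x : A s -> m x <= sval s x.
    by move=> As; apply: (ge_inf (hB x).2); exists s.
  have mge x c : (forall s, A s -> c <= sval s x) -> c <= m x.
    by move=> H; apply: lb_le_inf; [case: (hB x)|move=> _ [s As <-]; exact: H].
  have sm : sublinear m.
    split=> [x y|t x t0].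
      rewrite -lerBlDr; apply/mge => s As; rewrite lerBlDr -lerBlDl.
      apply/mge => s' As'; rewrite lerBlDr.
      have [/asboolP ss'|/asboolP ss'] := Atot _ _ As As'.
        apply: le_trans (mle _ _ As') _.
        by have := (svalP s').1.1 x y; have := ss' x; lra.
      apply: le_trans (mle _ _ As) _.
      by have := (svalP s).1.1 x y; have := ss' y; lra.
    move: t0; rewrite le_eqVlt => /predU1P[<-|t0].
      rewrite scale0r mul0r; apply/eqP; rewrite eq_le; apply/andP; split.
        by apply: le_trans (mle _ _ Aa) _; rewrite (sublinear0 (svalP a).1).
      by apply/mge => s As; rewrite (sublinear0 (svalP s).1).
    apply/eqP; rewrite eq_le; apply/andP; split.
      rewrite -ler_pdivrMl//; apply/mge => s As; rewrite ler_pdivrMl//.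
      by rewrite -(svalP s).1.2 ?(ltW t0)//; exact: mle.
    apply/mge => s As; rewrite (svalP s).1.2 ?(ltW t0)//.
    by rewrite ler_pM2l//; exact: mle.
  have mp x : m x <= p x by apply: le_trans (mle _ _ Aa) ((svalP a).2 x).
  exists (exist _ m (conj sm mp)) => s As; apply/asboolP => x /=; exact: mle.
exists q; split=> // r sr rq.
have rp x : r x <= p x by apply: le_trans (rq x) (qp x).
have /asboolP /= := qmin (exist _ r (conj sr rp)) (asboolT rq).
by move=> qr; apply/funext => x; apply/eqP; rewrite eq_le rq qr.
Qed.

(** The minimal functional is taken below the slide of [p] along [x0], which is at most [- p x0] at
    [- x0]; this forces [g x0 = p x0]. *)
Lemma hahn_banach_real p x0 : sublinear p -> exists g : V -> R,
  [/\ forall x y, g (x + y) = g x + g y, forall t x, g (t%:C *: x) = t * g x,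
      forall x, g x <= p x & g x0 = p x0].
Proof.
move=> sp; have [g [sg gp gmin]] := minimal_sublinear (sublinear_slide x0 sp).
have slide0 q x y : sublinear q -> slide q y x <= q x.
  by move=> sq; have := slide_le y sq x (lexx 0); rewrite scale0r addr0 mul0r subr0.
have gD x y : g (x + y) = g x + g y.
  apply/eqP; rewrite eq_le sg.1/= -lerBrDr.
  (* By minimality [g] is its own slide along [y]; the parameter 1 gives
     [g x + g y <= g (x + y)]. *)
  rewrite -[in leLHS](gmin _ (sublinear_slide y sg) (fun z => slide0 _ z y sg)).
  by have := slide_le y sg x ler01; rewrite scale1r mul1r.
have gN x : g (- x) = - g x.
  by apply/eqP; rewrite -addr_eq0 -gD addNr (sublinear0 sg).
exists g; split=> // [t x|x|].
- have [t0|t0] := lerP 0 t; first exact: sg.2.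
  rewrite -[t]opprK rmorphN scaleNr gN sg.2 ?mulNr// oppr_ge0; exact: ltW.
- exact: le_trans (gp x) (slide0 _ _ _ sp).
- apply/eqP; rewrite eq_le (le_trans (gp x0) (slide0 _ _ _ sp))/=.
  rewrite -lerN2 -gN (le_trans (gp _))// (le_trans (slide_le x0 sp (- x0) ler01))//.
  by rewrite scale1r addNr mul1r (sublinear0 sp) sub0r.
Qed.

Lemma hahn_banach (N : V -> R) x0 : seminorm N ->
  exists f : {linear V -> R[i]^o},
    (forall x, normc (f x) <= N x) /\ f x0 = (N x0)%:C.
Proof.
move=> sN; have [|g [gD gZ gN g0]] := @hahn_banach_real N x0.
  by split=> [|t x t0]; [exact: sN.1|rewrite snZr// ger0_norm].
have gopp x : g (- x) = - g x.
  by have := gZ (- 1) x; rewrite rmorphN scaleN1r mulN1r.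
(* The only complex-linear functional with real part [g]. *)
pose f x : R[i]^o := (g x) +i* (- g ('i *: x)).
have fD x y : f (x + y) = f x + f y.
  by rewrite /f scalerDr !gD opprD.
have fr t x : f (t%:C *: x) = t%:C * f x.
  rewrite /f scalerA [_ * t%:C]mulrC -scalerA !gZ.
  by apply/eqP; rewrite eq_complex /=; apply/andP; split; apply/eqP; ring.
have fi x : f ('i *: x) = 'i * f x.
  rewrite /f scalerA -expr2 sqr_i scaleN1r gopp.
  by apply/eqP; rewrite eq_complex /=; apply/andP; split; apply/eqP; ring.
have lf : linear f.
  move=> a x y; rewrite fD; congr (_ + _).
  rewrite [in LHS](complexE a) scalerDl fD fr -scalerA fi fr mulrA -mulrDl.
  by rewrite -complexE.
pose F := linear_of lf.
have fle x : normc (f x) <= N x.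
  have [->|fx0] := eqVneq (f x) 0; first by rewrite normc0 sn_ge0.
  (* Rotation by the phase [th] makes the value real and nonnegative, where the bound [g <= N]
     suffices. *)
  pose th : R[i] := (normc (f x))%:C / f x.
  have nth : normc th = 1.
    by rewrite normcM normcV normc_real ger0_norm ?normc_ge0// divff// normc_eq0.
  have : f (th *: x) = (normc (f x))%:C.
    have -> : f (th *: x) = th * f x by exact: (linearZ_LR F).
    by rewrite divfK.
  move=> /(congr1 (@complex.Re R)) /= <-.
  by rewrite (le_trans (gN _))// (snZ sN) nth mul1r.
exists F; split=> //=.
(* The real part already equals [N x0], which bounds the modulus, so the imaginary part vanishes. *)
apply/eqP; rewrite eq_complex /= g0 eqxx/= oppr_eq0.
have := fle x0; rewrite /f /normc g0 sqrrN.
rewrite -[X in _ <= X](ger0_norm (sn_ge0 sN x0)) -sqrtr_sqr ler_psqrt ?nnegrE ?addr_ge0 ?sqr_ge0//.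
rewrite gerDl => h; rewrite -sqrf_eq0 eq_le h; exact: sqr_ge0.
Qed.

Definition lin_subspace (S : set V) :=
  S 0 /\ forall (a : R[i]) x y, S x -> S y -> S (a *: x + y).

(** [hahn_banach] for the distance to [S], a seminorm that vanishes on [S] and is at least [d] at
    [x0]. The functional is then divided by its value at [x0]. *)
Lemma hahn_banach_sep (N : V -> R) (S : set V) x0 d : seminorm N -> lin_subspace S ->
  0 < d -> (forall y, S y -> d <= N (x0 - y)) ->
  exists f : {linear V -> R[i]^o}, [/\ exists K, forall x, normc (f x) <= K * N x,
    forall y, S y -> f y = 0 & f x0 = 1].
Proof.
move=> sN [S0 SD] d0 dN.
pose D x := [set N (x - y) | y in S].
have hD x : has_inf (D x).
  split; first by exists (N (x - 0)), 0.
  by exists 0 => _ [y _ <-]; exact: sn_ge0.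
pose p x := inf (D x).
have ple x y : S y -> p x <= N (x - y).
  by move=> Sy; apply: (ge_inf (hD x).2); exists y.
have pge x c : (forall y, S y -> c <= N (x - y)) -> c <= p x.
  by move=> H; apply: lb_le_inf; [case: (hD x)|move=> _ [y Sy <-]; exact: H].
have SZ a y : S y -> S (a *: y) by move=> Sy; rewrite -[_ *: _]addr0; exact: SD.
have SA y z : S y -> S z -> S (y + z).
  by move=> Sy Sz; rewrite -[y]scale1r; exact: SD.
have pZ a x : a != 0 -> normc a * p x <= p (a *: x).
  move=> a0; apply/pge => y Sy; rewrite mulrC -ler_pdivlMr ?normc_gt0//.
  apply: le_trans (ple x _ (SZ a^-1 _ Sy)) _.
  rewrite -[X in _ <= X / _]/(N _) -[y in leRHS](scalerKV a0) -scalerBr (snZ sN).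
  by rewrite mulrAC divff ?mul1r// normc_eq0.
have sp : seminorm p.
  split=> [x y|a x].
    rewrite -lerBlDr; apply/pge => u Su; rewrite lerBlDr -lerBlDl.
    apply/pge => v Sv; rewrite lerBlDr.
    apply: le_trans (ple _ _ (SA _ _ Sv Su)) _.
    by rewrite [x + y]addrC opprD addrACA (sn_le sN).
  have [->|a0] := eqVneq a 0.
    rewrite scale0r normc0 mul0r; apply/eqP; rewrite eq_le; apply/andP; split.
      by have := ple 0 _ S0; rewrite subrr (sn0 sN).
    by apply/pge => y Sy; exact: sn_ge0.
  apply/eqP; rewrite eq_le pZ// andbT.
  have ai0 : a^-1 != 0 by rewrite invr_eq0.
  have := pZ _ (a *: x) ai0.
  by rewrite scalerK// normcV ler_pdivrMl ?normc_gt0.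
have px0 : 0 < p x0 by apply: lt_le_trans d0 _; exact: pge.
have [f [fp f0]] := hahn_banach x0 sp.
have pN x : p x <= N x by have := ple x _ S0; rewrite subr0.
pose c : R[i] := (p x0)^-1%:C.
have lg : linear (fun x => c * f x : R[i]^o).
  move=> a x y; rewrite linearD linearZ/= mulrDr; congr (_ + _).
  by rewrite -[a *: f x]/(a * f x) -[a *: (c * f x)]/(a * (c * f x)) mulrCA.
exists (linear_of lg); split=> [|y Sy|] /=.
- exists (p x0)^-1 => x; rewrite normcM normc_real ger0_norm ?invr_ge0 ?(ltW px0)//.
  by rewrite ler_pM2l ?invr_gt0// (le_trans (fp x)).
- suff -> : f y = 0 by rewrite mulr0.
  apply/eqP; rewrite -normc_eq0 eq_le normc_ge0 andbT (le_trans (fp y))//.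
  by have := ple y _ Sy; rewrite subrr (sn0 sN).
- by rewrite f0 -rmorphM/= mulVf// lt0r_neq0.
Qed.

End HahnBanach.

(** * Convergence, completeness and uniform boundedness *)

Section Tends.
Variable R : realType.

Definition tends (V : lmodType R[i]) (N : V -> R) (I : Type) (F : set_system I)
  (x : I -> V) (l : V) := forall e, 0 < e -> F [set i | N (x i - l) < e].

(** Stated for filters, since limits along ultrafilters are taken later. *)
Definition complete (V : lmodType R[i]) (N : V -> R) :=
  forall F : set_system V, ProperFilter F ->
    (forall e, 0 < e -> exists v, F [set w | N (w - v) < e]) ->
    exists l, tends N F id l.

Definition banach (V : lmodType R[i]) (N : V -> R) :=
  [/\ seminorm N, forall x, N x = 0 -> x = 0 & complete N].

Variables (V : lmodType R[i]) (N : V -> R).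
Hypothesis sN : seminorm N.
Variables (I : Type) (F : set_system I).
Context {FF : ProperFilter F}.
Implicit Types (x y : I -> V) (l m : V).

Lemma tends_cst l : tends N F (fun=> l) l.
Proof. by move=> e e0; rewrite subrr (sn0 sN) /=; apply: filterE. Qed.

Lemma tends_eq x y l : F [set i | x i = y i] -> tends N F x l -> tends N F y l.
Proof.
by move=> xy xl e e0; apply: filterS2 xy (xl e e0) => i /= ->.
Qed.

Lemma tendsD x y l m :
  tends N F x l -> tends N F y m -> tends N F (fun i => x i + y i) (l + m).
Proof.
move=> xl ym e e0; have e2 : 0 < e / 2 by rewrite divr_gt0.
apply: filterS2 (xl _ e2) (ym _ e2) => i /= xi yi.
rewrite opprD addrACA (le_lt_trans (sn_le sN _ _))//; lra.
Qed.

Lemma tendsB_cst x l c : tends N F x l -> tends N F (fun i => x i - c) (l - c).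
Proof. by move=> xl; apply: tendsD xl (tends_cst _). Qed.

Lemma tends_map (W : lmodType R[i]) (N' : W -> R) (f : {linear V -> W}) K x l :
  (forall v, N' (f v) <= K * N v) -> tends N F x l ->
  tends N' F (fun i => f (x i)) (f l).
Proof.
move=> fK xl e e0; have K0 : 0 < `|K| + 1 by rewrite ltr_wpDl.
have := xl _ (divr_gt0 e0 K0); apply: filterS => i /=.
rewrite ltr_pdivlMr// -linearB => xi.
rewrite (le_lt_trans (fK _))//; apply: le_lt_trans xi.
rewrite mulrC ler_wpM2l ?(sn_ge0 sN)//; have := ler_norm K; lra.
Qed.

Lemma tends_le x l c : F [set i | N (x i) <= c] -> tends N F x l -> N l <= c.
Proof.
move=> xc xl; apply/ler_addgt0Pr => e e0.
have /filter_ex[i [/= a b]] := @filterI _ _ FF _ _ xc (xl _ e0).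
have := sn_le sN (x i - l) (- x i); rewrite addrAC subrr add0r !(snN sN); lra.
Qed.

Lemma tends_ge x l c : F [set i | c <= N (x i)] -> tends N F x l -> c <= N l.
Proof.
move=> xc xl; apply/ler_addgt0Pr => e e0.
have /filter_ex[i [/= a b]] := @filterI _ _ FF _ _ xc (xl _ e0).
have := sn_le sN (x i - l) l; rewrite subrK; lra.
Qed.

Lemma tends_N0 x l m : tends N F x l -> tends N F x m -> N (l - m) = 0.
Proof.
move=> xl xm; apply/eqP; rewrite eq_le (sn_ge0 sN) andbT.
have h := tendsD (tends_map (f := GRing.opp) (N' := N) (K := 1) _ xl) xm.
rewrite (snC sN) addrC; apply: (tends_le _ (h _)).
  by apply: filterE => i /=; rewrite addNr (sn0 sN).
by move=> v; rewrite /= (snN sN) mul1r.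
Qed.

Lemma tends0M (a : I -> R[i]) x B :
  tends (@normc R : R[i]^o -> R) F a 0 -> F [set i | N (x i) <= B] ->
  tends N F (fun i => a i *: x i) 0.
Proof.
move=> a0 xB e e0; have B0 : 0 < `|B| + 1 by rewrite ltr_wpDl.
have := @filterI _ _ FF _ _ (a0 _ (divr_gt0 e0 B0)) xB; apply: filterS => i /= [].
rewrite !subr0 ltr_pdivlMr// (snZ sN) => ai xi.
apply: le_lt_trans ai; rewrite ler_wpM2l ?normc_ge0//.
have := ler_norm B; lra.
Qed.

Lemma complete_tends x : complete N ->
  (forall e, 0 < e -> exists v, F [set i | N (x i - v) < e]) ->
  exists l, tends N F x l.
Proof.
move=> cN xC; have [|l xl] := cN (x @ F) _.
  by move=> e e0; have [v Fv] := xC e e0; exists v.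
by exists l => e e0; have := xl e e0.
Qed.

End Tends.

Section Half.
Variable R : realType.
Definition half_pow (k : nat) : R := 2^-1 ^+ k.
Lemma half_pow_gt0 k : 0 < half_pow k. Proof. by rewrite exprn_gt0. Qed.
Lemma half_powS k : half_pow k.+1 = half_pow k / 2. Proof. by rewrite /half_pow exprSr. Qed.
Lemma half_pow_lt e : 0 < e -> exists k, forall m, (k <= m)%N -> half_pow m < e.
Proof.
move=> e0; have /cvgrPdist_lt/(_ e e0)[k _ H] : half_pow @ \oo --> (0 : R).
  by apply: cvg_expr; rewrite ger0_norm// invf_lt1// ltr1n.
by exists k => m km; have := H m km; rewrite sub0r normrN ger0_norm// ltW// half_pow_gt0.
Qed.
End Half.

Section FastCauchy.
Variables (R : realType) (V : lmodType R[i]) (N : V -> R).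
Hypothesis bN : banach N.
Let sN : seminorm N. Proof. by case: bN. Qed.

Lemma banach_eq0 x : (N x == 0) = (x == 0).
Proof.
apply/eqP/eqP => [|->]; last by rewrite (sn0 sN).
by case: bN => _ + _; exact.
Qed.

Lemma fast_cauchy (x : nat -> V) : (forall k, N (x k.+1 - x k) <= half_pow R k) ->
  exists l, tends N \oo x l /\ forall k, N (l - x k) <= 2 * half_pow R k.
Proof.
move=> xh; have H k n : N (x (k + n)%N - x k) <= 2 * half_pow R k.
  suff : N (x (k + n)%N - x k) <= 2 * half_pow R k - 2 * half_pow R (k + n)%N.
    by have := half_pow_gt0 R (k + n); lra.
  elim: n => [|n IH]; first by rewrite addn0 !subrr (sn0 sN).
  rewrite addnS half_powS; have := sn_tri sN (x (k + n)%N) (x (k + n).+1) (x k).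
  by have := xh (k + n)%N; lra.
have Hn k : (\oo : set_system nat) [set n | N (x n - x k) <= 2 * half_pow R k].
  by exists k => // n /= kn; rewrite -(subnKC kn).
have [l xl] : exists l, tends N \oo x l.
  apply: complete_tends => [|e e0]; first by case: bN.
  have [k ke] := half_pow_lt (divr_gt0 e0 (ltr0n R 2)).
  by exists (x k); apply: filterS (Hn k) => n /=; have := ke k (leqnn k); lra.
exists l; split=> // k; apply: (tends_le sN (Hn k)).
exact: (tendsB_cst sN).
Qed.

(* Baire's theorem, with nowhere-dense replaced by shrinking of closed balls. *)
Lemma baire (G : nat -> set V) :
  (forall k x r, 0 < r -> exists x' r', 0 < r' /\
     forall y, N (y - x') <= r' -> N (y - x) <= r /\ G k y) ->
  exists x, forall k, G k x.
Proof.
move=> H.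
(* Choice asks for a total relation, so [(0, 0)] answers balls of nonpositive radius. Staying also
   within [half_pow] of the old centre makes the centres a fast Cauchy sequence. *)
have H' (s : nat * (V * R)) : exists t : V * R, 0 < s.2.2 ->
    0 < t.2 /\ forall y, N (y - t.1) <= t.2 ->
      [/\ N (y - s.2.1) <= s.2.2, N (y - s.2.1) <= half_pow R s.1 & G s.1 y].
  case: s => k [x r] /=; have [r0|] := pselect (0 < r); last by exists (0, 0).
  have m0 : 0 < Num.min r (half_pow R k) by rewrite lt_min r0 half_pow_gt0.
  have [x' [r' [r'0 h]]] := H k x _ m0.
  exists (x', r') => _; split=> // y /h[]; rewrite le_min => /andP[? ?] ?.
  by split.
have [g gP] := choice H'.
pose st := fix st k := if k is k'.+1 then g (k', st k') else (0, 1) : V * R.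
have st0 k : 0 < (st k).2.
  by elim: k => [|k IH] /=; [exact: ltr01|have [] := gP (k, st k) IH].
have stS k y : N (y - (st k.+1).1) <= (st k.+1).2 ->
    [/\ N (y - (st k).1) <= (st k).2, N (y - (st k).1) <= half_pow R k & G k y].
  by have [_] := gP (k, st k) (st0 k); apply.
have stc k : N ((st k).1 - (st k).1) <= (st k).2.
  by rewrite subrr (sn0 sN) ltW.
have stm k n : N ((st (k + n)%N).1 - (st k).1) <= (st k).2.
  have stn y : N (y - (st (k + n)%N).1) <= (st (k + n)%N).2 -> N (y - (st k).1) <= (st k).2.
    elim: n => [|n IH]; first by rewrite addn0.
    by rewrite addnS => /stS[/IH].
  exact: stn (stc _).
have [|l [xl _]] := @fast_cauchy (fun k => (st k).1).
  by move=> k; have [] := stS k _ (stc _).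
exists l => k; suff /stS[] : N (l - (st k.+1).1) <= (st k.+1).2 by [].
apply: (tends_le sN _ (tendsB_cst sN (st k.+1).1 xl)).
by exists k.+1 => // n /= kn; rewrite -(subnKC kn).
Qed.

(** Baire category for the open sets where some [p n] exceeds [k]. Every ball meets them: were [p n]
    small at both [x + (r / 2) v] and [x - (r / 2) v], it would be small at their difference
    [r v]. *)
Lemma banach_steinhaus (p : nat -> V -> R) (K : nat -> R) :
  (forall n, seminorm (p n)) -> (forall n x, p n x <= K n * N x) ->
  (forall c, exists n v, N v <= 1 /\ c < p n v) ->
  exists x, forall c, exists n, c < p n x.
Proof.
move=> sp pK punb.
suff [x Hx] : exists x, forall k : nat, exists n, k%:R < p n x.
  exists x => c; have [n Hn] := Hx (Num.bound `|c|); exists n.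
  by apply: lt_trans Hn; apply: le_lt_trans (ler_norm c) (archi_boundP (normr_ge0 c)).
apply: (baire (G := fun k => [set x | exists n, k%:R < p n x])) => k x r r0.
have [n [v [v1 kv]]] := punb ((k%:R + 1) / (r / 2)).
have r2 : 0 < r / 2 by rewrite divr_gt0.
rewrite ltr_pdivrMr// in kv.
have [x' [x'r x'p]] : exists x', N (x' - x) <= r / 2 /\ k%:R + 1 < p n x'.
  have Nrv : N ((r / 2)%:C *: v) <= r / 2.
    by rewrite (snZr sN) gtr0_norm// ler_piMr// ltW.
  have prv : k%:R + 1 < p n ((r / 2)%:C *: v).
    by rewrite (snZr (sp n)) gtr0_norm// mulrC.
  have [h|h] := ltP (k%:R + 1) (p n (x + (r / 2)%:C *: v)).
    by exists (x + (r / 2)%:C *: v); rewrite addrAC subrr add0r.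
  exists (x - (r / 2)%:C *: v); rewrite addrAC subrr add0r (snN sN); split=> //.
  rewrite ltNge; apply/negP => h'.
  have : p n ((r / 2)%:C *: v + (r / 2)%:C *: v) <= k%:R + 1 + (k%:R + 1).
    apply: le_trans (lerD h h'); rewrite -[_ + _ in leLHS](addrK x).
    rewrite (_ : _ - x = (x + (r / 2)%:C *: v) - (x - (r / 2)%:C *: v)).
      exact: sn_leB.
    by rewrite opprB addrK addrA -[x + _ + _]addrA [RHS]addrAC subrr add0r.
  rewrite -mulr2n -scaler_nat (snZ (sp n)) -[2%:R]/((1 + 1)%:R) natrD.
  have -> : normc (1%:R + 1%:R : R[i]) = 2.
    by rewrite -[X in normc X](rmorphD (real_complex R) 1 1) normc_real ger0_norm.
  lra.
(* Within distance [K'^-1] the seminorm [p n] changes by at most 1, which uses up the margin between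
   [k + 1] and [k]. *)
pose K' := `|K n| + 1; have K'0 : 0 < K' by rewrite ltr_wpDl.
exists x', (Num.min (r / 2) K'^-1); split; first by rewrite lt_min r2 invr_gt0.
move=> y; rewrite le_min => /andP[y1 y2]; split.
  by apply: le_trans (sn_tri sN x' _ _) _; lra.
exists n; have : p n (x' - y) <= 1.
  apply: le_trans (pK _ _) _; rewrite (snC sN).
  have := ler_wpM2l (ltW K'0) y2; rewrite divff ?lt0r_neq0//.
  apply: le_trans; rewrite ler_wpM2r ?(sn_ge0 sN)//.
  by rewrite /K'; have := ler_norm (K n); lra.
by have := sn_diff (sp n) x' y; lra.
Qed.

End FastCauchy.

(** * The dual space *)

Section Complex.
Variable R : realType.

Lemma tends_ReIm (I : Type) (F : set_system I) (z : I -> R[i]) (a b : R) :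
  ProperFilter F -> (complex.Re (z i) @[i --> F] --> a) ->
  (complex.Im (z i) @[i --> F] --> b) ->
  tends (@normc R : R[i]^o -> R) F z (a +i* b).
Proof.
move=> FF /cvgrPdist_lt za /cvgrPdist_lt zb e e0.
have e2 : 0 < e / 2 by rewrite divr_gt0.
apply: filterS2 (za _ e2) (zb _ e2) => i /= ha hb.
apply: le_lt_trans (normc_le_ReIm _) _.
by case: (z i) ha hb => x y /= ha hb; rewrite distrC [X in _ + X]distrC; lra.
Qed.

Lemma banach_normc : banach (@normc R : R[i]^o -> R).
Proof.
split; [exact: seminorm_normc|exact: eq0_normc|move=> F FF FC].
have cv (g : R[i]^o -> R) : (forall x y, `|g x - g y| <= normc (x - y)) -> cvg (g @ F).
  move=> gl; apply/cauchy_cvgP/cauchy_exP => e e0.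
  have [v Fv] := FC e e0; exists (g v).
  change (F [set w | ball (g v) e (g w)]).
  apply: filterS Fv => w /= wv.
  by rewrite -ball_normE /= distrC (le_lt_trans (gl _ _)).
have cRe : cvg (@complex.Re R @ F).
  by apply: cv => -[a b] [c d]; exact: (normc_Re ((a - c) +i* (b - d))).
have cIm : cvg (@complex.Im R @ F).
  by apply: cv => -[a b] [c d]; exact: (normc_Im ((a - c) +i* (b - d))).
by exists (lim (@complex.Re R @ F) +i* lim (@complex.Im R @ F)); exact: tends_ReIm.
Qed.

Lemma ultra_fmap (I T : Type) (U : set_system I) (f : I -> T) :
  UltraFilter U -> UltraFilter (f @ U).
Proof.
move=> UU; split => [|G GG UG]; first exact: fmap_proper_filter.
apply/seteqP; split=> // A GA.
have [//|UnA] := in_ultra_setVsetC (f @^-1` A) UU.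
have [x [Ax]] : (A `&` ~` A) !=set0.
  by apply: (@filter_ex _ G); apply: filterI => //; exact: UG.
by [].
Qed.

Lemma ultra_tends (I : Type) (U : set_system I) (z : I -> R[i]) B :
  UltraFilter U -> (forall i, normc (z i) <= B) ->
  exists l, tends (@normc R : R[i]^o -> R) U z l.
Proof.
move=> UU zB.
have cv (g : R[i] -> R) : (forall x, `|g x| <= normc x) ->
    exists l : R, g (z i) @[i --> U] --> l.
  move=> gl; have := @segment_compact R (- B) B.
  rewrite compact_ultra => /(_ ((g \o z) @ U) (ultra_fmap _ _)) [|l [_ ?]]; last by exists l.
  change (U [set i | g (z i) \in `[- B, B]%R]).
  apply: filterE => i /=; rewrite in_itv /= -ler_norml.
  exact: le_trans (gl _) (zB i).
have [a ha] := cv _ (@normc_Re R).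
have [b hb] := cv _ (@normc_Im R).
by exists (a +i* b); exact: tends_ReIm.
Qed.

End Complex.

Section Dual.
Variables (R : realType) (V : lmodType R[i]) (N : V -> R).

(** The dual is a vector space type of its own because uniform boundedness and the extraction of
    biorthogonal sequences are applied to it as well. *)
Definition dual_pred : {pred V -> R[i]^o} :=
  fun f => `[< linear f /\ exists K, forall x, normc (f x) <= K * N x >].

Fact dual_pred_closed : submod_closed dual_pred.
Proof.
split.
  apply/asboolP; split; last by exists 0 => x; rewrite mul0r normc0.
  by move=> a x y /=; rewrite scaler0 addr0.
move=> a f g /asboolP[lf [K fK]] /asboolP[lg [L gL]]; apply/asboolP; split.
  move=> b x y.
  change (a * f (b *: x + y) + g (b *: x + y) = b * (a * f x + g x) + (a * f y + g y)).
  rewrite lf lg -[LHS]/(a * (b * f x + f y) + (b * g x + g y)).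
  ring.
exists (normc a * K + L) => x; apply: le_trans (le_normcD (a * f x) (g x)) _.
by rewrite mulrDl lerD// normcM -mulrA ler_wpM2l ?normc_ge0.
Qed.

HB.instance Definition _ :=
  GRing.isSubmodClosed.Build R[i] (V -> R[i]^o) dual_pred dual_pred_closed.

Record dual := Dual { dual_fun : V -> R[i]^o; _ : dual_fun \in dual_pred }.

HB.instance Definition _ := [isSub for dual_fun].
HB.instance Definition _ := [Choice of dual by <:].
HB.instance Definition _ := [SubChoice_isSubLmodule of dual by <:].

Lemma dual_linear (f : dual) : linear (dual_fun f).
Proof. by case: f => f /= /asboolP[]. Qed.

Definition dual_lin (f : dual) : {linear V -> R[i]^o} := linear_of (dual_linear f).

Lemma dual_bounded (f : dual) : exists K, forall x, normc (dual_lin f x) <= K * N x.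
Proof. by case: f => f /= /asboolP[]. Qed.

Lemma dual_of (f : {linear V -> R[i]^o}) K : (forall x, normc (f x) <= K * N x) ->
  exists g : dual, forall x, dual_lin g x = f x.
Proof.
move=> fK; have df : (f : V -> R[i]^o) \in dual_pred.
  by apply/asboolP; split; [exact: linearP|exists K].
by exists (Dual df).
Qed.

Definition dual_norm (f : dual) : R := sup [set normc (dual_lin f x) | x in [set x | N x <= 1]].

Hypothesis sN : seminorm N.

Let has_dual_norm (f : dual) : has_sup [set normc (dual_lin f x) | x in [set x | N x <= 1]].
Proof.
split.
  by exists (normc (dual_lin f 0)), 0 => //=; rewrite (sn0 sN).
have [K fK] := dual_bounded f; exists `|K| => _ [x /= x1 <-].
apply: le_trans (fK x) _; apply: le_trans (ler_norm _) _.
by rewrite normrM ler_piMr// ger0_norm ?(sn_ge0 sN).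
Qed.

Lemma dual_norm_ge f x : N x <= 1 -> normc (dual_lin f x) <= dual_norm f.
Proof. by move=> x1; apply: (sup_upper_bound (has_dual_norm f)); exists x. Qed.

Lemma dual_norm_le f c : (forall x, N x <= 1 -> normc (dual_lin f x) <= c) -> dual_norm f <= c.
Proof.
move=> H; apply: ge_sup => [|_ [x x1 <-]]; last exact: H.
by case: (has_dual_norm f).
Qed.

Lemma dual_norm_ge0 f : 0 <= dual_norm f.
Proof.
by apply: le_trans (@dual_norm_ge f 0 _); rewrite ?normc_ge0// (sn0 sN).
Qed.

Lemma dual_le f x : normc (dual_lin f x) <= dual_norm f * N x.
Proof.
have [x0|x0] := eqVneq (N x) 0.
  by have [K] := dual_bounded f => /(_ x); rewrite x0 !mulr0.
have Nx : 0 < N x by rewrite lt_neqAle eq_sym x0 (sn_ge0 sN).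
have := @dual_norm_ge f ((N x)^-1%:C *: x).
rewrite (snZr sN) ger0_norm ?invr_ge0 ?(sn_ge0 sN)// mulVf// => /(_ (lexx _)).
rewrite linearZ_LR -[_ *: _]/(_ * _) normcM normc_real ger0_norm ?invr_ge0 ?(sn_ge0 sN)//.
by rewrite ler_pdivrMl// mulrC.
Qed.

Lemma seminorm_dual_norm : seminorm dual_norm.
Proof.
split=> [f g|a f].
  apply: dual_norm_le => x x1; apply: le_trans (le_normcD (dual_lin f x) (dual_lin g x)) _.
  by rewrite lerD ?dual_norm_ge.
have le b h : dual_norm (b *: h) <= normc b * dual_norm h.
  apply: dual_norm_le => x x1.
  rewrite -[dual_lin _ x]/(b * dual_lin h x) normcM ler_wpM2l ?normc_ge0//.
  exact: dual_norm_ge.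
apply/eqP; rewrite eq_le le/=.
have [->|a0] := eqVneq a 0; first by rewrite normc0 mul0r dual_norm_ge0.
have := le a^-1 (a *: f); rewrite scalerK// normcV ler_pdivlMl ?normc_gt0//.
Qed.

Lemma banach_dual_norm : banach dual_norm.
Proof.
have sC := seminorm_normc R.
split; [exact: seminorm_dual_norm| |].
  move=> f f0; apply/val_inj/funext => x /=.
  apply/eqP; rewrite -normc_eq0 eq_le normc_ge0 andbT.
  by have := dual_le f x; rewrite f0 mul0r.
move=> F FF FC.
have evB f g x : dual_lin (f - g) x = dual_lin f x - dual_lin g x by [].
have /choice[l lP] x : exists l, tends (@normc R : R[i]^o -> R) F (fun f => dual_lin f x) l.
  apply: complete_tends => [|e e0]; first by case: (banach_normc R).
  have N1 : 0 < N x + 1 by rewrite ltr_wpDl ?(sn_ge0 sN).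
  have [g Fg] := FC _ (divr_gt0 e0 N1); exists (dual_lin g x).
  apply: filterS Fg => f /=; rewrite ltr_pdivlMr// => fg.
  rewrite -evB (le_lt_trans (dual_le _ _))//; apply: le_lt_trans fg.
  by rewrite ler_wpM2l ?dual_norm_ge0// lerDl.
have uniq z a b : tends (@normc R : R[i]^o -> R) F z a ->
    tends (@normc R : R[i]^o -> R) F z b -> a = b.
  move=> za zb; apply/eqP; rewrite -subr_eq0 -normc_eq0; apply/eqP.
  exact: (tends_N0 sC za zb).
have ll : linear l.
  move=> a x y; apply: (uniq (fun f => dual_lin f (a *: x + y))) => //.
  apply: (tends_eq (x := fun f => a * dual_lin f x + dual_lin f y)).
    by apply: filterE => f; rewrite /mkset linearP.
  apply: tendsD (lP y) => //.
  have lm : linear (fun v : R[i]^o => a * v : R[i]^o).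
    by move=> b u v; rewrite mulrDr; congr (_ + _); exact: mulrCA.
  apply: (@tends_map _ _ (@normc R) sC _ F FF _ (@normc R) (linear_of lm) (normc a)) (lP x).
  by move=> v; rewrite -normcM.
have [g Fg] := FC 1 ltr01.
have lb x : normc (l x) <= (dual_norm g + 1) * N x.
  apply: (tends_le sC _ (lP x)); apply: filterS Fg => f /= fg.
  apply: le_trans (dual_le _ _) _; rewrite ler_wpM2r ?(sn_ge0 sN)//.
  by have := sn_diff seminorm_dual_norm f g; lra.
have dl : l \in dual_pred by apply/asboolP; split=> //; exists (dual_norm g + 1).
exists (Dual dl) => e e0; have e4 : 0 < e / 4 by rewrite divr_gt0.
have [h Fh] := FC _ e4.
(* Two functionals within [e / 4] of [h] are within [e / 2] of each other, and this weak inequality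
   persists when one of them tends to [l]. *)
apply: filterS (Fh) => f /= fh; apply: (@le_lt_trans _ _ (e / 2)); last by lra.
apply: dual_norm_le => x x1.
rewrite -[dual_lin _ _]/(dual_lin f x - l x).
rewrite (snC sC).
apply: (tends_le sC _ (tendsB_cst sC (dual_lin f x) (lP x))).
apply: filterS (Fh) => k /= kh; rewrite -evB.
apply: le_trans (dual_norm_ge _ x1) _.
have := sn_tri seminorm_dual_norm h k f; rewrite (snC seminorm_dual_norm h f); lra.
Qed.

End Dual.

(** * Biorthogonal subsequences *)

Section Biorthogonal.
Variables (R : realType) (A : lmodType R[i]) (N : A -> R).
Hypothesis bN : banach N.
Let sN : seminorm N. Proof. by case: bN. Qed.
Let sC := seminorm_normc R.

(** The difference [a - P a] is a combination of the finite list [vs] with controlled coefficients.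
    The last clause records this in the form that is used: a functional that is small on [vs] is
    small on [a - P a]. *)
Lemma annihilating_projection (theta : nat -> {linear A -> R[i]^o}) n :
  (forall i, exists K, forall a, normc (theta i a) <= K * N a) ->
  exists (P : {linear A -> A}) (K : R) (vs : seq A),
  [/\ 0 <= K, forall i a, (i < n)%N -> theta i (P a) = 0,
      forall a, N (P a) <= K * N a &
      forall (chi : {linear A -> R[i]^o}) a,
        normc (chi (a - P a)) <= K * N a * \sum_(v <- vs) normc (chi v)].
Proof.
move=> tb; elim: n => [|n [P [K [vs [K0 tP PK chiP]]]]].
  exists idfun, 1, [::]; split=> // [a|chi a]; first by rewrite mul1r.
  by rewrite /= subrr linear0 normc0 big_nil mulr0.
have [t0|] := pselect (forall a, theta n (P a) = 0).
  exists P, K, vs; split=> // i a; rewrite ltnS leq_eqVlt => /predU1P[->//|].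
  exact: tP.
move=> /existsNP[v0 /eqP tv0].
(* [w] is taken in the range of [P], so that subtracting multiples of it preserves the earlier
   zeros. *)
have [w tw twi] : exists2 w, theta n w = 1 & forall i, (i < n)%N -> theta i w = 0.
  exists (P ((theta n (P v0))^-1 *: v0)) => [|i ilt]; last exact: tP.
  by rewrite !linearZ_LR -[LHS]/(_ * _) mulVf.
have lP' : linear (fun a => P a - theta n (P a) *: w).
  move=> b x y; rewrite !linearP scalerDl opprD addrACA -[(b *: _) *: w]scalerA.
  by rewrite scalerBr.
have [L tL] := tb n.
have tPL a : normc (theta n (P a)) <= `|L| * K * N a.
  apply: le_trans (tL _) _; rewrite -mulrA.
  apply: (@le_trans _ _ (`|L| * N (P a))); last by rewrite ler_wpM2l.
  by rewrite ler_wpM2r ?(sn_ge0 sN) ?ler_norm.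
exists (linear_of lP'), (K + `|L| * K * (1 + N w)), (w :: vs).
have LK : 0 <= `|L| * K by rewrite mulr_ge0.
have Nw := sn_ge0 sN w.
split=> [|i a|a|chi a] /=.
- by rewrite addr_ge0// mulr_ge0// addr_ge0.
- rewrite linearB linearZ_LR ltnS leq_eqVlt => /predU1P[->|ilt].
    by rewrite tw -[_ *: 1]/(_ * 1) mulr1 subrr.
  by rewrite (tP i)// (twi i)// scaler0 subrr.
- apply: le_trans (sn_leB sN _ _) _; rewrite (snZ sN) mulrDl lerD//.
  rewrite mulrAC; apply: le_trans (ler_wpM2r Nw (tPL a)) _.
  by rewrite ler_wpM2l ?mulr_ge0 ?(sn_ge0 sN)//; lra.
- rewrite opprB [_ *: w - P a]addrC addrA linearD linearZ_LR big_cons.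
  apply: le_trans (le_normcD _ _) _.
  have S0 : 0 <= \sum_(v <- vs) normc (chi v).
    by apply: sumr_ge0 => v _; exact: normc_ge0.
  have h1 := chiP chi a.
  have h2 : normc (theta n (P a) *: chi w) <= `|L| * K * N a * normc (chi w).
    rewrite -[_ *: _]/(theta n (P a) * chi w) normcM.
    by rewrite ler_wpM2r ?normc_ge0.
  have c0 := normc_ge0 (chi w).
  have a0 := sn_ge0 sN a.
  apply: le_trans (lerD h1 h2) _.
  rewrite [X in _ <= X](_ : _ = K * N a * (\sum_(v <- vs) normc (chi v)) +
    `|L| * K * N a * normc (chi w) + (K * N a * normc (chi w) +
    `|L| * K * N w * N a * normc (chi w) +
    `|L| * K * (1 + N w) * N a * (\sum_(v <- vs) normc (chi v)))); last by ring.
  by rewrite lerDl !addr_ge0// !mulr_ge0// addr_ge0.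
Qed.

Variables (psi : nat -> {linear A -> R[i]^o}) (B : R) (U : set_system nat) (eps : R).
Hypothesis psiB : forall n a, normc (psi n a) <= B * N a.
Hypothesis UU : UltraFilter U.
Hypothesis eps0 : 0 < eps.
Hypothesis psi_sep : forall m, U [set n | exists2 a, N a <= 1 &
  eps <= normc (psi n a - psi m a)].

Let Up : ProperFilter U := @ultra_proper _ _ UU.

Let filter_lt (k : nat) (S : nat -> set nat) :
  (forall j, (j < k)%N -> U (S j)) -> U [set m | forall j, (j < k)%N -> S j m].
Proof.
elim: k => [|k IH] H; first exact: filterE.
have := @filterI _ _ Up _ _ (IH (fun j jk => H j (ltnW jk))) (H k (ltnSn k)).
apply: filterS => m [h1 h2] j; rewrite ltnS leq_eqVlt => /predU1P[->//|].
exact: h1.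
Qed.

(** The weak-star limit along [U], obtained pointwise from the compactness of closed bounded sets of
    scalars. *)
Lemma ultra_functional : exists2 phi : {linear A -> R[i]^o},
  forall a, normc (phi a) <= B * N a &
  forall a, tends (@normc R : R[i]^o -> R) U (fun n => psi n a) (phi a).
Proof.
have /choice[phi phiP] a : exists l,
    tends (@normc R : R[i]^o -> R) U (fun n => psi n a) l.
  by apply: ultra_tends => n; exact: psiB.
have lphi : linear phi.
  move=> b x y; apply/eqP; rewrite -subr_eq0 -normc_eq0; apply/eqP.
  apply: (tends_N0 sC (phiP _)).
  apply: (tends_eq (x := fun n => b * psi n x + psi n y)).
    by apply: filterE => n; rewrite /mkset linearP.
  apply: tendsD (phiP y) => //.
  have lm : linear (fun v : R[i]^o => b * v : R[i]^o).
    by move=> c u v; rewrite mulrDr; congr (_ + _); exact: mulrCA.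
  apply: (@tends_map _ _ (@normc R) sC _ U Up _ (@normc R) (linear_of lm) (normc b)) (phiP x).
  by move=> v; rewrite -normcM.
exists (linear_of lphi) => // a /=.
by apply: (tends_le sC _ (phiP a)); apply: filterE => n /=; exact: psiB.
Qed.

Lemma ultra_sum_small (phi : {linear A -> R[i]^o}) (vs : seq A) e : 0 < e ->
  (forall a, tends (@normc R : R[i]^o -> R) U (fun n => psi n a) (phi a)) ->
  U [set n | \sum_(v <- vs) normc (psi n v - phi v) < e].
Proof.
move=> e0 phiP; elim: vs e e0 => [|v vs IH] e e0.
  by apply: filterE => n /=; rewrite big_nil.
have e2 : 0 < e / 2 by rewrite divr_gt0.
apply: filterS2 (phiP v _ e2) (IH _ e2) => n /= h1 h2; rewrite big_cons; lra.
Qed.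

(** Two members of [S] are close to the limit on [vs], hence to each other at every [a - P a] with
    [a] in the unit ball, yet they differ by [eps] at some such [a]. So they differ at [P a], and
    one of them has modulus at least [eps / 4] there. As [C] is chosen before [S], the condition
    imposed on [m] through [S] may depend on [C]. *)
Lemma uniform_peak (theta : nat -> {linear A -> R[i]^o}) n :
  (forall i, exists K, forall a, normc (theta i a) <= K * N a) ->
  exists2 C, 0 < C & forall S, U S -> exists2 m, S m & exists h,
    [/\ forall i, (i < n)%N -> theta i h = 0, psi m h = 1 & N h <= C].
Proof.
move=> /(annihilating_projection n)[P [K [vs [K0 tP PK chiP]]]].
have [phi _ phiP] := ultra_functional.
have K1 : 0 < K + 1 by rewrite ltr_wpDl.
(* [N (P a)] is at most [K + 1], and [P a] will be divided by a value of modulus at least [eps / 4].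
   Below, [eta] is such that [(K + 1) * (2 * eta) = eps / 4]. *)
exists (4 * (K + 1) / eps); first by rewrite divr_gt0// mulr_gt0.
move=> S US; set eta := eps / (8 * (K + 1)).
have eta0 : 0 < eta by rewrite divr_gt0// mulr_gt0.
have UT := @filterI _ _ Up _ _ US (ultra_sum_small vs eta0 phiP).
have [m [Sm mvs]] := @filter_ex _ _ Up _ UT.
have [m' [[Sm' m'vs] [a a1 asep]]] :=
  @filter_ex _ _ Up _ (@filterI _ _ Up _ _ UT (psi_sep m)).
have lchi : linear (fun x => psi m' x - psi m x).
  by move=> b x y; rewrite (linearP (psi m')) (linearP (psi m)) scalerBr opprD addrACA.
have := chiP (linear_of lchi) a; rewrite /= => chia.
have sum2 : \sum_(v <- vs) normc (psi m' v - psi m v) <= 2 * eta.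
  apply: (@le_trans _ _ (\sum_(v <- vs) (normc (psi m' v - phi v) + normc (psi m v - phi v)))).
    by apply: ler_sum => v _; rewrite [X in _ <= _ + X](snC sC); exact: (sn_tri sC).
  by rewrite big_split /=; move: mvs m'vs => /=; lra.
have : normc (psi m' (a - P a) - psi m (a - P a)) <= eps / 4.
  apply: le_trans chia _.
  apply: (@le_trans _ _ ((K + 1) * (2 * eta))).
    apply: ler_pM => //; first by rewrite mulr_ge0 ?(sn_ge0 sN).
      by apply: sumr_ge0 => v _; exact: normc_ge0.
    by apply: (@le_trans _ _ (K * 1)); [rewrite ler_wpM2l|lra].
  by rewrite /eta le_eqVlt; apply/orP; left; apply/eqP; field; rewrite lt0r_neq0.
rewrite (linearB (psi m')) (linearB (psi m)) => small.
have big : eps / 2 <= normc (psi m' (P a)) + normc (psi m (P a)).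
  have h := sn_leB sC (psi m' (P a)) (psi m (P a)).
  have := sn_le sC (psi m' a - psi m a - (psi m' (P a) - psi m (P a))) (psi m' (P a) - psi m (P a)).
  rewrite subrK => h'.
  have aux (p q r : R) : 0 < eps -> eps <= p + q -> p <= eps / 4 -> q <= r -> eps / 2 <= r by lra.
  by apply: aux eps0 (le_trans asep h') _ h; rewrite -subr_swap.
have [m0 Sm0 m0big] : exists2 m0, S m0 & eps / 4 <= normc (psi m0 (P a)).
  have [h|h] := leP (eps / 4) (normc (psi m (P a))); first by exists m.
  exists m' => //.
  have aux (p q : R) : eps / 2 <= p + q -> q < eps / 4 -> eps / 4 <= p by lra.
  exact: aux big h.
exists m0 => //; have p0 : 0 < normc (psi m0 (P a)) by apply: lt_le_trans m0big; rewrite divr_gt0.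
exists ((psi m0 (P a))^-1 *: P a); split.
- by move=> i ilt; rewrite linearZ_LR tP// scaler0.
- by rewrite linearZ_LR -[LHS]/(_ * _) mulVf// -normc_gt0.
- rewrite (snZ sN) normcV ler_pdivrMl//.
  apply: (@le_trans _ _ (K + 1)).
    apply: le_trans (PK a) _; apply: (@le_trans _ _ (K * 1)); [rewrite ler_wpM2l//|lra].
  rewrite -[leLHS](_ : eps / 4 * (4 * (K + 1) / eps) = _).
    by rewrite ler_wpM2r// divr_ge0 ?mulr_ge0 ?ltW.
  by field; rewrite lt0r_neq0.
Qed.

(* Gliding hump: all corrections stay in the kernel of the limit functional
   [phi], so that later functionals [psi m] are small on them. *)
Theorem biorthogonal_subsequence : exists (nn : nat -> nat) (a : nat -> A),
  forall i j, psi (nn i) (a j) = (i == j)%:R.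
Proof.
have [phi phiB phiP] := ultra_functional.
pose Inv k (s : (nat -> nat) * (nat -> A)) :=
  (forall i j, (i < k)%N -> (j < k)%N -> psi (s.1 i) (s.2 j) = (i == j)%:R) /\
  forall j, (j < k)%N -> phi (s.2 j) = 0.
have step (t : nat * ((nat -> nat) * (nat -> A))) :
    exists s : (nat -> nat) * (nat -> A), Inv t.1 t.2 ->
    [/\ Inv t.1.+1 s, forall i, (i < t.1)%N -> s.1 i = t.2.1 i &
        forall j, (j < t.1)%N -> N (s.2 j - t.2.2 j) <= half_pow R t.1].
  case: t => k [nn a] /=; have [[I1 I2]|] := pselect (Inv k (nn, a)); last first.
    by exists (nn, a).
  rewrite /= in I1 I2.
  (* The functionals chosen so far, and [phi] at index [k]; hence the [k.+1] below. *)
  pose theta i := if (i < k)%N then psi (nn i) else phi.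
  have [|C C0 HC] := @uniform_peak theta k.+1.
    by move=> i; exists B => x; rewrite /theta; case: ifP.
  (* As [phi] vanishes at the old vectors, [psi m] can be required to be so small there that the
     corrections [psi m (a j) *: h] have norm at most [half_pow k]. *)
  have [|m Sm [h [th ph hC]]] := HC [set m | forall j, (j < k)%N ->
      normc (psi m (a j)) < half_pow R k / C].
    apply: filter_lt => j jk.
    have := phiP (a j) _ (divr_gt0 (half_pow_gt0 R k) C0); rewrite I2//.
    by apply: filterS => n /=; rewrite subr0.
  (* The correction makes [psi m] vanish at the old vectors; earlier values are unchanged because
     the earlier functionals annihilate [h]. *)
  exists (fun i => if (i < k)%N then nn i else m,
          fun j => if (j < k)%N then a j - psi m (a j) *: h else h) => _.
  have psih i : (i < k)%N -> psi (nn i) h = 0.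
    by move=> ik; have := th i (ltnW ik); rewrite /theta ik.
  have phih : phi h = 0 by have := th k (ltnSn k); rewrite /theta ltnn.
  split; [split|by move=> i /= ->|].
  - move=> i j /=; rewrite (ltnS i) (ltnS j) (leq_eqVlt i) (leq_eqVlt j).
    have [-> _|_ /= ik] := eqVneq i k; have [-> _|jk /= jk'] := eqVneq j k.
    + by rewrite ltnn ph ?eqxx.
    + by rewrite ltnn jk' linearB linearZ_LR ph -[_ *: 1]/(_ * 1) mulr1 subrr.
    + by rewrite ltnn ik psih// ?(ltn_eqF ik).
    + by rewrite ik jk' linearB linearZ_LR psih// scaler0 subr0 I1.
  - move=> j /=; case: ifP => [jk _|//].
    by rewrite linearB linearZ_LR phih scaler0 subr0 I2.
  - move=> j /= jk; rewrite jk addrAC subrr sub0r (snN sN) (snZ sN).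
    have := Sm j jk; rewrite ltr_pdivlMr// => /ltW; apply: le_trans.
    by rewrite ler_wpM2l ?normc_ge0.
have [g gP] := choice step.
pose st := fix st k := if k is k'.+1 then g (k', st k') else (fun=> 0%N, fun=> 0).
have stI k : Inv k (st k).
  by elim: k => [|k IH] /=; [split|have [] := gP (k, st k) IH].
have stS k : [/\ forall i, (i < k)%N -> (st k.+1).1 i = (st k).1 i &
    forall j, (j < k)%N -> N ((st k.+1).2 j - (st k).2 j) <= half_pow R k].
  by have [] := gP (k, st k) (stI k).
pose nn i := (st i.+1).1 i.
have stnn i k : (i < k)%N -> (st k).1 i = nn i.
  elim: k => // k IH; rewrite ltnS leq_eqVlt => /predU1P[->//|ik].
  by have [h _] := stS k; rewrite h//; exact: IH.
(* Indices are fixed once chosen, but the vectors keep moving; the [j]-th one is present from stage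
   [j.+1] on. *)
have lim j : exists l, tends N \oo (fun k => (st (j.+1 + k)%N).2 j) l.
  have [|l [xl _]] := @fast_cauchy _ _ _ bN (fun k => (st (j.+1 + k)%N).2 j).
    move=> k; rewrite addnS; have [_ h] := stS (j.+1 + k)%N.
    apply: le_trans (h j _) _; first by rewrite addSn ltnS leq_addr.
    by rewrite /half_pow exprD ler_piMl// ?exprn_ge0// exprn_ile1// invf_le1// ler1n.
  by exists l.
have [a aP] := choice lim; exists nn, a => i j.
apply/eqP; rewrite -subr_eq0 -normc_eq0; apply/eqP.
apply: (tends_N0 sC (F := \oo) (tends_map sN (psiB (nn i)) (aP j))).
apply: (tends_eq (x := fun=> (i == j)%:R)); last exact: tends_cst.
exists i.+1 => // k /= ik; rewrite -(stnn i (j.+1 + k)%N); last first.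
  by apply: leq_trans ik _; exact: leq_addl.
have [h _] := stI (j.+1 + k)%N; rewrite h//; last by rewrite addSn ltnS leq_addr.
by apply: leq_trans ik _; exact: leq_addl.
Qed.

End Biorthogonal.

(** * Finite dimension and finite codimension *)

Section RowSubspaces.
Variables (K : fieldType) (n : nat).

(** Take a matrix of greatest rank with row space in [S]: adjoining a vector of [S] to its row space
    cannot raise the rank. *)
Lemma subspace_mx (S : set 'rV[K]_n) :
  S 0 -> (forall a u v, S u -> S v -> S (a *: u + v)) ->
  exists U : 'M[K]_n, forall v, S v <-> (v <= U)%MS.
Proof.
move=> S0 SD.
pose P k := `[< exists2 U : 'M[K]_n, (forall v, (v <= U)%MS -> S v) & \rank U = k >].
have exP : exists k, P k.
  exists 0%N; apply/asboolP; exists 0; last exact: mxrank0.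
  by move=> v; rewrite submx0 => /eqP ->.
have leP k : P k -> (k <= n)%N by move=> /asboolP[U _ <-]; exact: rank_leq_row.
have [k /asboolP[U US rU] kmax] := ex_maxnP exP leP.
exists U => v; split=> [Sv|]; last exact: US.
have : P (\rank (U + v)%MS).
  apply/asboolP; exists (U + v)%MS => // w /sub_addsmxP[[a b] /= ->].
  rewrite addrC [b]mx11_scalar mul_scalar_mx; apply: SD => //.
  by apply: US; exact: submxMl.
move=> /kmax; rewrite -rU => le.
have : (U == U + v)%MS.
  by rewrite -(mxrank_leqif_eq (addsmxSl U v)) eqn_leq le mxrankS ?addsmxSl.
by move=> /eqmxP ->; exact: addsmxSr.
Qed.

Lemma descending_subspaces (S : nat -> set 'rV[K]_n) :
  (forall j, S j 0) -> (forall j a u v, S j u -> S j v -> S j (a *: u + v)) ->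
  (forall j, S j.+1 `<=` S j) ->
  exists j0, forall j, (j0 <= j)%N -> S j0 `<=` S j.
Proof.
move=> S0 SD SS.
have /choice[U UP] j : exists U : 'M[K]_n, forall v, S j v <-> (v <= U)%MS.
  by apply: subspace_mx => //; exact: SD.
have Sle i j : (i <= j)%N -> S j `<=` S i.
  elim: j => [|j IH]; first by rewrite leqn0 => /eqP ->.
  rewrite leq_eqVlt => /predU1P[->//|ij]; apply: subset_trans (SS _) (IH _).
  by rewrite -ltnS.
pose P k := `[< exists j, \rank (U j) = k >].
have exP : exists k, P k by exists (\rank (U 0%N)); apply/asboolP; exists 0%N.
have [k /asboolP[j0 rj0] kmin] := ex_minnP exP.
exists j0 => j j0j v /UP vU.
have sub : (U j <= U j0)%MS.
  apply/row_subP => i; apply/UP/(Sle _ _ j0j)/UP; exact: row_sub.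
have : (U j == U j0)%MS.
  rewrite -(mxrank_leqif_eq sub) eqn_leq mxrankS//= rj0 kmin//.
  by apply/asboolP; exists j.
by move=> /eqmxP eqU; apply/UP; rewrite eqU.
Qed.

End RowSubspaces.

Section FiniteDim.
Variables (R : realType) (X : lmodType R[i]) (N : X -> R).
Hypothesis bN : banach N.
Let sN : seminorm N. Proof. by case: bN. Qed.
Implicit Types (Y M : set X).

Definition bounded_fun (f : {linear X -> R[i]^o}) := exists K, forall x, normc (f x) <= K * N x.

Definition bounded_map (S : {linear X -> X}) := exists K, forall x, N (S x) <= K * N x.

Definition biorthogonal n (v : nat -> X) (f : nat -> {linear X -> R[i]^o}) :=
  (forall i, bounded_fun (f i)) /\
  forall i j, (i < n)%N -> (j < n)%N -> f i (v j) = (i == j)%:R.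

(** Dimension and codimension are both measured by finite biorthogonal systems, with the vectors in
    [Y] here and the functionals annihilating [Y] below. One infinite biorthogonal sequence can then
    witness both. *)
Definition inf_dim Y := forall n, exists v f, biorthogonal n v f /\ forall i, (i < n)%N -> Y (v i).

Definition inf_codim Y := forall n, exists v f,
  biorthogonal n v f /\ forall i y, (i < n)%N -> Y y -> f i y = 0.

Definition norm_closed Y := forall x, (forall e, 0 < e -> exists2 y, Y y & N (x - y) < e) -> Y x.

Lemma bounded_fun_ge0 (f : {linear X -> R[i]^o}) : bounded_fun f ->
  exists2 K, 0 <= K & forall x, normc (f x) <= K * N x.
Proof.
move=> [K fK]; exists `|K| => // x; apply: le_trans (fK x) _.
by rewrite ler_wpM2r ?(sn_ge0 sN)// ler_norm.
Qed.

Lemma bounded_map_ge0 (S : {linear X -> X}) : bounded_map S ->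
  exists2 K, 0 < K & forall x, N (S x) <= K * N x.
Proof.
move=> [K fK]; exists (`|K| + 1) => [|x]; first by rewrite ltr_wpDl.
apply: le_trans (fK x) _.
by rewrite ler_wpM2r ?(sn_ge0 sN)//; have := ler_norm K; lra.
Qed.

Lemma bounded_fun_lin (a : R[i]) (f g : {linear X -> R[i]^o}) : bounded_fun f -> bounded_fun g ->
  exists2 h : {linear X -> R[i]^o}, bounded_fun h & forall x, h x = a * f x + g x.
Proof.
move=> [K fK] [L gL].
have lh : linear (fun x => a * f x + g x : R[i]^o).
  move=> b x y; rewrite (linearP f) (linearP g).
  rewrite -[LHS]/(a * (b * f x + f y) + (b * g x + g y)).
  rewrite -[RHS]/(b * (a * f x + g x) + (a * f y + g y)); ring.
exists (linear_of lh) => //; exists (normc a * K + L) => x /=.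
apply: le_trans (le_normcD _ _) _.
by rewrite mulrDl lerD// normcM -mulrA ler_wpM2l ?normc_ge0.
Qed.

Lemma bounded_fun0 : exists2 h : {linear X -> R[i]^o}, bounded_fun h & forall x, h x = 0.
Proof.
have l0 : linear (fun _ : X => 0 : R[i]^o) by move=> a x y; rewrite scaler0 addr0.
by exists (linear_of l0) => //; exists 0 => x; rewrite mul0r -(normc0 R).
Qed.

Lemma bounded_fun_sum n (c : nat -> R[i]) (f : nat -> {linear X -> R[i]^o}) :
  (forall i, bounded_fun (f i)) -> exists2 h : {linear X -> R[i]^o}, bounded_fun h &
  forall x, h x = \sum_(i < n) c i * f i x.
Proof.
move=> bf; elim: n => [|n [h bh hE]].
  by have [h bh hE] := bounded_fun0; exists h => // x; rewrite hE big_ord0.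
have [h' bh' hE'] := bounded_fun_lin (c n) (bf n) bh.
by exists h' => // x; rewrite hE' hE big_ord_recr /= addrC.
Qed.

Lemma biorthogonal_ext n v f x g : biorthogonal n v f -> bounded_fun g ->
  (forall i, (i < n)%N -> g (v i) = 0) -> (forall i, (i < n)%N -> f i x = 0) ->
  g x = 1 ->
  biorthogonal n.+1 (fun i => if i == n then x else v i) (fun i => if i == n then g else f i).
Proof.
move=> [bf vf] bg gv fx gx; split=> [i|i j]; first by case: eqP.
rewrite (ltnS i) (ltnS j) (leq_eqVlt i) (leq_eqVlt j).
have [->|ni] := eqVneq i n; have [->|nj] := eqVneq j n => //=.
- by move=> _ jn; exact: gv.
- by move=> ilt _; rewrite (negPf ni) fx.
- exact: vf.
Qed.

Section bior_decomp.
Variables (n : nat) (v : nat -> X) (f : nat -> {linear X -> R[i]^o}).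
Hypothesis vf : biorthogonal n v f.

(** The projection onto the span of [v] along the common kernel of [f]. *)
Definition biorth_proj (x : X) := \sum_(i < n) f i x *: v i.

Lemma biorth_proj_linear : linear biorth_proj.
Proof.
move=> a x y; rewrite /biorth_proj scaler_sumr -big_split /=; apply: eq_bigr => i _.
by rewrite (linearP (f i)) scalerDl scalerA.
Qed.

Lemma biorth_proj_f i x : (i < n)%N -> f i (biorth_proj x) = f i x.
Proof.
move=> ilt; rewrite /biorth_proj linear_sum (bigD1 (Ordinal ilt))//= linearZ_LR.
rewrite vf.2// eqxx -[_ *: _]/(_ * 1) mulr1 big1 ?addr0// => j ij.
rewrite linearZ_LR vf.2// (_ : (i == j) = false) ?scaler0//.
by apply/negbTE; apply: contra ij => /eqP e; apply/eqP/val_inj.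
Qed.

Lemma biorth_proj_bounded : exists2 K, 0 <= K & forall x, N (biorth_proj x) <= K * N x.
Proof.
rewrite /biorth_proj; elim: n => [|m [K K0 IH]].
  by exists 0 => // x; rewrite big_ord0 (sn0 sN) mul0r.
have [L L0 fL] := bounded_fun_ge0 (vf.1 m).
exists (K + L * N (v m)) => [|x]; first by rewrite addr_ge0// mulr_ge0 ?(sn_ge0 sN).
rewrite big_ord_recr /= (le_trans (sn_le sN _ _))// mulrDl lerD//.
by rewrite (snZ sN) mulrAC ler_wpM2r ?(sn_ge0 sN).
Qed.

Lemma biorth_compl_fun g : bounded_fun g -> exists2 g', bounded_fun g' &
  (forall x, g' x = g (x - biorth_proj x)).
Proof.
move=> bg; have [h bh hE] := bounded_fun_sum n (fun i => g (v i)) vf.1.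
have [g' bg' gE] := bounded_fun_lin (-1) bh bg; exists g' => // x.
rewrite gE hE linearB mulN1r addrC; congr (_ - _).
rewrite linear_sum; apply: eq_bigr => i _; rewrite linearZ_LR.
by rewrite mulrC.
Qed.

Lemma biorth_proj_v i : (i < n)%N -> biorth_proj (v i) = v i.
Proof.
move=> ilt; rewrite /biorth_proj (bigD1 (Ordinal ilt))//= vf.2// eqxx scale1r.
rewrite big1 ?addr0// => j ij; rewrite vf.2// (_ : (_ == i) = false) ?scale0r//.
by apply/negbTE; apply: contra ij => /eqP e; apply/eqP/val_inj.
Qed.

End bior_decomp.

Lemma subspace_sum Y n (c : nat -> R[i]) (v : nat -> X) : lin_subspace Y ->
  (forall i, (i < n)%N -> Y (v i)) -> Y (\sum_(i < n) c i *: v i).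
Proof.
move=> [Y0 YD] Yv; elim: n Yv => [|n IH] Yv; first by rewrite big_ord0.
rewrite big_ord_recr /= addrC; apply: YD; first exact: Yv.
by apply: IH => i ilt; apply: Yv; exact: ltnW.
Qed.

Lemma subspaceB Y x y : lin_subspace Y -> Y x -> Y y -> Y (x - y).
Proof. by move=> [_ YD] Yx Yy; rewrite addrC -scaleN1r; exact: YD. Qed.

(** Subtracting its projection makes [y] annihilated by every [f i]. The functional given by
    Hahn-Banach is in turn composed with the complementary projection, so as to vanish at every
    [v i]. *)
Lemma biorthogonal_extend Y n v f y : lin_subspace Y -> biorthogonal n v f ->
  (forall i, (i < n)%N -> Y (v i)) -> Y y -> y != biorth_proj n v f y ->
  exists x g, Y x /\ biorthogonal n.+1 (fun i => if i == n then x else v i)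
     (fun i => if i == n then g else f i).
Proof.
move=> sY vf Yv Yy; rewrite -subr_eq0; set x := y - _ => x0.
have Nx : 0 < N x.
  by rewrite lt_neqAle (sn_ge0 sN) andbT eq_sym (banach_eq0 bN).
have Yx : Y x by apply: (subspaceB sY Yy); exact: (subspace_sum (fun i => f i y) sY Yv).
have fx i : (i < n)%N -> f i x = 0 by move=> ilt; rewrite linearB (biorth_proj_f vf)// subrr.
have [g [bg _ gx]] : exists g : {linear X -> R[i]^o},
    [/\ exists K, forall z, normc (g z) <= K * N z, forall z, [set 0] z -> g z = 0 & g x = 1].
  apply: (hahn_banach_sep sN (d := N x)) => //.
    by split=> // a _ _ -> ->; rewrite scaler0 addr0.
  by move=> _ ->; rewrite subr0.
have [g' bg' gE] := biorth_compl_fun vf bg.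
have g'x : g' x = 1.
  rewrite gE -[RHS]gx; congr (g _); rewrite (_ : biorth_proj n v f x = 0) ?subr0//.
  by apply: big1 => i _; rewrite fx// scale0r.
exists x, g'; split=> //; apply: biorthogonal_ext => // i ilt.
by rewrite gE (biorth_proj_v vf)// subrr linear0.
Qed.

Lemma ex_max_nat (P : nat -> Prop) : P 0%N -> ~ (forall n, P n) -> exists2 n, P n & ~ P n.+1.
Proof.
move=> P0 nP; apply: contrapT => H; apply: nP; elim=> // n Pn.
by apply: contrapT => nPn; apply: H; exists n.
Qed.

Lemma findim_basis Y : lin_subspace Y -> ~ inf_dim Y -> exists n v f,
  [/\ biorthogonal n v f, forall i, (i < n)%N -> Y (v i) & forall y, Y y -> y = biorth_proj n v f y].
Proof.
move=> sY nY; have [|n [v [f [vf Yv]]] nS] := @ex_max_nat (fun n => exists v f,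
    biorthogonal n v f /\ forall i, (i < n)%N -> Y (v i)) _ nY.
  by have [h bh _] := bounded_fun0; exists (fun=> 0), (fun=> h); split=> //; split.
exists n, v, f; split=> // y Yy; apply/eqP; apply: contrapT => /negP yn.
have [x [g [Yx xg]]] := biorthogonal_extend sY vf Yv Yy yn.
apply: nS; exists (fun i => if i == n then x else v i), (fun i => if i == n then g else f i).
split=> // i; rewrite ltnS leq_eqVlt; case: eqP => //= _; exact: Yv.
Qed.

Lemma norm_closed_dist Y x : norm_closed Y -> ~ Y x -> exists2 d, 0 < d & forall y, Y y -> d <= N (x - y).
Proof.
move=> cY nYx; apply: contrapT => H; apply: nYx; apply: cY => e e0.
apply: contrapT => H'; apply: H; exists e => // y Yy; rewrite leNgt.
by apply/negP => lt; apply: H'; exists y.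
Qed.

(** A maximal system of functionals annihilating [Y] cuts out exactly [Y]: a common zero outside the
    closed [Y] could be separated from it and adjoined to the system. *)
Lemma fincodim_basis Y : lin_subspace Y -> norm_closed Y -> ~ inf_codim Y -> exists n v f,
  biorthogonal n v f /\ Y = [set x | forall i, (i < n)%N -> f i x = 0].
Proof.
move=> sY cY nY; have [|n [v [f [vf Yv]]] nS] := @ex_max_nat (fun n => exists v f,
    biorthogonal n v f /\ forall i y, (i < n)%N -> Y y -> f i y = 0) _ nY.
  by have [h bh _] := bounded_fun0; exists (fun=> 0), (fun=> h); split=> //; split.
exists n, v, f; split=> //; apply/seteqP; split=> [y Yy i ilt|x /= fx]; first exact: Yv.
apply: contrapT => nYx; have [d d0 dY] := norm_closed_dist cY nYx.
have [g [bg gY gx]] := hahn_banach_sep sN sY d0 dY.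
have [g' bg' gE] := biorth_compl_fun vf bg.
have b0 z : (forall i, (i < n)%N -> f i z = 0) -> biorth_proj n v f z = 0.
  by move=> fz; apply: big1 => i _; rewrite fz// scale0r.
have g'x : g' x = 1 by rewrite gE b0// subr0.
apply: nS; exists (fun i => if i == n then x else v i), (fun i => if i == n then g' else f i).
split.
  by apply: biorthogonal_ext => // i ilt; rewrite gE (biorth_proj_v vf)// subrr linear0.
move=> i y; rewrite ltnS leq_eqVlt; case: eqP => [_ _|_ /= ilt] Yy; last exact: Yv.
by rewrite gE b0 ?subr0 ?gY// => j jlt; exact: Yv.
Qed.

(** A biorthogonal system of length [n.+1] in the span of [n] vectors would factor the identity
    matrix of size [n.+1] through size [n]. *)
Lemma spanned_not_inf_dim Y n (w : nat -> X) :
  (forall y, Y y -> exists c : nat -> R[i], y = \sum_(i < n) c i *: w i) -> ~ inf_dim Y.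
Proof.
move=> H /(_ n.+1)[v [f [[bf vf] Yv]]].
have /choice[c cP] (j : 'I_n.+1) : exists c : nat -> R[i], v j = \sum_(i < n) c i *: w i.
  by apply: H; exact: Yv.
pose A : 'M[R[i]]_(n.+1, n) := \matrix_(j, k) c j k.
pose B : 'M[R[i]]_(n, n.+1) := \matrix_(k, i) f i (w k).
have AB : A *m B = 1%:M.
  apply/matrixP => j i; rewrite !mxE eq_sym -[RHS](vf i j)// cP linear_sum.
  by apply: eq_bigr => k _; rewrite !mxE linearZ_LR.
have := mxrankM_maxl A B; rewrite AB mxrank1 => /leq_trans/(_ (rank_leq_col A)).
by rewrite ltnn.
Qed.

(** Some nontrivial combination of [n.+1] vectors is killed by the [n] functionals [h], whereas the
    functionals of a biorthogonal system read off its coefficients. *)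
Lemma common_ker_not_inf_codim n (h : nat -> {linear X -> R[i]^o}) :
  ~ inf_codim [set x | forall i, (i < n)%N -> h i x = 0].
Proof.
move=> /(_ n.+1)[v [f [[bf vf] fY]]].
pose A : 'M[R[i]]_(n.+1, n) := \matrix_(j, k) h k (v j).
have /rowV0Pn[u /sub_kermxP uA u0] : kermx A != 0.
  by rewrite kermx_eq0 -row_leq_rank -ltnNge ltnS rank_leq_col.
move/eqP: u0; apply; apply/rowP => i; rewrite mxE.
pose x := \sum_(j < n.+1) u 0 j *: v j.
have <- : f i x = u 0 i.
  rewrite linear_sum (bigD1 i)//= linearZ_LR vf// eqxx -[_ *: _]/(_ * 1) mulr1.
  rewrite big1 ?addr0// => j ij; rewrite linearZ_LR vf//.
  rewrite (_ : (_ == _) = false) ?scaler0//.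
  by apply/negbTE; apply: contra ij => /eqP e; apply/eqP/val_inj.
apply: fY => // k klt; rewrite linear_sum.
transitivity ((u *m A) 0 (Ordinal klt)); last by rewrite uA mxE.
by rewrite mxE; apply: eq_bigr => j _; rewrite mxE linearZ_LR.
Qed.

End FiniteDim.

(** * Invertibility modulo finite codimension *)

Section Invertibility.
Variables (R : realType) (X : lmodType R[i]) (N : X -> R).
Hypothesis bN : banach N.
Let sN : seminorm N. Proof. by case: bN. Qed.
Implicit Types (M : set X) (l : R[i]).

Lemma bounded_map_comp (S S' : {linear X -> X}) : bounded_map N S -> bounded_map N S' -> bounded_map N (S \o S').
Proof.
move=> /(bounded_map_ge0 bN)[K K0 SK] [K' SK']; exists (K * K') => x /=.
by apply: le_trans (SK _) _; rewrite -mulrA ler_pM2l//; exact: SK'.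
Qed.

Lemma bounded_map_lin (a : R[i]) (S S' : {linear X -> X}) : bounded_map N S -> bounded_map N S' ->
  exists2 Q : {linear X -> X}, bounded_map N Q & forall x, Q x = a *: S x + S' x.
Proof.
move=> [K SK] [K' SK'].
have lQ : linear (fun x => a *: S x + S' x).
  move=> b x y; rewrite (linearP S) (linearP S') scalerDr addrACA.
  by rewrite scalerDr !scalerA [a * b]mulrC.
exists (linear_of lQ) => //; exists (normc a * K + K') => x /=.
apply: le_trans (sn_le sN _ _) _.
by rewrite (snZ sN) mulrDl lerD// -mulrA ler_wpM2l ?normc_ge0.
Qed.

Lemma bounded_map_scale (a : R[i]) (S : {linear X -> X}) : bounded_map N S ->
  exists2 Q : {linear X -> X}, bounded_map N Q & forall x, Q x = a *: S x.
Proof.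
move=> [K SK].
have lQ : linear (fun x => a *: S x).
  by move=> b x y; rewrite (linearP S) scalerDr !scalerA [a * b]mulrC.
exists (linear_of lQ) => //; exists (normc a * K) => x /=.
by rewrite (snZ sN) -mulrA ler_wpM2l ?normc_ge0.
Qed.

Lemma bounded_map_id : bounded_map N idfun.
Proof. by exists 1 => x; rewrite mul1r. Qed.

Lemma neumann (B : {linear X -> X}) : (forall x, N (B x) <= 2^-1 * N x) ->
  exists2 V : {linear X -> X}, bounded_map N V &
    forall x, V x - B (V x) = x /\ V (x - B x) = x.
Proof.
move=> Bh.
have inj z : z - B z = 0 -> z = 0.
  move=> /eqP; rewrite subr_eq0 => /eqP zB; apply/eqP; rewrite -(banach_eq0 bN).
  by rewrite eq_le (sn_ge0 sN) andbT; have := Bh z; rewrite -zB; lra.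
have uniq z z' y : z - B z = y -> z' - B z' = y -> z = z'.
  move=> zy z'y; apply/eqP; rewrite -subr_eq0; apply/eqP/inj.
  by rewrite linearB subr_swap zy z'y subrr.
have ex_sol y : exists z, z - B z = y.
  (* Dividing [y] by [c] makes the first increment of the iteration at most 1, as [fast_cauchy]
     requires. *)
  pose c : R[i] := (N y + 1)%:C.
  have Ny : 0 < N y + 1 by rewrite ltr_wpDl ?(sn_ge0 sN).
  have c0 : c != 0 by rewrite -normc_gt0 normc_real normr_gt0 lt0r_neq0.
  pose st := fix st k := if k is k'.+1 then c^-1 *: y + B (st k') else 0.
  have [|l [xl _]] := @fast_cauchy _ _ _ bN st.
    elim=> [|k IH] /=.
      rewrite linear0 addr0 subr0 (snZ sN) normcV normc_real ger0_norm ?(ltW Ny)//.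
      by rewrite /half_pow expr0 ler_pdivrMl// mulr1 lerDl.
    rewrite opprD addrACA subrr add0r -linearB half_powS.
    apply: le_trans (Bh _) _; rewrite mulrC ler_wpM2r//.
  exists (c *: l); rewrite linearZ_LR -scalerBr.
  rewrite (_ : l - B l = c^-1 *: y) ?scalerKV//.
  have Bl : tends N \oo (fun k => c^-1 *: y + B (st k)) (c^-1 *: y + B l).
    apply: tendsD => //; first exact: tends_cst.
    exact: (tends_map sN Bh xl).
  have xl1 : tends N \oo (fun k => st k.+1) l.
    move=> e e0; have [k _ kl] := xl e e0.
    by exists k => // m /= km; exact: (kl m.+1 (leqW km)).
  apply/eqP; rewrite subr_eq eq_sym -subr_eq0 -(banach_eq0 bN); apply/eqP.
  exact: (tends_N0 sN Bl xl1).
have [V VP] := choice ex_sol.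
have lV : linear V.
  move=> a x y; apply: (uniq _ _ (a *: x + y)) => //.
  by rewrite linearP opprD addrACA -scalerBr !VP.
exists (linear_of lV) => [|x] /=.
  exists 2 => x; have := Bh (V x); have := sn_tri sN (B (V x)) (V x) 0.
  by rewrite !subr0 VP; lra.
by split=> //; exact: (uniq _ _ _ (VP _) erefl).
Qed.

End Invertibility.

(** * Closed invariant subspaces of finite codimension *)

Section FiniteCodimensional.
Variables (R : realType) (X : lmodType R[i]) (N : X -> R).
Hypothesis bN : banach N.
Let sN : seminorm N. Proof. by case: bN. Qed.
Variable T : {linear X -> X}.
Hypothesis bT : bounded_map N T.
Implicit Types (M : set X) (l : R[i]).

Definition common_ker n (f : nat -> {linear X -> R[i]^o}) : set X :=
  [set x | forall i, (i < n)%N -> f i x = 0].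

Definition fin_codim_inv M := exists n v f,
  [/\ biorthogonal N n v f, M = common_ker n f & forall x, M x -> M (T x)].

(** The inverse is an operator on all of [X], constrained only on [M]; composing with a projection
    onto [M] relates this to a bounded inverse on [M]. *)
Definition invertible_on M l := exists2 S : {linear X -> X}, bounded_map N S & forall x, M x ->
  [/\ M (S x), T (S x) - l *: S x = x & S (T x - l *: x) = x].

Lemma lin_subspace_common_ker n f : lin_subspace (common_ker n f).
Proof.
split=> [i _|a x y fx fy i ilt]; first exact: linear0.
by rewrite (linearP (f i)) fx// fy// scaler0 addr0.
Qed.

Lemma norm_closed_ker (f : {linear X -> R[i]^o}) : bounded_fun N f -> norm_closed N [set x | f x = 0].
Proof.
move=> /(bounded_fun_ge0 bN)[K K0 fK] x Hx; apply/eqP; rewrite -normc_eq0 eq_le normc_ge0 andbT.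
apply/ler_addgt0Pr => e e0; rewrite add0r.
have K1 : 0 < K + 1 by rewrite ltr_wpDl.
have [y /= fy] := Hx _ (divr_gt0 e0 K1); rewrite ltr_pdivlMr// => xy.
have -> : f x = f (x - y) by rewrite linearB fy subr0.
apply: le_trans (fK _) _; apply: le_trans (ltW xy).
by rewrite mulrC ler_wpM2l ?(sn_ge0 sN)// lerDl.
Qed.

Lemma norm_closed_bigcap (I : Type) (D : set I) (Y : I -> set X) :
  (forall i, D i -> norm_closed N (Y i)) -> norm_closed N [set x | forall i, D i -> Y i x].
Proof.
move=> cY x Hx i Di; apply: cY => // e e0.
by have [y Yy xy] := Hx e e0; exists y => //; exact: Yy.
Qed.

Lemma norm_closed_common_ker n f : (forall i, bounded_fun N (f i)) -> norm_closed N (common_ker n f).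
Proof.
by move=> bf; apply: norm_closed_bigcap => i _; exact: norm_closed_ker.
Qed.

Lemma fin_codim_inv_subspace M : fin_codim_inv M -> lin_subspace M.
Proof. by move=> [n [v [f [_ -> _]]]]; exact: lin_subspace_common_ker. Qed.

Lemma fin_codim_inv_closed M : fin_codim_inv M -> norm_closed N M.
Proof. by move=> [n [v [f [[bf _] -> _]]]]; exact: norm_closed_common_ker. Qed.

Lemma biorth_compl_proj n v f : biorthogonal N n v f -> exists2 P : {linear X -> X}, bounded_map N P &
  forall x, P x = x - biorth_proj n v f x.
Proof.
move=> vf; have lP : linear (fun x => x - biorth_proj n v f x).
  by move=> a x y; rewrite biorth_proj_linear opprD addrACA scalerBr.
exists (linear_of lP) => //; have [K K0 pK] := biorth_proj_bounded bN vf.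
exists (1 + K) => x /=; rewrite (le_trans (sn_leB sN _ _))// mulrDl mul1r.
by rewrite lerD2l.
Qed.

Lemma fin_codim_inv_proj M : fin_codim_inv M -> exists2 P : {linear X -> X}, bounded_map N P &
  (forall x, M (P x)) /\ forall x, M x -> P x = x.
Proof.
move=> [n [v [f [vf -> _]]]]; have [P bP PE] := biorth_compl_proj vf.
exists P => //; split=> [x i ilt|x xM]; rewrite PE.
  by rewrite linearB (biorth_proj_f vf)// subrr.
by rewrite /biorth_proj big1 ?subr0// => i _; rewrite xM ?scale0r.
Qed.

(** Coordinates of the class of [x] modulo [common_ker n f]; they turn operators induced on this
    quotient into matrices acting on row vectors. *)
Definition coords n (f : nat -> {linear X -> R[i]^o}) (x : X) : 'rV[R[i]]_n :=
  \row_(i < n) f i x.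

Lemma coordsP n f a x y : coords n f (a *: x + y) = a *: coords n f x + coords n f y.
Proof. by apply/rowP => i; rewrite !mxE (linearP (f i)). Qed.

Lemma coords_eq0 n f x : coords n f x = 0 <-> common_ker n f x.
Proof.
split=> [/rowP c0 i ilt|k0]; first by have := c0 (Ordinal ilt); rewrite !mxE.
by apply/rowP => i; rewrite !mxE k0.
Qed.

Lemma coords_image n f M : lin_subspace M -> exists U : 'M[R[i]]_n,
  forall u, (u <= U)%MS <-> exists2 x, M x & coords n f x = u.
Proof.
move=> [M0 MD]; have [||U UP] := @subspace_mx R[i] n [set coords n f x | x in M].
- by exists 0 => //; apply/coords_eq0 => i _; exact: linear0.
- by move=> a _ _ [x Mx <-] [y My <-]; exists (a *: x + y); [exact: MD|exact: coordsP].
by exists U => u; rewrite -(UP u).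
Qed.

Lemma fin_codim_inv_mx n v f : biorthogonal N n v f ->
  (forall x, common_ker n f x -> common_ker n f (T x)) ->
  exists A : 'M[R[i]]_n, forall x, coords n f (T x) = coords n f x *m A.
Proof.
move=> vf kT; exists (\matrix_(i, j) f j (T (v i))) => x.
apply/rowP => j; rewrite !mxE.
have : f j (T (x - biorth_proj n v f x)) = 0.
  by apply: kT => // i ilt; rewrite linearB (biorth_proj_f vf)// subrr.
rewrite (linearB T) (linearB (f j)) => /eqP; rewrite subr_eq0 => /eqP ->.
rewrite /biorth_proj !linear_sum; apply: eq_bigr => i _.
by rewrite !mxE (linearZ_LR T) (linearZ_LR (f j)).
Qed.

(** [T - l] maps [M] onto itself, hence also the quotient of [M] by [M']. This quotient has finite
    dimension, so the induced map is injective, and the solution in [M] for a right-hand side in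
    [M'] lies in [M']. *)
Lemma invertible_on_sub M M' l : fin_codim_inv M -> fin_codim_inv M' -> M' `<=` M ->
  invertible_on M l -> invertible_on M' l.
Proof.
move=> fM [n [v [f [vf M'E M'T]]]] M'M [S bS SP]; exists S => // y M'y.
have [MSy TSy STy] := SP y (M'M _ M'y); split=> //.
have [|A AP] := fin_codim_inv_mx vf; first by rewrite -M'E.
have [U UP] := coords_image n f (fin_codim_inv_subspace fM).
pose B := A - l%:M.
have TB x : coords n f (T x - l *: x) = coords n f x *m B.
  by rewrite addrC -scaleNr coordsP AP mulmxBr mul_mx_scalar scaleNr addrC.
have US : (U <= U *m B)%MS.
  apply/row_subP => i; have /UP[x Mx <-] := row_sub i U.
  have [MSx TSx _] := SP x Mx; rewrite -[x]TSx TB submxMr//.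
  by apply/UP; exists (S x).
have /mxrank_injP : \rank (U *m B) = \rank U.
  by apply/eqP; rewrite eqn_leq mxrankM_maxl mxrankS.
move=> /eqP UB0; rewrite M'E; apply/coords_eq0/eqP; rewrite -submx0 -UB0 sub_capmx.
apply/andP; split; first by apply/UP; exists (S y).
apply/sub_kermxP; rewrite -TB TSy; apply/coords_eq0; by rewrite -M'E.
Qed.

Lemma fin_codim_invT : fin_codim_inv setT.
Proof.
have [h bh _] := bounded_fun0 N; exists 0%N, (fun=> 0), (fun=> h); split=> //.
by apply/seteqP; split.
Qed.

(** The two families of functionals together may be dependent, so a biorthogonal system for the
    intersection comes from [fincodim_basis]. *)
Lemma fin_codim_invI M M' : fin_codim_inv M -> fin_codim_inv M' -> fin_codim_inv (M `&` M').
Proof.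
move=> fM fM'; have [[n [v [f [[bf vf] ME MT]]]] [n' [v' [f' [[bf' vf'] M'E M'T]]]]] := (fM, fM').
have [M0 MD] := fin_codim_inv_subspace fM; have [M'0 M'D] := fin_codim_inv_subspace fM'.
have [| | |m [w [g [wg wE]]]] := @fincodim_basis _ _ _ bN (M `&` M').
- by split=> // a x y [Mx M'x] [My M'y]; split; [exact: MD|exact: M'D].
- move=> x Hx; split; [apply: (fin_codim_inv_closed fM)|apply: (fin_codim_inv_closed fM')] => e e0;
    by have [y [My M'y] xy] := Hx e e0; exists y.
- pose h i := if (i < n)%N then f i else f' (i - n)%N.
  rewrite (_ : M `&` M' = common_ker (n + n') h); first exact: common_ker_not_inf_codim.
  rewrite ME M'E; apply/seteqP; split=> x.
    move=> [fx f'x] i ilt; rewrite /h; case: ltnP => ni; first exact: fx.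
    by apply: f'x; rewrite ltn_subLR.
  move=> hx; split=> i ilt.
    by have := hx i (ltn_addr _ ilt); rewrite /h ilt.
  have := hx (n + i)%N; rewrite ltn_add2l /h addKn.
  have -> : (n + i < n)%N = false by rewrite ltnNge leq_addr.
  by apply.
by exists m, w, g; split=> // x [Mx M'x]; split; [exact: MT|exact: M'T].
Qed.

(** On [M], [T - l'] is [T - l] times [1 - (l' - l) S]. With [S] preceded by the projection onto
    [M], the second factor is inverted on all of [X] by [neumann], and its inverse preserves [M]. *)
Lemma invertible_on_near M l : fin_codim_inv M -> invertible_on M l ->
  exists2 r, 0 < r & forall l', normc (l' - l) < r -> invertible_on M l'.
Proof.
move=> fM [S bS SP]; have [P bP [MP PM]] := fin_codim_inv_proj fM.
have [M0 MD] := fin_codim_inv_subspace fM.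
have [K K0 SPK] := bounded_map_ge0 bN (bounded_map_comp bN bS bP).
exists (2 * K)^-1; first by rewrite invr_gt0 mulr_gt0.
move=> l' ll'.
have [B bB BE] := bounded_map_scale bN (l' - l) (bounded_map_comp bN bS bP).
have {}BE x : B x = (l' - l) *: S (P x) by rewrite BE.
have [|V bV VP] := neumann bN (B := B).
  move=> x; rewrite BE (snZ sN); apply: (@le_trans _ _ (normc (l' - l) * (K * N x))).
    by rewrite ler_wpM2l ?normc_ge0//; exact: SPK.
  rewrite mulrA ler_wpM2r ?(sn_ge0 sN)// -ler_pdivlMr//.
  by apply: le_trans (ltW ll') _; rewrite invfM.
have MS x : M x -> M (S x) by move=> /SP[].
have MV x : M x -> M (V x).
  move=> Mx; have [h _] := VP x.
  rewrite (_ : V x = (l' - l) *: S (P (V x)) + x); last first.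
    by move/eqP: h; rewrite subr_eq addrC BE => /eqP.
  by apply: MD => //; exact: MS.
exists (S \o V) => [|x Mx /=]; first exact: bounded_map_comp.
have My := MV x Mx; have [MSy TSy _] := SP _ My.
have [Vx _] := VP x.
have [_ _ STx] := SP _ Mx.
have shift z : T z - l' *: z = T z - l *: z - (l' - l) *: z.
  by rewrite scalerBl opprB addrA subrK.
split=> //.
  by rewrite shift TSy -[X in _ - X = _](_ : B (V x) = _) ?Vx// BE PM.
have Mu : M (T x - l *: x).
  have [n [v [f [_ _ MT]]]] := fM.
  by rewrite addrC -scaleNr; apply: MD => //; exact: MT.
rewrite shift -[X in _ - _ *: X]STx.
have := (VP (T x - l *: x)).2; rewrite BE PM// => ->.
exact: STx.
Qed.

Lemma invertible_on_large : exists2 K, 0 < K & forall l, K < normc l -> invertible_on setT l.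
Proof.
have [K K0 TK] := bounded_map_ge0 bN bT; exists (2 * K); first by rewrite mulr_gt0.
move=> l lK; have l0 : 0 < normc l by apply: lt_trans lK; rewrite mulr_gt0.
have ln0 : l != 0 by rewrite -normc_gt0.
have [B bB BE] := bounded_map_scale bN l^-1 bT.
have [|V bV VP] := neumann bN (B := B).
  move=> x; rewrite BE (snZ sN) normcV ler_pdivrMl// (le_trans (TK x))//.
  by rewrite mulrA ler_wpM2r ?(sn_ge0 sN)//; lra.
have [S bS SE] := bounded_map_scale bN (- l^-1) bV.
exists S => // x _; have [Vx1 Vx2] := VP x; split=> //; rewrite SE.
- rewrite scalerA mulrN divff// scaleN1r opprK (linearZ_LR T) scaleNr -BE.
  by rewrite addrC.
- rewrite scaleNr -linearZ_LR -linearN scalerBr scalerK// opprB -BE.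
  exact: Vx2.
Qed.

End FiniteCodimensional.

(** * Nonempty essential spectrum *)

Section Liouville.
Variables (R : realType) (X : lmodType R[i]) (N : X -> R).
Hypothesis bN : banach N.
Let sN : seminorm N. Proof. by case: bN. Qed.
Let sC := seminorm_normc R.
Variable T : {linear X -> X}.
Hypothesis bT : bounded_map N T.
Variables (M : set X) (Q : R[i] -> {linear X -> X}) (K : R[i] -> R).
Hypothesis K0 : forall l, 0 < K l.
Hypothesis QK : forall l x, N (Q l x) <= K l * N x.
Hypothesis MQ : forall l x, M x -> M (Q l x).
Hypothesis TQ : forall l x, M x -> T (Q l x) - l *: Q l x = x.
Hypothesis QT : forall l x, M x -> Q l (T x - l *: x) = x.

Lemma resolvent_identity l m x : M x -> Q l x = Q m x + (l - m) *: Q m (Q l x).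
Proof.
move=> Mx; have := QT m (MQ l Mx).
have -> : T (Q l x) - m *: Q l x = (l - m) *: Q l x + x.
  by move/eqP: (TQ l Mx); rewrite subr_eq => /eqP ->; rewrite scalerBl -addrA addrC.
by rewrite (linearP (Q m)) addrC => ->.
Qed.

Lemma resolvent_identity' l m x : M x -> Q l x = Q m x + (l - m) *: Q l (Q m x).
Proof.
move=> Mx; rewrite [in X in _ = X + _](resolvent_identity m l Mx).
by rewrite -addrA -scalerDl -(opprB l m) addNr scale0r addr0.
Qed.

Lemma resolvent_near l m x : normc (l - m) * K m <= 2^-1 -> M x ->
  N (Q l x) <= 2 * K m * N x.
Proof.
move=> lm Mx.
have h : N (Q l x) <= K m * N x + 2^-1 * N (Q l x).
  rewrite {1}(resolvent_identity l m Mx) (le_trans (sn_le sN _ _))// lerD//.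
  rewrite (snZ sN); apply: (@le_trans _ _ (normc (l - m) * (K m * N (Q l x)))).
    by rewrite ler_wpM2l ?normc_ge0.
  by rewrite mulrA ler_wpM2r ?(sn_ge0 sN).
by rewrite -mulrA; lra.
Qed.

Variables (x0 : X) (f : {linear X -> R[i]^o}) (Kf : R).
Hypothesis Mx0 : M x0.
Hypothesis Kf0 : 0 <= Kf.
Hypothesis fK : forall x, normc (f x) <= Kf * N x.

Let phi l : R[i] := f (Q l x0).

Hypothesis phi0 : phi 0 != 0.

Lemma phi_cont m e : 0 < e -> exists2 r, 0 < r & forall l, normc (l - m) < r ->
  normc (phi l - phi m) < e.
Proof.
move=> e0; pose D := Kf * (K m * (2 * K m * N x0)).
have D0 : 0 <= D.
  by rewrite /D mulr_ge0// mulr_ge0 ?(ltW (K0 m))// mulr_ge0 ?(sn_ge0 sN)// mulr_ge0 ?(ltW (K0 m)).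
have D1 : 0 < D + 1 by rewrite ltr_wpDl.
exists (Num.min (2^-1 / K m) (e / (D + 1))).
  by rewrite lt_min !divr_gt0// invr_gt0.
move=> l; rewrite lt_min => /andP[].
rewrite ltr_pdivlMr// => /ltW lm; rewrite ltr_pdivlMr// => lmD.
apply: le_lt_trans lmD.
have -> : phi l - phi m = (l - m) * f (Q m (Q l x0)).
  rewrite /phi {1}(resolvent_identity l m Mx0) (linearD f) (linearZ_LR f) addrAC subrr add0r.
  by [].
rewrite normcM ler_wpM2l ?normc_ge0//; apply: (@le_trans _ _ D); last by rewrite lerDl.
apply: le_trans (fK _) _; rewrite /D ler_wpM2l//.
apply: le_trans (QK _ _) _; rewrite ler_wpM2l ?(ltW (K0 m))//.
exact: resolvent_near.
Qed.

Lemma phi_decay : exists2 r, 0 < r & forall l, r < normc l -> normc (phi l) < normc (phi 0).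
Proof.
have [KT KT0 TK] := bounded_map_ge0 bN bT.
have p0 : 0 < normc (phi 0) by rewrite normc_gt0.
have Nx := sn_ge0 sN x0.
(* The equation [l w = T w - x0] gives [c * N w <= N x0] once the modulus of [l] exceeds [KT + c];
   this [c] then puts [Kf * N w] strictly below the modulus of [phi 0]. *)
pose c := (Kf * N x0 + 1) / normc (phi 0).
have c0 : 0 < c by rewrite divr_gt0// ltr_wpDl// mulr_ge0.
exists (KT + c); first by rewrite addr_gt0.
move=> l lr; set w := Q l x0.
have h : normc l * N w <= N x0 + KT * N w.
  rewrite -(snZ sN) (_ : l *: w = T w - x0); last first.
    move/eqP: (TQ l Mx0); rewrite -/w subr_eq addrC -subr_eq.
    by move=> /eqP ->.
  by apply: le_trans (sn_leB sN _ _) _; rewrite addrC lerD2l.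
have hw : c * N w <= N x0.
  have : (KT + c) * N w <= normc l * N w by rewrite ler_wpM2r ?(sn_ge0 sN)// ltW.
  by rewrite mulrDl; lra.
have : Kf * N w < normc (phi 0).
  have : c * (Kf * N w) <= Kf * N x0 by rewrite mulrCA ler_wpM2l.
  move=> h1; rewrite -(ltr_pM2l c0) (le_lt_trans h1)//.
  by rewrite /c divfK ?lt0r_neq0// ltrDl.
exact: le_lt_trans (fK _).
Qed.

(** Outside a large square [phi] is smaller than at 0, so its maximum over the square is global. The
    maximisers in the square form a compact set, on which the real part attains its maximum. *)
Lemma phi_max : exists m, (forall l, normc (phi l) <= normc (phi m)) /\
  forall l, normc (phi l) = normc (phi m) -> complex.Re l <= complex.Re m.
Proof.
have [r r0 decay] := phi_decay.
pose A := (`[- r, r]%classic `*` `[- r, r]%classic : set (R * R)).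
have cA : compact A by apply: compact_setX; exact: segment_compact.
pose g (p : R * R) := normc (phi (p.1 +i* p.2)).
have cg : continuous g.
  move=> p; apply/cvgrPdist_lt => e e0.
  have [d d0 dP] := phi_cont (p.1 +i* p.2) e0.
  have d2 : 0 < d / 2 by rewrite divr_gt0.
  exists (ball p.1 (d / 2), ball p.2 (d / 2)); first by split; exact: nbhsx_ballx.
  move=> q [/= q1 q2].
  rewrite distrC -(opprB (g p)) normrN.
  have h : normc (phi (q.1 +i* q.2) - phi (p.1 +i* p.2)) < e.
    apply: dP; apply: le_lt_trans (normc_le_ReIm _) _ => /=.
    move: q1 q2; rewrite -!ball_normE /= => q1 q2.
    rewrite distrC [X in _ + X]distrC; lra.
  apply: le_lt_trans h; rewrite ler_norml; apply/andP; split.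
    rewrite lerNl opprB (le_trans (sn_diff sC _ _))// (snC sC) //.
  by rewrite (snC sC) (le_trans (sn_diff sC _ _)).
have inA l : normc l <= r -> A (complex.Re l, complex.Im l).
  move=> lr; split => /=; rewrite in_itv /= -ler_norml.
    exact: le_trans (normc_Re l) lr.
  exact: le_trans (normc_Im l) lr.
have Ane : A !=set0.
  by exists (complex.Re (0 : R[i]), complex.Im (0 : R[i])); apply: inA; rewrite normc0 ltW.
have [c /set_mem cinA cmax] := compact_EVT_max Ane cA (continuous_subspaceT cg).
have gc l : normc (phi l) <= g c.
  have gE : normc (phi l) = g (complex.Re l, complex.Im l) by rewrite /g /=; case: l.
  have [lr|lr] := lerP (normc l) r; first by rewrite gE; apply: cmax; apply/mem_set/inA.
  apply: le_trans (ltW (decay _ lr)) _.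
  have := cmax (complex.Re (0 : R[i]), complex.Im (0 : R[i])); rewrite /g /=; apply.
  by apply/mem_set/(inA 0); rewrite normc0 ltW.
pose A' := A `&` (g @^-1` [set g c]).
have cA' : compact A'.
  apply: compact_closedI => //; apply: closed_comp => [p _|]; first exact: cg.
  exact: closed_eq.
have cf : continuous (fst : R * R -> R) by move=> p; exact: cvg_fst.
have [c' /set_mem[c'A c'g] c'max] := compact_EVT_max
  (ex_intro _ c (conj cinA erefl)) cA' (continuous_subspaceT cf).
exists (c'.1 +i* c'.2); rewrite -/(g c') c'g; split=> // l lg.
have := c'max (complex.Re l, complex.Im l); apply; apply/mem_set.
have gE : normc (phi l) = g (complex.Re l, complex.Im l) by rewrite /g /=; case: (l).
split; last by rewrite /= -gE.
apply: inA; rewrite leNgt; apply/negP => /decay; rewrite lg.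
by rewrite ltNge gc.
Qed.

(* At a maximum [m] of |phi| (with maximal real part), the first nonzero
   coefficient of the expansion of [phi] at [m] would allow a larger value in
   some direction, as in the usual proof of the fundamental theorem of algebra.
   So [phi] is constant near [m], against the choice of the real part. *)
Lemma liouville : False.
Proof.
have [m [mmax mRe]] := phi_max.
pose y k := iter k (Q m) x0.
have My k : M (y k) by elim: k => //= k; exact: MQ.
(* [u k m] is the [k]-th Taylor coefficient of [phi] at [m], and [h ^+ k.+1 * u k.+1 (m + h)] is the
   remainder after that term. *)
pose u k l : R[i] := f (Q l (y k)).
have uS k h : u k (m + h) = u k m + h * u k.+1 (m + h).
  rewrite /u (resolvent_identity' (m + h) m (My k)) (linearD f) (linearZ_LR f).
  by rewrite addrAC subrr add0r.
have phim : 0 < normc (phi m) by apply: lt_le_trans (mmax 0); rewrite normc_gt0.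
have ub k h : normc h * K m <= 2^-1 -> normc (u k (m + h)) <= Kf * (2 * K m * N (y k)).
  move=> hK; apply: le_trans (fK _) _; rewrite ler_wpM2l//.
  by apply: resolvent_near (My k); rewrite addrAC subrr add0r.
(* All coefficients of positive order vanish: the induction removes them one at a time. *)
have P k h : phi (m + h) = phi m + h ^+ k.+1 * u k.+1 (m + h).
  elim: k h => [|k IH] h; first by rewrite expr1; exact: (uS 0%N h).
  rewrite IH (uS k.+1); suff -> : u k.+1 m = 0 by rewrite add0r mulrA -exprSr.
  apply/eqP; apply: contrapT => /negP a0; set a := u k.+1 m in a0.
  (* With this direction, [h = t w] turns the first two terms into [(1 + t ^+ k.+1) * phi m], of
     larger modulus than [phi m]. *)
  pose w := k.+1.-root (phi m / a).
  have wk : w ^+ k.+1 = phi m / a by rewrite rootCK.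
  pose D := normc (w ^+ k.+2) * (Kf * (2 * K m * N (y k.+2))).
  have D0 : 0 <= D.
    by rewrite /D mulr_ge0 ?normc_ge0// mulr_ge0// mulr_ge0 ?(sn_ge0 sN)// mulr_ge0 ?(ltW (K0 m)).
  have D1 : 0 < D + 1 by rewrite ltr_wpDl.
  have w1 : 0 < 2 * (normc w * K m + 1).
    by rewrite mulr_gt0// ltr_wpDl// mulr_ge0 ?normc_ge0// ltW.
  (* The first bound on [t] makes [ub] applicable; the second makes the remainder smaller than the
     gain [t ^+ k.+1 * normc (phi m)]. *)
  pose t := Num.min (2 * (normc w * K m + 1))^-1 (normc (phi m) / (D + 1)).
  have t0 : 0 < t by rewrite lt_min invr_gt0 w1 divr_gt0.
  have [t1 t2] : t <= (2 * (normc w * K m + 1))^-1 /\ t <= normc (phi m) / (D + 1).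
    by apply/andP; rewrite -le_min.
  have tw : normc (t%:C * w) * K m <= 2^-1.
    rewrite normcM normc_real (gtr0_norm t0) -mulrA.
    apply: (@le_trans _ _ ((2 * (normc w * K m + 1))^-1 * (normc w * K m + 1))).
      apply: ler_pM => //; first exact: ltW.
        by rewrite mulr_ge0 ?normc_ge0// ltW.
      by rewrite lerDl.
    by rewrite invfM -mulrA mulVf ?mulr1// lt0r_neq0// ltr_wpDl// mulr_ge0 ?normc_ge0// ltW.
  have := mmax (m + t%:C * w).
  rewrite IH (uS k.+1) -/a mulrDr {1}exprMn wk mulrA -exprSr addrA.
  rewrite -mulrA divfK// -{1}[phi m]mul1r -mulrDl.
  move=> contra.
  have small : normc ((t%:C * w) ^+ k.+2 * u k.+2 (m + t%:C * w)) < t ^+ k.+1 * normc (phi m).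
    rewrite normcM exprMn normcM normcX normc_real (gtr0_norm t0) -mulrA.
    apply: (@le_lt_trans _ _ (t ^+ k.+2 * D)).
      by rewrite ler_wpM2l ?exprn_ge0 ?(ltW t0)// ler_wpM2l ?normc_ge0// ub.
    rewrite exprSr -mulrA ltr_pM2l ?exprn_gt0//.
    apply: (@lt_le_trans _ _ (t * (D + 1))); first by rewrite ltr_pM2l// ltrDl.
    by rewrite -ler_pdivlMr.
  set z := _ * u _ _ in small contra *.
  have := sn_diff sC ((1 + t%:C ^+ k.+1) * phi m) (- z); rewrite opprK (snN sC).
  have -> : normc ((1 + t%:C ^+ k.+1) * phi m) = (1 + t ^+ k.+1) * normc (phi m).
    rewrite normcM -rmorphXn -(rmorph1 (real_complex R)) -rmorphD normc_real ger0_norm//.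
    by rewrite addr_ge0 ?exprn_ge0// ltW.
  have aux (p q r s : R) : p <= r -> s < q -> (r + q) - s <= p -> False by lra.
  by rewrite mulrDl mul1r; exact: aux contra small.
have Ny k : N (y k) <= K m ^+ k * N x0.
  elim: k => [|k IH]; first by rewrite expr0 mul1r.
  rewrite exprS -mulrA /= (le_trans (QK _ _))// ler_wpM2l// ltW//.
(* The remainder is at most a constant times [(normc h * K m) ^+ k.+1], which tends to 0 as [k]
   grows. *)
have const h : normc h * K m <= 2^-1 -> phi (m + h) = phi m.
  move=> hK; apply/eqP; rewrite -subr_eq0 -normc_eq0 eq_le normc_ge0 andbT.
  apply/ler_addgt0Pr => e e0; rewrite add0r.
  pose C := Kf * (2 * K m * N x0).
  have C0 : 0 <= C by rewrite /C mulr_ge0// mulr_ge0 ?(sn_ge0 sN)// mulr_ge0 ?(ltW (K0 m)).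
  have C1 : 0 < C + 1 by rewrite ltr_wpDl.
  have [k ke] := half_pow_lt (divr_gt0 e0 C1).
  have := ke k.+1 (leqnSn k); rewrite ltr_pdivlMr// => /ltW; apply: le_trans.
  rewrite (P k) addrAC subrr add0r normcM normcX.
  apply: (@le_trans _ _ ((normc h * K m) ^+ k.+1 * C)).
    rewrite exprMn -mulrA ler_wpM2l ?exprn_ge0 ?normc_ge0//.
    apply: le_trans (ub _ _ hK) _; rewrite /C [leRHS]mulrCA ler_wpM2l// [leRHS]mulrCA ler_wpM2l ?Ny//.
    by rewrite mulr_ge0// ltW.
  apply: ler_pM => //; rewrite ?exprn_ge0 ?mulr_ge0 ?normc_ge0 ?(ltW (K0 m))//.
    by rewrite /half_pow lerXn2r// nnegrE ?mulr_ge0 ?normc_ge0 ?invr_ge0// ltW.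
  by rewrite lerDl.
pose t := (2 * K m)^-1.
have t0 : 0 < t by rewrite invr_gt0 mulr_gt0.
have : phi (m + t%:C) = phi m.
  apply: const; rewrite normc_real gtr0_norm// /t invfM -mulrA mulVf ?mulr1//.
  by rewrite lt0r_neq0.
move=> /(congr1 (@normc R)) /mRe /=; case: (m) => a b /=; lra.
Qed.

End Liouville.

(** * Boundary points of the essential spectrum *)

Section EssentialSpectrum.
Variables (R : realType) (X : lmodType R[i]) (N : X -> R).
Hypothesis bN : banach N.
Let sN : seminorm N. Proof. by case: bN. Qed.
Let sC := seminorm_normc R.
Variable T : {linear X -> X}.
Hypothesis bT : bounded_map N T.

(* The complement of an essential spectrum: finite-dimensional obstructions to
   the invertibility of [T - l] are ignored. *)
Definition ess_regular (l : R[i]) := exists2 M, fin_codim_inv N T M & invertible_on N T M l.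

Lemma not_invertible_everywhere M : fin_codim_inv N T M -> (exists2 x, M x & x != 0) ->
  ~ forall l, invertible_on N T M l.
Proof.
move=> fM [x0 Mx0 x00] invM.
have /choice[Q QP] l : exists S : {linear X -> X}, bounded_map N S /\ forall x, M x ->
    [/\ M (S x), T (S x) - l *: S x = x & S (T x - l *: x) = x].
  by have [S bS SP] := invM l; exists S.
have /choice[K KP] l : exists K, 0 < K /\ forall x, N (Q l x) <= K * N x.
  by have [K K0 QK] := bounded_map_ge0 bN (QP l).1; exists K.
have Q0 : Q 0 x0 != 0.
  apply/eqP => Q0; have [_ + _] := (QP 0).2 _ Mx0.
  by rewrite Q0 linear0 scaler0 subrr => /esym/eqP; rewrite (negPf x00).
have [f [fN f0]] := hahn_banach (Q 0 x0) sN.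
apply: (@liouville _ _ _ bN T bT M Q K _ _ _ _ _ x0 f 1 Mx0) => //.
- by move=> l; case: (KP l).
- by move=> l; case: (KP l).
- by move=> l x Mx; case: ((QP l).2 _ Mx).
- by move=> l x Mx; case: ((QP l).2 _ Mx).
- by move=> l x Mx; case: ((QP l).2 _ Mx).
- by move=> x; rewrite mul1r.
- by rewrite f0 -normc_eq0 normc_real normr_eq0 (banach_eq0 bN).
Qed.

Hypothesis infX : inf_dim N setT.

Lemma ess_spectrum_nonempty : exists l, ~ ess_regular l.
Proof.
apply: contrapT => /forallNP H.
have {}H l : ess_regular l by apply: contrapT; exact: H.
have [K K0 large] := invertible_on_large bN bT.
(* Compactness of the square gives a single subspace [M0] that works for all
   its points: the filter below is that of small subspaces. *)
pose F : set_system (set X) := [set D | exists2 M0, fin_codim_inv N T M0 &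
  forall M, fin_codim_inv N T M -> M `<=` M0 -> D M].
have FF : Filter F.
  split.
  - by exists setT => //; exact: fin_codim_invT.
  - move=> D D' [M fM MD] [M' fM' M'D']; exists (M `&` M'); first exact: fin_codim_invI.
    by move=> L fL LM; split; [apply: MD|apply: M'D'] => // x /LM[].
  - by move=> D D' DD' [M fM MD]; exists M => // L fL LM; exact/DD'/MD.
have : compact (`[- K, K]%classic `*` `[- K, K]%classic : set (R * R)).
  by apply: compact_setX; exact: segment_compact.
move=> /compact_near_coveringP/(_ _ F (fun M p => invertible_on N T M (p.1 +i* p.2)) FF)[].
  move=> p _; have [M0 fM0 invM0] := H (p.1 +i* p.2).
  have [r r0 rP] := invertible_on_near bN fM0 invM0.
  have r2 : 0 < r / 2 by rewrite divr_gt0.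
  exists (ball p (r / 2), [set M | fin_codim_inv N T M /\ M `<=` M0]).
    split; first exact: nbhsx_ballx.
    by exists M0.
  move=> [q M] [/= [q1 q2] [fM MM0]].
  apply: (invertible_on_sub fM0 fM MM0); apply: rP.
  apply: le_lt_trans (normc_le_ReIm _) _ => /=.
  move: q1 q2; rewrite -!ball_normE /= => q1 q2.
  rewrite distrC [X in _ + X]distrC; lra.
move=> M0 fM0 /(_ _ fM0 (@subset_refl _ M0)) M0sq.
apply: (not_invertible_everywhere fM0).
  (* Infinite dimension enters here: if [M0] were zero, [X] would be the span of the [n] vectors
     [v]. *)
  apply: contrapT => noM; have [n [v [f [vf ME _]]]] := fM0.
  apply: (@spanned_not_inf_dim _ _ N setT n v) infX => x _.
  exists (fun i => f i x); apply/eqP; rewrite -subr_eq0; apply: contrapT => /negP x0.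
  apply: noM; exists (x - biorth_proj n v f x) => //.
  by rewrite ME => i ilt; rewrite linearB (biorth_proj_f vf)// subrr.
move=> l; have [lK|lK] := ltP K (normc l).
  by apply: (invertible_on_sub (@fin_codim_invT _ _ N T) fM0 _ (large _ lK)) => x.
have := M0sq (complex.Re l, complex.Im l) => /=.
have -> : complex.Re l +i* complex.Im l = l by case: (l).
apply; split=> /=; rewrite in_itv /= -ler_norml.
  exact: le_trans (normc_Re l) lK.
exact: le_trans (normc_Im l) lK.
Qed.

(** Among the scalars near [l] only finitely many are eigenvalues of the operator induced on the
    finite-dimensional quotient by [M]. For any other [l'], [T - l'] is invertible both on [M] and
    on the quotient, hence on [X]. *)
Lemma ess_regular_near l e : ess_regular l -> 0 < e ->
  exists2 l', normc (l' - l) < e & invertible_on N T setT l'.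
Proof.
move=> [M fM invM] e0.
have [r r0 rP] := invertible_on_near bN fM invM.
have fM' := fM; have [n [v [f [vf ME MT]]]] := fM'.
have [|A AP] := fin_codim_inv_mx (T := T) vf; first by rewrite -ME.
pose d := Num.min r e; have d0 : 0 < d by rewrite lt_min r0.
(* More candidates than the characteristic polynomial has roots; the shift by 2 keeps them at
   distance less than [d]. *)
pose lk k : R[i] := l + (d / (k + 2)%:R)%:C.
have lkd k : normc (lk k - l) < d.
  rewrite /lk addrAC subrr add0r normc_real gtr0_norm ?divr_gt0// ?ltr0n ?addn2//.
  by rewrite ltr_pdivrMr ?ltr0n// ltr_pMr// ltr1n.
have [k kroot] : exists k, ~~ root (char_poly A) (lk k).
  apply: contrapT => /forallNP allroot.
  pose s := [seq lk k | k <- iota 0 (size (char_poly A))].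
  have : (size s < size (char_poly A))%N.
    apply: max_poly_roots.
    - by rewrite monic_neq0 ?char_poly_monic.
    - apply/allP => _ /mapP[k _ ->]; apply: contrapT => /negP; exact: allroot.
    - rewrite map_inj_uniq ?iota_uniq// => i j /addrI [].
      move=> /(mulfI (lt0r_neq0 d0))/invr_inj/eqP.
      by rewrite eqr_nat eqn_add2r => /eqP.
  by rewrite size_map size_iota ltnn.
have := lkd k; rewrite lt_min => /andP[lr le].
set l' := lk k in kroot lr le; exists l' => //.
have [S bS SP] := rP _ lr.
pose B := A - l'%:M.
have unitB : B \in unitmx.
  rewrite unitmxE unitfE; apply: contra kroot => /eqP detB.
  rewrite -eigenvalue_root_char; apply/eigenvalueP.
  have /det0P[u u0 uB] : \det B == 0 by rewrite detB.
  exists u => //; apply/eqP; rewrite -subr_eq0 -mul_mx_scalar -mulmxBr.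
  exact/eqP.
pose s (u : 'rV[R[i]]_n) : X := \sum_(i < n) u 0 i *: v i.
have sl a u w : s (a *: u + w) = a *: s u + s w.
  rewrite /s scaler_sumr -big_split /=; apply: eq_bigr => i _.
  by rewrite !mxE scalerDl scalerA.
have cs u : coords n f (s u) = u.
  apply/rowP => i; rewrite mxE /s linear_sum (bigD1 i)//= linearZ_LR vf.2// eqxx.
  rewrite -[_ *: _]/(_ * 1) mulr1 big1 ?addr0// => j ij; rewrite linearZ_LR vf.2//.
  rewrite (_ : (_ == _) = false) ?scaler0//.
  by apply/negbTE; apply: contra ij => /eqP e1; apply/eqP/val_inj.
have TB x : coords n f (T x - l' *: x) = coords n f x *m B.
  by rewrite addrC -scaleNr coordsP AP mulmxBr mul_mx_scalar scaleNr addrC.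
(* [q] solves the equation modulo [M]. The error [W2 y = y - (T - l') (q y)] lies in [M], where [S]
   corrects it, so the inverse is [q + S W2]. *)
pose q y := s (coords n f y *m invmx B).
have ql a x y : q (a *: x + y) = a *: q x + q y.
  by rewrite /q coordsP mulmxDl -scalemxAl sl.
have [Kq Kq0 qK] : exists2 Kq, 0 <= Kq & forall y, N (q y) <= Kq * N y.
  have sumK m (c : 'I_m -> X -> R[i]) (w : 'I_m -> X) :
      (forall i, exists2 K, 0 <= K & forall y, normc (c i y) <= K * N y) ->
      exists2 K, 0 <= K & forall y, N (\sum_(i < m) c i y *: w i) <= K * N y.
    elim: m c w => [|m IH] c w cK.
      by exists 0 => // y; rewrite big_ord0 (sn0 sN) mul0r.
    have [K1 K10 h1] := IH (fun i => c (widen_ord (leqnSn m) i))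
       (fun i => w (widen_ord (leqnSn m) i)) (fun i => cK _).
    have [K2 K20 h2] := cK ord_max.
    exists (K1 + K2 * N (w ord_max)) => [|y].
      by rewrite addr_ge0// mulr_ge0 ?(sn_ge0 sN).
    rewrite big_ord_recr /= (le_trans (sn_le sN _ _))// mulrDl lerD//.
    by rewrite (snZ sN) mulrAC ler_wpM2r ?(sn_ge0 sN).
  apply: sumK => i.
  have [h [Kh hK] hE] := bounded_fun_sum n (fun j => if insub j is Some j' then invmx B j' i else 0) vf.1.
  have [K' K'0 h'] := bounded_fun_ge0 bN (ex_intro _ Kh hK).
  exists K' => // y; apply: le_trans (h' y); rewrite hE mxE le_eqVlt; apply/orP; left.
  apply/eqP; congr normc; apply: eq_bigr => j _; rewrite mxE mulrC; congr (_ * _).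
  by rewrite valK.
have lq : linear q by exact: ql.
pose qq := linear_of lq.
have bq : bounded_map N qq by exists Kq => x; exact: qK.
have [W1 bW1 W1E] := bounded_map_lin bN (- l') bq (bounded_map_comp bN bT bq).
have [W2 bW2 W2E] := bounded_map_lin bN (-1) bW1 (bounded_map_id N).
have W2M y : M (W2 y).
  rewrite ME; apply/coords_eq0; rewrite W2E scaleN1r.
  rewrite (_ : - W1 y = - (T (q y) - l' *: q y)); last first.
    by rewrite W1E /= scaleNr addrC.
  rewrite -scaleN1r coordsP TB /q cs mulmxKV// scaleN1r /=.
  exact: addNr.
have W2y y : W2 y = y - (T (q y) - l' *: q y).
  by rewrite W2E W1E /= scaleN1r scaleNr addrC [- _ + T _]addrC.
have [V bV VE] := bounded_map_lin bN 1 bq (bounded_map_comp bN bS bW2).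
exists V => // y _.
have [MS TS ST] := SP _ (W2M y).
have VyE : V y = q y + S (W2 y) by rewrite VE scale1r.
have TV z : T (V z) - l' *: V z = z.
  have [_ TSz _] := SP _ (W2M z).
  rewrite VE scale1r /= (linearD T) scalerDr opprD addrACA TSz W2y.
  by rewrite addrC subrK.
split=> //.
have inj z : T z - l' *: z = 0 -> z = 0.
  move=> Tz0.
  have Mz : M z.
    rewrite ME; apply/coords_eq0.
    have := TB z; rewrite Tz0 (_ : coords n f 0 = 0); last first.
      by apply/coords_eq0 => i _; exact: linear0.
    move=> /(congr1 (fun u => u *m invmx B)); rewrite mulmxK// mul0mx.
    by move=> ->.
  by have [_ _ <-] := SP _ Mz; rewrite Tz0 linear0.
apply/eqP; rewrite -subr_eq0; apply/eqP/inj.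
rewrite linearB scalerBr subr_swap TV subrr//.
Qed.

(** The point is the supremum of the irregular points on a horizontal ray from [l1]. It is irregular
    because regularity is an open condition; the points beyond it on the ray are regular, so
    [ess_regular_near] applies to them. *)
Lemma ess_boundary : exists2 l, ~ ess_regular l &
  forall e, 0 < e -> exists2 l', normc (l' - l) < e & invertible_on N T setT l'.
Proof.
have [l1 nl1] := ess_spectrum_nonempty.
have [K K0 large] := invertible_on_large bN bT.
pose D := [set t : R | 0 <= t /\ ~ ess_regular (l1 + t%:C)].
have D0 : D 0 by split=> //; rewrite addr0.
have hD : has_sup D.
  split; first by exists 0.
  exists (K + normc l1) => t [t0 nt]; rewrite leNgt; apply/negP => Kt; apply: nt.
  exists setT; first exact: fin_codim_invT.
  apply: large; have := sn_diff sC t%:C (- l1).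
  rewrite opprK normc_real ger0_norm// (snN sC) [t%:C + l1]addrC; lra.
pose t0 := sup D.
have t00 : 0 <= t0 by exact: (sup_upper_bound hD).
have above t : t0 < t -> ess_regular (l1 + t%:C).
  move=> tt0; apply: contrapT => nt.
  have : t <= t0.
    by apply: (sup_upper_bound hD); split=> //; rewrite (le_trans t00)// ltW.
  by rewrite leNgt tt0.
exists (l1 + t0%:C).
  move=> [M fM invM]; have [r r0 rP] := invertible_on_near bN fM invM.
  have [t Dt rt] := sup_adherent r0 hD.
  have le : t <= t0 by apply: (sup_upper_bound hD).
  apply: Dt.2; exists M => //; apply: rP.
  rewrite opprD addrACA subrr add0r -rmorphB normc_real.
  rewrite distrC ger0_norm ?subr_ge0//.
  by rewrite -/t0 in rt; lra.
move=> e e0; have e2 : 0 < e / 2 by rewrite divr_gt0.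
have [|l' l'e inv'] := ess_regular_near (above (t0 + e / 2) _) e2; first by rewrite ltrDl.
exists l' => //; apply: le_lt_trans (sn_tri sC (l1 + (t0 + e / 2)%:C) _ _) _.
have -> : l1 + (t0 + e / 2)%:C - (l1 + t0%:C) = (e / 2)%:C.
  by rewrite opprD addrACA subrr add0r -rmorphB addrAC subrr add0r.
rewrite normc_real gtr0_norm//; lra.
Qed.

End EssentialSpectrum.

(** * Criteria for rank-one perturbations *)

Section Criteria.
Variables (R : realType) (X : lmodType R[i]) (N : X -> R).
Hypothesis bN : banach N.
Let sN : seminorm N. Proof. by case: bN. Qed.
Let sC := seminorm_normc R.
Implicit Types (Y S : set X).

Definition half_space Y := [/\ lin_subspace Y, norm_closed N Y, inf_dim N Y & inf_codim N Y].

Definition perturbable (T : {linear X -> X}) :=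
  exists (F : {linear X -> X}) (u : X) (f : {linear X -> R[i]^o}) Y,
  [/\ bounded_fun N f, forall x, F x = f x *: u, half_space Y &
      forall y, Y y -> Y (T y + F y)].

Definition norm_closure Y : set X := [set x | forall e, 0 < e -> exists2 y, Y y & N (x - y) < e].

Lemma sub_norm_closure Y : Y `<=` norm_closure Y.
Proof. by move=> y Yy e e0; exists y => //; rewrite subrr (sn0 sN). Qed.

Lemma norm_closed_closure Y : norm_closed N (norm_closure Y).
Proof.
move=> x Hx e e0; have e2 : 0 < e / 2 by rewrite divr_gt0.
have [y cy xy] := Hx _ e2; have [z Yz yz] := cy _ e2; exists z => //.
by apply: le_lt_trans (sn_tri sN y _ _) _; lra.
Qed.

Lemma norm_closure_map Y Z (S : {linear X -> X}) : bounded_map N S -> norm_closed N Z ->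
  (forall y, Y y -> Z (S y)) -> forall y, norm_closure Y y -> Z (S y).
Proof.
move=> /(bounded_map_ge0 bN)[K K0 SK] cZ YZ y cy; apply: cZ => e e0.
have [z Yz yz] := cy _ (divr_gt0 e0 K0); exists (S z); first exact: YZ.
by rewrite -linearB (le_lt_trans (SK _))// mulrC -ltr_pdivlMr.
Qed.

Lemma lin_subspace_closure Y : lin_subspace Y -> lin_subspace (norm_closure Y).
Proof.
move=> [Y0 YD]; split; first exact: sub_norm_closure.
move=> a x y cx cy e e0; have e2 : 0 < e / 2 by rewrite divr_gt0.
have a1 : 0 < normc a + 1 by rewrite ltr_wpDl ?normc_ge0.
have [x' Yx' xx'] := cx _ (divr_gt0 e2 a1); have [y' Yy' yy'] := cy _ e2.
exists (a *: x' + y'); first exact: YD.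
rewrite opprD addrACA -scalerBr; apply: le_lt_trans (sn_le sN _ _) _.
rewrite (snZ sN); rewrite ltr_pdivlMr// in xx'.
have : normc a * N (x - x') <= N (x - x') * (normc a + 1).
  by rewrite mulrC ler_wpM2l ?(sn_ge0 sN)// lerDl.
lra.
Qed.

Lemma norm_closure_ker Y (f : {linear X -> R[i]^o}) : bounded_fun N f ->
  (forall y, Y y -> f y = 0) -> forall y, norm_closure Y y -> f y = 0.
Proof.
move=> bf Yf y cy; apply: (norm_closed_ker bN bf) => e e0.
by have [z Yz yz] := cy e e0; exists z => //=; exact: Yf.
Qed.

Section Sequences.
Variables (v : nat -> X) (f : nat -> {linear X -> R[i]^o}).
Hypothesis bf : forall i, bounded_fun N (f i).
Hypothesis vf : forall i j, f i (v j) = (i == j)%:R.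
Variable h : nat -> nat.
Hypothesis hinj : injective h.

Let bior_h n : biorthogonal N n (v \o h) (f \o h).
Proof. by split=> [i|i j _ _] /=; [exact: bf|rewrite vf (inj_eq hinj)]. Qed.

Lemma inf_dim_seq Y : (forall i, Y (v (h i))) -> inf_dim N Y.
Proof. by move=> Yv n; exists (v \o h), (f \o h); split=> // i _; exact: Yv. Qed.

Lemma inf_codim_seq Y : (forall i y, Y y -> f (h i) y = 0) -> inf_codim N Y.
Proof.
by move=> Yf n; exists (v \o h), (f \o h); split=> // i y _; exact: Yf.
Qed.

End Sequences.

Lemma doubleS_inj : injective (fun n => n.*2.+1).
Proof. by move=> m n /succn_inj/double_inj. Qed.

(** Each extension leaves the earlier vectors and functionals unchanged, so the finite systems fit
    together into one sequence. *)
Lemma biorthogonal_in Y : lin_subspace Y -> inf_dim N Y ->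
  exists (v : nat -> X) (f : nat -> {linear X -> R[i]^o}),
  [/\ forall i, bounded_fun N (f i), forall i j, f i (v j) = (i == j)%:R &
    forall i, Y (v i)].
Proof.
move=> sY iY; have [f0 bf0 _] := bounded_fun0 N.
pose Inv k (s : (nat -> X) * (nat -> {linear X -> R[i]^o})) :=
  biorthogonal N k s.1 s.2 /\ forall i, (i < k)%N -> Y (s.1 i).
have step (t : nat * ((nat -> X) * (nat -> {linear X -> R[i]^o}))) :
    exists s, Inv t.1 t.2 -> Inv t.1.+1 s /\
      forall i, (i < t.1)%N -> s.1 i = t.2.1 i /\ s.2 i = t.2.2 i.
  case: t => k [v f] /=; have [[/= vf Yv]|] := pselect (Inv k (v, f)); last first.
    by exists (v, f).
  have [y Yy yn] : exists2 y, Y y & y != biorth_proj k v f y.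
    apply: contrapT => H; apply: (@spanned_not_inf_dim _ _ N Y k v) iY => y Yy.
    exists (fun i => f i y); apply/eqP; apply: contrapT => /negP yn.
    by apply: H; exists y.
  have [x [g [Yx xg]]] := biorthogonal_extend bN sY vf Yv Yy yn.
  exists (fun i => if i == k then x else v i, fun i => if i == k then g else f i).
  move=> _; split; last by move=> i ik /=; rewrite (ltn_eqF ik).
  split=> // i /=; rewrite ltnS leq_eqVlt; case: eqP => //= _; exact: Yv.
have [g gP] := choice step.
pose st := fix st k := if k is k'.+1 then g (k', st k') else (fun=> 0, fun=> f0).
have stI k : Inv k (st k).
  by elim: k => [|k IH] /=; [split => //; split|have [] := gP (k, st k) IH].
have stS k i : (i < k)%N -> (st k.+1).1 i = (st k).1 i /\ (st k.+1).2 i = (st k).2 i.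
  by have [_] := gP (k, st k) (stI k); exact.
have sti i k : (i < k)%N -> (st k).1 i = (st i.+1).1 i /\ (st k).2 i = (st i.+1).2 i.
  elim: k => // k IH; rewrite ltnS leq_eqVlt => /predU1P[->//|ik].
  by have [-> ->] := stS k i ik; exact: IH.
exists (fun i => (st i.+1).1 i), (fun i => (st i.+1).2 i); split=> [i|i j|i].
- by have [[bf _] _] := stI i.+1; exact: bf.
- have [[_ vf] _] := stI (maxn i j).+1.
  have im : (i < (maxn i j).+1)%N by rewrite ltnS leq_maxl.
  have jm : (j < (maxn i j).+1)%N by rewrite ltnS leq_maxr.
  by rewrite -(sti i _ im).2 -(sti j _ jm).1 vf.
- by have [_ Yv] := stI i.+1; exact: Yv.
Qed.

Lemma half_space_cut Y (v : nat -> X) (f : nat -> {linear X -> R[i]^o}) :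
  lin_subspace Y -> norm_closed N Y -> (forall i, bounded_fun N (f i)) ->
  (forall i j, f i (v j) = (i == j)%:R) -> (forall i, Y (v i)) ->
  half_space [set x | Y x /\ forall i, f i.*2.+1 x = 0].
Proof.
move=> sY cY bf vf Yv; split.
- split; first by split; [exact: sY.1|move=> i; exact: linear0].
  move=> a x y [Yx fx] [Yy fy]; split; first exact: sY.2.
  by move=> i; rewrite (linearP (f _)) fx fy scaler0 addr0.
- move=> x Hx; split.
    by apply: cY => e e0; have [y [Yy _] xy] := Hx e e0; exists y.
  move=> i; apply: (norm_closed_ker bN (bf i.*2.+1)) => e e0.
  by have [y [_ fy] xy] := Hx e e0; exists y => //; exact: fy.
- apply: (inf_dim_seq bf vf double_inj) => i; split; first exact: Yv.
  move=> j; rewrite vf; case: eqP => // /(congr1 odd) /=.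
  by rewrite !odd_double.
- by apply: (inf_codim_seq bf vf doubleS_inj) => i y [_]; exact.
Qed.

Lemma half_space_in Y : lin_subspace Y -> norm_closed N Y -> inf_dim N Y ->
  exists2 Z, Z `<=` Y & half_space Z.
Proof.
move=> sY cY iY; have [v [f [bf vf Yv]]] := biorthogonal_in sY iY.
exists [set x | Y x /\ forall i, f i.*2.+1 x = 0]; first by move=> x [].
exact: half_space_cut sY cY bf vf Yv.
Qed.

Variable T : {linear X -> X}.
Hypothesis bT : bounded_map N T.

Lemma perturbable_invariant Y : half_space Y -> (forall y, Y y -> Y (T y)) -> perturbable T.
Proof.
move=> hY TY; have [f bf f0] := bounded_fun0 N.
have l0 : linear (fun _ : X => 0 : X) by move=> a x y; rewrite scaler0 addr0.
exists (linear_of l0), 0, f, Y; split=> //.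
  by move=> x; rewrite scaler0.
by move=> y Yy /=; rewrite addr0; exact: TY.
Qed.

Lemma rank_one_op (u : X) (f : {linear X -> R[i]^o}) :
  exists F : {linear X -> X}, forall x, F x = f x *: u.
Proof.
have lF : linear (fun x => f x *: u).
  by move=> a x y; rewrite (linearP f) scalerDl scalerA.
by exists (linear_of lF).
Qed.

(** If [u y0 != 0] with [y0] in [Y], the perturbed operator is [T] preceded by the projection onto
    the kernel of [u] along [y0], and this projection maps [Y] into itself. *)
Lemma perturbable_functional Y (u : {linear X -> R[i]^o}) : half_space Y -> bounded_fun N u ->
  (forall y, Y y -> u y = 0 -> Y (T y)) -> perturbable T.
Proof.
move=> hY bu uY; have [u0|] := pselect (forall y, Y y -> u y = 0).
  by apply: (perturbable_invariant hY) => y Yy; apply: uY => //; exact: u0.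
move=> /existsNP[y0 /not_implyP[Yy0 /eqP uy0]].
have [F FE] := rank_one_op (- ((u y0)^-1 *: T y0)) u.
exists F, (- ((u y0)^-1 *: T y0)), u, Y; split=> // y Yy.
have -> : T y + F y = T (- (u y / u y0) *: y0 + y).
  rewrite FE (linearP T) scalerN scalerA scaleNr addrC.
  by [].
have [sY _ _ _] := hY; apply: uY; first exact: sY.2.
rewrite (linearP u) -[_ *: _]/(_ * _) mulNr divfK//.
exact: addNr.
Qed.

(** If [e] is outside the closure of [S], a functional [f] with [f e = 1] that vanishes on [S]
    recovers the coefficient [a] as [f (T x)], so [- f (T x) *: e] is a bounded correction. If [e]
    is inside, the closure is already invariant. *)
Lemma perturbable_span S (e : X) : lin_subspace S ->
  (forall x, S x -> exists a : R[i], S (T x - a *: e)) ->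
  inf_dim N (norm_closure S) -> inf_codim N (norm_closure S) -> perturbable T.
Proof.
move=> sS ST iS jS; have sY := lin_subspace_closure sS.
have hY : half_space (norm_closure S) by split=> //; exact: norm_closed_closure.
have [ce|nce] := pselect (norm_closure S e).
  apply: (perturbable_invariant hY); apply: (norm_closure_map bT) => [|x Sx]; first exact: norm_closed_closure.
  have [a Sa] := ST x Sx; rewrite -[T x](subrK (a *: e)) addrC.
  by apply: sY.2 => //; exact: sub_norm_closure.
have [d d0 dP] := norm_closed_dist (@norm_closed_closure S) nce.
have [f [bf fS fe]] := hahn_banach_sep sN sY d0 dP.
have lg : linear (fun x => - f (T x) : R[i]^o).
  by move=> a x y; rewrite (linearP T) (linearP f) opprD scalerN.
have bg : bounded_fun N (linear_of lg).
  have [K K0 fK] := bounded_fun_ge0 bN bf; have [L L0 TL] := bounded_map_ge0 bN bT.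
  exists (K * L) => x /=; rewrite (snN sC) (le_trans (fK _))// -mulrA.
  by rewrite ler_wpM2l.
have [F FE] := rank_one_op e (linear_of lg).
exists F, e, (linear_of lg), (norm_closure S); split=> //.
have bF : bounded_map N F.
  have [K bK] := bg; exists (K * N e) => x.
  by rewrite FE (snZ sN) mulrAC ler_wpM2r ?(sn_ge0 sN).
have [G bG GE] := bounded_map_lin bN 1 bT bF.
move=> y cy; rewrite -[T y]scale1r -GE; move: y cy.
apply: (norm_closure_map bG) => [|x Sx]; first exact: norm_closed_closure.
have [a Sa] := ST x Sx; rewrite GE scale1r FE /=.
have : f (T x - a *: e) = 0 by apply: fS; exact: sub_norm_closure.
rewrite (linearB f) (linearZ_LR f) fe -[_ *: 1]/(_ * 1) mulr1 => /eqP.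
rewrite subr_eq0 => /eqP ->; rewrite scaleNr.
exact: sub_norm_closure.
Qed.

End Criteria.

(** * Unbounded resolvents *)

Lemma unbounded_tail (R : realType) (a : nat -> R) :
  (forall c, exists n, c < a n) -> forall k c, exists2 n, (k <= n)%N & c < a n.
Proof.
move=> ub k c; have [n cn] := ub (`|c| + \sum_(i < k) `|a i|).
have S0 : 0 <= \sum_(i < k) `|a i| by apply: sumr_ge0.
exists n; last by apply: le_lt_trans cn; have := ler_norm c; lra.
rewrite leqNgt; apply/negP => nk; move: cn; rewrite (bigD1 (Ordinal nk))//=.
have : 0 <= \sum_(i < k | i != Ordinal nk) `|a i| by apply: sumr_ge0.
by have := ler_norm (a n); have := normr_ge0 c; lra.
Qed.

Section BanachLemmas.
Variables (R : realType) (X : lmodType R[i]) (N : X -> R).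
Hypothesis bN : banach N.
Let sN : seminorm N. Proof. by case: bN. Qed.
Let sC := seminorm_normc R.

Lemma unit_ball_bound (p : X -> R) c : seminorm p -> (forall x, N x <= 1 -> p x <= c) ->
  forall x, p x <= `|c| * N x.
Proof.
move=> sp H x; have [/eqP|x0] := eqVneq (N x) 0.
  by rewrite (banach_eq0 bN) => /eqP ->; rewrite (sn0 sp) mulr_ge0 ?(sn_ge0 sN).
have Nx : 0 < N x by rewrite lt_neqAle eq_sym x0 (sn_ge0 sN).
have := H ((N x)^-1%:C *: x); rewrite (snZr sN) (snZr sp) gtr0_norm ?invr_gt0//.
rewrite mulVf// => /(_ (lexx _)); rewrite ler_pdivrMl// mulrC => h.
by apply: le_trans h _; rewrite ler_wpM2r ?(sn_ge0 sN)// ler_norm.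
Qed.

Lemma seminorm_comp (V : lmodType R[i]) (W : lmodType R[i]) (p : W -> R) (f : {linear V -> W}) :
  seminorm p -> seminorm (fun x => p (f x)).
Proof.
by move=> sp; split=> [x y|a x]; rewrite ?linearD ?linearZ_LR ?(snZ sp) ?(sn_le sp).
Qed.

(** For an ultrafilter, failure of the first alternative means that for every [e] almost all terms
    are within [e] of a single one, so the sequence is Cauchy along [U]. *)
Lemma ultra_dichotomy (U : set_system nat) (x : nat -> X) : UltraFilter U ->
  (exists2 eps, 0 < eps & forall m, U [set n | eps <= N (x n - x m)]) \/
  exists l, tends N U x l.
Proof.
move=> UU; have Up : ProperFilter U := @ultra_proper _ _ UU.
have [H|H] := pselect (exists2 eps, 0 < eps & forall m, U [set n | eps <= N (x n - x m)]).
  by left.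
right; apply: complete_tends => [|e e0]; first by case: bN.
apply: contrapT => H'; apply: H; exists e => // m.
have [Um|] := in_ultra_setVsetC [set n | e <= N (x n - x m)] UU => //.
move=> Um; exfalso; apply: H'; exists (x m); apply: filterS Um => n /= /negP.
by rewrite -ltNge.
Qed.

(** The last hypothesis is what the resolvent identity gives for uniformly bounded resolvents. The
    lemma serves to prove unboundedness, since the limit would invert [T], at least from the
    right. *)
Lemma op_limit (lam : nat -> R[i]) (Z : nat -> {linear X -> X}) c d :
  tends (@normc R : R[i]^o -> R) \oo lam 0 -> 0 <= d ->
  (forall n x, N (Z n x) <= c * N x) ->
  (forall n m x, N (Z n x - Z m x) <= normc (lam n - lam m) * (d * N x)) ->
  exists2 S : {linear X -> X}, bounded_map N S & forall x, tends N \oo (fun n => Z n x) (S x).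
Proof.
move=> lam0 d0 Zc Zd.
have /choice[S SP] x : exists l, tends N \oo (fun n => Z n x) l.
  apply: complete_tends => [|e e0]; first by case: bN.
  pose D := d * N x + 1; have D0 : 0 < D by rewrite ltr_wpDl// mulr_ge0 ?(sn_ge0 sN).
  have e2 : 0 < e / (2 * D) by rewrite divr_gt0// mulr_gt0.
  have [k _ kP] := lam0 _ e2; exists (Z k x); exists k => // n /= kn.
  apply: le_lt_trans (Zd _ _ _) _.
  have h1 : normc (lam n) < e / (2 * D) by have := kP n kn; rewrite /= subr0.
  have h2 : normc (lam k) < e / (2 * D) by have := kP k (leqnn k); rewrite /= subr0.
  have h3 : normc (lam n - lam k) < e / D.
    apply: le_lt_trans (sn_leB sC _ _) _.
    have -> : e / D = e / (2 * D) + e / (2 * D) by field; rewrite lt0r_neq0.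
    exact: ltrD.
  apply: (@le_lt_trans _ _ (normc (lam n - lam k) * D)).
    by rewrite ler_wpM2l ?normc_ge0// lerDl.
  by rewrite -ltr_pdivlMr.
have lS : linear S.
  move=> a x y; apply/eqP; rewrite -subr_eq0 -(banach_eq0 bN); apply/eqP.
  apply: (tends_N0 sN (SP _)).
  apply: (tends_eq (x := fun n => a *: Z n x + Z n y)).
    by apply: filterE => n; rewrite /mkset linearP.
  apply: (tendsD sN _ (SP y)).
  have lm : linear (fun v : X => a *: v).
    by move=> b u v; rewrite scalerDr !scalerA [a * b]mulrC.
  apply: (tends_map sN (f := linear_of lm) (K := normc a)) (SP x).
  by move=> v; rewrite -(snZ sN).
exists (linear_of lS) => //; exists c => x /=.
by apply: (tends_le sN _ (SP x)); apply: filterE => n /=.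
Qed.

End BanachLemmas.

(** * Half-spaces cut out by functionals *)

Section Core.
Variables (R : realType) (X : lmodType R[i]) (N : X -> R).
Hypothesis bN : banach N.
Let sN : seminorm N. Proof. by case: bN. Qed.
Let sC := seminorm_normc R.
Variable T : {linear X -> X}.
Hypothesis bT : bounded_map N T.
Variables (lam : nat -> R[i]) (Q : nat -> {linear X -> X}).
Hypothesis lam0 : tends (@normc R : R[i]^o -> R) \oo lam 0.
Hypothesis bQ : forall n, bounded_map N (Q n).
Hypothesis TQ : forall n x, T (Q n x) - lam n *: Q n x = x.
Hypothesis QT : forall n x, Q n (T x - lam n *: x) = x.
Variable U : set_system nat.
Hypothesis UU : UltraFilter U.
Hypothesis ooU : (\oo : set_system nat) `<=` U.

Let Up : ProperFilter U := @ultra_proper _ _ UU.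

Lemma TQE n x : T (Q n x) = lam n *: Q n x + x.
Proof. by move/eqP: (TQ n x); rewrite subr_eq addrC => /eqP. Qed.

Lemma QTE n x : Q n (T x) = lam n *: Q n x + x.
Proof.
have := QT n x; rewrite linearB linearZ_LR => /eqP.
by rewrite subr_eq addrC => /eqP.
Qed.

Lemma Q_diff n m x : Q n x - Q m x = (lam n - lam m) *: Q m (Q n x).
Proof.
have := QT m (Q n x); rewrite TQE addrAC -scalerBl linearD linearZ_LR => {1}<-.
by rewrite addrK.
Qed.

Lemma tends_lam (V : lmodType R[i]) (p : V -> R) (x : nat -> V) c
    (nk : nat -> nat) (F : set_system nat) :
  seminorm p -> ProperFilter F -> (\oo : set_system nat) `<=` F ->
  (forall k, (k <= nk k)%N) -> (forall n, p (x n) <= c) ->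
  tends p F (fun n => lam (nk n) *: x n) 0.
Proof.
move=> sp PF oF nkk xc; apply: (tends0M sp (B := c)); last exact: filterE.
move=> e e0; apply: oF; have [k _ kP] := lam0 e0; exists k => // n /= kn.
by apply: kP => /=; exact: leq_trans kn (nkk n).
Qed.

Lemma tends_inv (V : lmodType R[i]) (p : V -> R) (x : V) (c : nat -> R) (F : set_system nat) :
  seminorm p -> ProperFilter F -> (\oo : set_system nat) `<=` F ->
  (forall k, k.+1%:R <= c k) ->
  tends p F (fun n => (c n)^-1%:C *: x) 0.
Proof.
move=> sp PF oF ck; apply: (tends0M sp (x := fun=> x) (B := p x)); last by apply: filterE => n /=.
move=> e e0; apply: oF; exists (Num.bound e^-1) => // n kn; rewrite /mkset.
have n0 : 0 < c n by apply: lt_le_trans (ck n).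
rewrite subr0 normc_real gtr0_norm ?invr_gt0// -[e]invrK ltf_pV2 ?posrE ?invr_gt0//.
apply: lt_le_trans (ck n); apply: lt_le_trans (archi_boundP _) _; first by rewrite invr_ge0 ltW.
by rewrite ler_nat leqW.
Qed.

Lemma oo_proper : ProperFilter (\oo : set_system nat).
Proof. exact: eventually_filter. Qed.

(* The functionals [psi k] are normalised [u \o Q k] on [M]. Either a subsequence
   is biorthogonal to some vectors, and every other one of these functionals
   cuts out the half-space; or they accumulate in norm at a nonzero functional
   that annihilates [T M], which is excluded by [dense]. *)
Lemma perturbable_dual M (P : {linear X -> X}) : fin_codim_inv N T M -> bounded_map N P ->
  (forall x, M (P x)) -> (forall x, M x -> P x = x) ->
  (forall psi : {linear X -> R[i]^o}, bounded_fun N psi -> (forall y, M y -> psi (T y) = 0) ->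
     forall y, M y -> psi y = 0) ->
  ~ invertible_on N T M 0 -> perturbable N T.
Proof.
move=> fM bP MP PM dense ninv.
have sM := fin_codim_inv_subspace fM; have cM := fin_codim_inv_closed bN fM.
have MT x : M x -> M (T x) by have [n [v [f [_ _]]]] := fM; exact.
have MQ n x : M x -> M (Q n x).
  move=> Mx; have [||S _ SP] := @invertible_on_sub _ _ N T setT M (lam n) (fin_codim_invT N T) fM _ _.
  - by [].
  - by exists (Q n) => // y _; split.
  - have [MS TS _] := SP x Mx; rewrite -{1}TS QT//.
(* Were the [Q n] bounded on [M], they would converge there, and the limit would invert [T] on
   [M]. *)
have unb c : exists n x, N x <= 1 /\ c < N (Q n (P x)).
  apply: contrapT => H; apply: ninv.
  have Zc n x : N (Q n (P x)) <= `|c| * N x.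
    apply: (unit_ball_bound bN (seminorm_comp (Q n \o P) sN)) => y y1 /=.
    by rewrite leNgt; apply/negP => lt; apply: H; exists n, y.
  have [||S bS SP] := @op_limit _ _ _ bN lam (fun n => Q n \o P) `|c| (`|c| * `|c|) lam0 _ Zc.
  - by rewrite mulr_ge0.
  - move=> n m x /=; rewrite Q_diff (snZ sN) ler_wpM2l ?normc_ge0//.
    have -> : Q m (Q n (P x)) = Q m (P (Q n (P x))).
      by rewrite (PM (Q n (P x)))//; apply: MQ; exact: MP.
    by apply: le_trans (Zc _ _) _; rewrite -mulrA ler_wpM2l.
  have lz x : tends N \oo (fun n => lam n *: Q n (P x)) 0.
    by apply: (tends_lam (c := `|c| * N x) (nk := id)) => //; exact: oo_proper.
  have lzx x : tends N \oo (fun n => lam n *: Q n (P x) + x) x.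
    have h := @tends_cst _ _ N sN _ \oo oo_proper x.
    by have := @tendsD _ _ N sN _ \oo oo_proper _ _ _ _ (lz x) h; rewrite add0r.
  have uniq z a b : tends N \oo z a -> tends N \oo z b -> a = b.
    move=> za zb; apply/eqP; rewrite -subr_eq0 -(banach_eq0 bN); apply/eqP.
    exact: (tends_N0 sN (F := \oo) za zb).
  exists S => // x Mx; rewrite scale0r subr0 scale0r subr0; split.
  - apply: cM => e e0; have [k _ kP] := SP x e e0; exists (Q k (P x)); first exact: MQ.
    by rewrite (snC sN); exact: (kP k (leqnn k)).
  - have [KT KT0 TK] := bounded_map_ge0 bN bT.
    apply: (uniq (fun n => T (Q n (P x)))); first exact: (tends_map sN TK (SP x)).
    apply: (tends_eq (x := fun n => lam n *: Q n (P x) + x)).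
      by apply: filterE => n; rewrite /mkset TQE PM.
    exact: lzx.
  - apply: (uniq (fun n => Q n (P (T x)))); first exact: SP.
    apply: (tends_eq (x := fun n => lam n *: Q n (P x) + x)).
      by apply: filterE => n; rewrite /mkset !PM ?QTE//; exact: MT.
    exact: lzx.
have /choice[KQ KQP] n : exists K, forall x, N (Q n (P x)) <= K * N x.
  exact: (bounded_map_comp bN (bQ n) bP).
(* Uniform boundedness is used in [X] and then in its dual, to make [u (Q n (P e0))] unbounded for
   one fixed [u]. *)
have [e0 e0P] := banach_steinhaus bN (fun n => seminorm_comp (Q n \o P) sN) KQP unb.
have sD := seminorm_dual_norm sN; have bD := banach_dual_norm sN.
have [|||u uP] := @banach_steinhaus _ _ _ bD (fun n u => normc (dual_lin u (Q n (P e0))))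
    (fun n => N (Q n (P e0))).
- move=> n; split=> [g h|a g].
    exact: (le_normcD (dual_lin g _) (dual_lin h _)).
  exact: (normcM a (dual_lin g _)).
- by move=> n g; rewrite mulrC; exact: dual_le.
- move=> c; have [n cn] := e0P c; exists n.
  have [f [fN fe]] := hahn_banach (Q n (P e0)) sN.
  have [g gf] : exists g : dual N, forall x, dual_lin g x = f x.
    by apply: (dual_of (K := 1)) => x; rewrite mul1r.
  exists g; split; last by rewrite gf fe normc_real ger0_norm ?(sn_ge0 sN).
  by apply: (dual_norm_le sN) => x x1; rewrite gf; exact: le_trans (fN x) x1.
have Ne := sn_ge0 sN e0.
(* Indices at least [k] make [lam (nk k)] tend to 0; the factor [N e0 + 1] gives [k + 1 <= c k], so
   the multiple of [u] in [psiT] tends to 0 too. *)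
have /choice[nk nkP] k : exists n, (k <= n)%N /\
    k.+1%:R * (N e0 + 1) < normc (dual_lin u (Q n (P e0))).
  by have [n kn h] := unbounded_tail uP k (k.+1%:R * (N e0 + 1)); exists n.
have nkk k : (k <= nk k)%N by case: (nkP k).
have [Ku uK] := dual_bounded u.
have /choice[w wP] k : exists g : dual N, forall x, dual_lin g x = dual_lin u (Q (nk k) (P x)).
  have [K0 K00 uK0] := bounded_fun_ge0 bN (dual_bounded u).
  apply: (dual_of (f := dual_lin u \o (Q (nk k) \o P)) (K := K0 * KQ (nk k))) => x.
  by apply: le_trans (uK0 _) _; rewrite -mulrA ler_wpM2l//; exact: KQP.
pose c k := dual_norm (w k).
have ck k : k.+1%:R <= c k.
  have : k.+1%:R * (N e0 + 1) < c k * (N e0 + 1).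
    apply: lt_le_trans (nkP k).2 _; rewrite -wP (le_trans (dual_le sN _ _))//.
    by apply: ler_wpM2l; [exact: (dual_norm_ge0 sN)|rewrite lerDl].
  have Ne1 : 0 < N e0 + 1 by rewrite ltr_wpDl.
  by rewrite (ltr_pM2r Ne1) => /ltW.
have c0 k : 0 < c k by apply: lt_le_trans (ck k).
pose psi k := (c k)^-1%:C *: w k.
have psiE k x : dual_lin (psi k) x = (c k)^-1%:C * dual_lin u (Q (nk k) (P x)) by rewrite -wP.
have psi1 k : dual_norm (psi k) = 1.
  by rewrite (snZr sD) gtr0_norm ?invr_gt0// mulVf// lt0r_neq0.
have psiT k y : M y -> dual_lin (psi k) (T y) =
    lam (nk k) * dual_lin (psi k) y + (c k)^-1%:C * dual_lin u y.
  move=> My; rewrite !psiE (PM _ My) (PM _ (MT _ My)) QTE (linearP (dual_lin u)).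
  by rewrite mulrDr mulrCA.
have [[eps eps0 sep]|[l psil]] := ultra_dichotomy bD psi UU.
  (* [eps] is halved because the dual norm is a supremum, which may not be attained on the unit
     ball. *)
  have [|||nn [a aP]] := @biorthogonal_subsequence _ _ _ bN
      (fun k => dual_lin (psi k)) 1 U (eps / 2) _ UU _ _.
  - by move=> n x; have := dual_le sN (psi n) x; rewrite psi1.
  - by rewrite divr_gt0.
  - move=> m; apply: filterS (sep m) => n /= h; apply: contrapT => H.
    have : dual_norm (psi n - psi m) <= eps / 2.
      apply: (dual_norm_le sN) => x x1; rewrite leNgt; apply/negP => lt; apply: H.
      by exists x => //; exact: ltW.
    by move: h eps0; lra.
  pose f i := dual_lin (psi (nn i)).
  have bf i : bounded_fun N (f i) by exact: dual_bounded.
  have fa i j : f i (P (a j)) = (i == j)%:R.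
    by rewrite -aP /f !psiE (PM _ (MP _)).
  have hY := half_space_cut bN sM cM bf fa (fun i => MP (a i)).
  apply: (perturbable_functional hY (dual_bounded u)) => y [My fy] uy; split; first exact: MT.
  move=> i; rewrite /f psiT// uy mulr0 addr0.
  by have := fy i; rewrite /f => ->; rewrite mulr0.
exfalso.
have l1 : 1 <= dual_norm l.
  by apply: (tends_ge sD _ psil); apply: filterE => k; rewrite /mkset psi1.
have uniq z a b : tends (@normc R : R[i]^o -> R) U z a ->
    tends (@normc R : R[i]^o -> R) U z b -> a = b.
  move=> za zb; apply/eqP; rewrite -subr_eq0 -normc_eq0; apply/eqP.
  exact: (tends_N0 sC za zb).
have psix x : tends (@normc R : R[i]^o -> R) U (fun k => dual_lin (psi k) x) (dual_lin l x).
  have lev : linear (fun g : dual N => dual_lin g x) by [].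
  apply: (tends_map sD (f := linear_of lev) (K := N x)) psil => g.
  by rewrite mulrC; exact: dual_le.
have lT y : M y -> dual_lin l (T y) = 0.
  move=> My; apply: (uniq (fun k => dual_lin (psi k) (T y))); first exact: psix.
  apply: (tends_eq (x := fun k => (lam (nk k) *: (dual_lin (psi k) y : R[i]^o)) +
      ((c k)^-1%:C *: (dual_lin u y : R[i]^o)))).
    by apply: filterE => k; rewrite /mkset psiT.
  rewrite -[X in tends _ _ _ X]addr0; apply: (tendsD sC).
    apply: (tends_lam (c := N y)) => // k.
    by have := dual_le sN (psi k) y; rewrite psi1 mul1r.
  exact: tends_inv.
have lM y : M y -> dual_lin l y = 0.
  by apply: dense => //; exact: dual_bounded.
have : dual_norm l <= 0.
  apply: (dual_norm_le sN) => x _.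
  suff -> : dual_lin l x = 0 by rewrite -(normc0 R).
  rewrite -[RHS](lM _ (MP x)); apply: (uniq (fun k => dual_lin (psi k) x)) => //.
  apply: (tends_eq (x := fun k => dual_lin (psi k) (P x))); last exact: psix.
  by apply: filterE => k; rewrite /mkset !psiE (PM _ (MP x)).
by move: l1; lra.
Qed.

End Core.

(** * Half-spaces spanned by vectors *)

Section CorePrimal.
Variables (R : realType) (X : lmodType R[i]) (N : X -> R).
Hypothesis bN : banach N.
Let sN : seminorm N. Proof. by case: bN. Qed.
Variable T : {linear X -> X}.
Hypothesis bT : bounded_map N T.
Variables (lam : nat -> R[i]) (Q : nat -> {linear X -> X}).
Hypothesis lam0 : tends (@normc R : R[i]^o -> R) \oo lam 0.
Hypothesis bQ : forall n, bounded_map N (Q n).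
Hypothesis TQ : forall n x, T (Q n x) - lam n *: Q n x = x.
Hypothesis QT : forall n x, Q n (T x - lam n *: x) = x.
Variable U : set_system nat.
Hypothesis UU : UltraFilter U.
Hypothesis ooU : (\oo : set_system nat) `<=` U.

Let Up : ProperFilter U := @ultra_proper _ _ UU.

(* Dual to the previous construction, modulo the finite-dimensional [Z]: the
   vectors are the normalised [Q k e], and a limit of them would be a nonzero
   element of the kernel of [T] modulo [Z]. *)
Lemma perturbable_primal Z m v f : biorthogonal N m v f -> lin_subspace Z ->
  (forall i, (i < m)%N -> Z (v i)) -> (forall y, Z y -> y = biorth_proj m v f y) ->
  (forall y, Z y -> Z (T y)) -> (forall x, Z (T x) -> Z x) ->
  (forall n y, Z y -> Z (Q n y)) ->
  ~ (exists2 S : {linear X -> X}, bounded_map N S & forall x, Z (T (S x) - x)) ->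
  perturbable N T.
Proof.
move=> vf sZ Zv Zb ZT TZ ZQ nsurj.
have [P bP PE] := biorth_compl_proj bN vf.
have PZ y : Z y -> P y = 0 by move=> Zy; rewrite PE -(Zb _ Zy) subrr.
have ZbP x : Z (biorth_proj m v f x) by apply: (subspace_sum (fun i => f i x) sZ Zv).
have ZP x : Z (x - P x) by rewrite PE opprB addrC subrK.
have PP x : P (P x) = P x.
  by rewrite [in LHS](PE x) linearB (PZ _ (ZbP x)) subr0.
have P0Z x : P x = 0 -> Z x by move=> Px; have := ZP x; rewrite Px subr0.
have Pcong x y : Z (x - y) -> P x = P y.
  by move=> /PZ/eqP; rewrite linearB subr_eq0 => /eqP.
have ZN y : Z y -> Z (- y) by move=> Zy; rewrite -sub0r; exact: (subspaceB sZ sZ.1).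
have PTP x : P (T (P x)) = P (T x).
  apply: Pcong; rewrite -linearB; apply: ZT.
  by rewrite -opprB; exact/ZN/ZP.
have PQP n x : P (Q n (P x)) = P (Q n x).
  apply: Pcong; rewrite -linearB; apply: ZQ.
  by rewrite -opprB; exact/ZN/ZP.
have uniqX z a b (F : set_system nat) : ProperFilter F -> tends N F z a -> tends N F z b -> a = b.
  move=> FF za zb; apply/eqP; rewrite -subr_eq0 -(banach_eq0 bN); apply/eqP.
  exact: (tends_N0 sN (F := F) za zb).
have [KT KT0 TK] := bounded_map_ge0 bN bT.
have [KP KP0 PK] := bounded_map_ge0 bN bP.
(* Otherwise the [P Q n] would converge to a right inverse of [T] modulo [Z]. *)
have unb c : exists n x, N x <= 1 /\ c < N (P (Q n x)).
  apply: contrapT => H; apply: nsurj.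
  have Zc n x : N (P (Q n x)) <= `|c| * N x.
    apply: (unit_ball_bound bN (seminorm_comp (P \o Q n) sN)) => y y1 /=.
    by rewrite leNgt; apply/negP => lt; apply: H; exists n, y.
  have [||S bS SP] := @op_limit _ _ _ bN lam (fun n => P \o Q n) `|c| (`|c| * `|c|) lam0 _ Zc.
  - by rewrite mulr_ge0.
  - move=> n k x /=; rewrite -linearB (Q_diff TQ QT) linearZ_LR (snZ sN) ler_wpM2l ?normc_ge0//.
    by rewrite -PQP (le_trans (Zc _ _))// -mulrA ler_wpM2l.
  exists S => // x; apply: P0Z; rewrite linearB; apply/eqP; rewrite subr_eq0; apply/eqP.
  apply: (uniqX (fun n => P (T (P (Q n x)))) _ _ \oo).
  - exact: (tends_map sN PK (tends_map sN TK (SP x))).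
  - apply: (tends_eq (x := fun n => lam n *: P (Q n x) + P x)).
      by apply: filterE => n; rewrite /mkset PTP (TQE TQ) (linearP P).
    have h1 : tends N \oo (fun n => lam n *: P (Q n x)) 0.
      by apply: (tends_lam lam0 (c := `|c| * N x) (nk := id)) => //; exact: oo_proper.
    have h2 := @tends_cst _ _ N sN _ \oo oo_proper (P x).
    by have := @tendsD _ _ N sN _ \oo oo_proper _ _ _ _ h1 h2; rewrite add0r.
have /choice[KQ KQP] n : exists K, forall x, N (P (Q n x)) <= K * N x.
  exact: (bounded_map_comp bN bP (bQ n)).
have [e eP] := banach_steinhaus bN (fun n => seminorm_comp (P \o Q n) sN) KQP unb.
have /choice[nk nkP] k : exists n, (k <= n)%N /\ k.+1%:R < N (P (Q n e)).
  by have [n kn h] := unbounded_tail eP k (k.+1%:R); exists n.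
have nkk k : (k <= nk k)%N by case: (nkP k).
pose c k := N (P (Q (nk k) e)).
have ck k : k.+1%:R <= c k by apply: ltW; case: (nkP k).
have c0 k : 0 < c k by apply: lt_le_trans (ck k).
pose x k := (c k)^-1%:C *: P (Q (nk k) e).
have x1 k : N (x k) = 1.
  by rewrite (snZr sN) gtr0_norm ?invr_gt0// mulVf// lt0r_neq0.
have Px k : P (x k) = x k by rewrite linearZ_LR PP.
have [[eps eps0 sep]|[l xl]] := ultra_dichotomy bN x UU; last first.
  exfalso.
  have l1 : 1 <= N l by apply: (tends_ge sN _ xl); apply: filterE => k; rewrite /mkset x1.
  have Pl : P l = l.
    apply: (uniqX x _ _ U) => //.
    apply: (tends_eq (x := fun k => P (x k))); last exact: (tends_map sN PK xl).
    by apply: filterE => k; rewrite /mkset Px.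
  have PTl : P (T l) = 0.
    apply: (uniqX (fun k => P (T (x k))) _ _ U) => //.
      exact: (tends_map sN PK (tends_map sN TK xl)).
    apply: (tends_eq (x := fun k => lam (nk k) *: x k + (c k)^-1%:C *: P e)).
      apply: filterE => k; rewrite /mkset /x (linearZ_LR T) (linearZ_LR P) PTP.
      rewrite (TQE TQ) (linearP P) scalerDr !scalerA; congr (_ *: _ + _).
      exact: mulrC.
    rewrite -[X in tends _ _ _ X]addr0; apply: (tendsD sN).
      by apply: (tends_lam lam0 (c := 1)) => // k; rewrite x1.
    exact: tends_inv.
  have Zl : Z l by apply: TZ; exact: P0Z.
  by move: l1; rewrite -Pl (PZ _ Zl) (sn0 sN); lra.
(* Vectors act on the dual by evaluation, so the elements biorthogonal to them are functionals on
   [X]. *)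
pose ev k (g : dual N) : R[i]^o := dual_lin g (x k).
have lev k : linear (ev k) by [].
have sD := seminorm_dual_norm sN; have bD := banach_dual_norm sN.
have [||nn [g gP]] := @biorthogonal_subsequence _ _ _ bD
    (fun k => linear_of (lev k)) 1 U eps _ UU eps0 _.
- by move=> n g /=; rewrite mul1r; have := dual_le sN g (x n); rewrite x1 mulr1.
- move=> k; apply: filterS (sep k) => n /= h.
  have [h' [hN he]] := hahn_banach (x n - x k) sN.
  have [g gh] : exists g : dual N, forall y, dual_lin g y = h' y.
    by apply: (dual_of (K := 1)) => y; rewrite mul1r.
  exists g; first by apply: (dual_norm_le sN) => y y1; rewrite gh; exact: le_trans (hN y) y1.
  rewrite /ev -[dual_lin g (x n) - _](linearB (dual_lin g)) gh he normc_real.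
  exact: le_trans h (ler_norm _).
pose V i := x (nn i).
pose F i : {linear X -> R[i]^o} := dual_lin (g i) \o P.
have bF i : bounded_fun N (F i).
  have [K K0 gK] := bounded_fun_ge0 bN (dual_bounded (g i)).
  by exists (K * KP) => y; apply: le_trans (gK _) _; rewrite -mulrA ler_wpM2l.
have FV i j : F i (V j) = (i == j)%:R.
  by rewrite /F /V /= Px eq_sym; exact: (gP j i).
pose y i := Q (nk (nn i)) e.
(* The span of [Z] and of the [y i] with even index. Containing [Z], it contains [P (y i)] along
   with [y i]; and it is for the unprojected [y i] that [T (y i)] is a multiple of [y i] plus
   exactly [e]. *)
pose S : set X := [set z | forall W, lin_subspace W -> Z `<=` W ->
  (forall i, W (y i.*2)) -> W z].
have sS : lin_subspace S.
  split=> [W sW _ _|a z z' Sz Sz' W sW ZW yW]; first exact: sW.1.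
  by apply: sW.2; [exact: Sz|exact: Sz'].
have ZS : Z `<=` S by move=> z Zz W _ ZW _; exact: ZW.
have yS i : S (y i.*2) by move=> W _ _; exact.
have VS i : S (V i.*2).
  rewrite /V /x -[_ *: _]addr0; apply: sS.2; last exact: sS.1.
  by rewrite PE; apply: (subspaceB sS); [exact: yS|exact: ZS].
have FS i z : S z -> F i.*2.+1 z = 0.
  move=> Sz; apply: (Sz [set z | F i.*2.+1 z = 0]).
  - split=> [|a u w Fu Fw]; first exact: (linear0 (F i.*2.+1)).
    by rewrite /mkset (linearP (F i.*2.+1)) Fu Fw scaler0 addr0.
  - move=> u Zu; rewrite /mkset -[F _ u]/(dual_lin (g i.*2.+1) (P u)) (PZ _ Zu).
    exact: (linear0 (dual_lin (g i.*2.+1))).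
  - move=> j; have := FV i.*2.+1 j.*2.
    rewrite -[F _ _]/(dual_lin (g i.*2.+1) (P (V j.*2))) /V /x linearZ_LR PP.
    rewrite (linearZ_LR (dual_lin _)).
    rewrite (_ : (_ == _) = false); last first.
      by apply/negbTE/eqP => /(congr1 odd) /=; rewrite !odd_double.
    move/eqP; rewrite -[_ *: _]/(_ * _) mulf_eq0 => /orP[|/eqP //].
    by rewrite -normc_eq0 normc_real normr_eq0 invr_eq0 (negPf (lt0r_neq0 (c0 _))).
apply: (@perturbable_span _ _ _ bN T bT S e sS).
- move=> z Sz; apply: (Sz [set z | exists a : R[i], S (T z - a *: e)]).
  + split; first by exists 0; rewrite linear0 scale0r subr0; exact: sS.1.
    move=> a u w [b Sb] [d Sd]; exists (a * b + d).
    rewrite (linearP T) scalerDl -scalerA opprD addrACA -scalerBr.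
    exact: sS.2.
  + by move=> u Zu; exists 0; rewrite scale0r subr0; apply: ZS; exact: ZT.
  + move=> i; exists 1; rewrite scale1r /y (TQE TQ) addrK.
    by rewrite -[_ *: _]addr0; apply: sS.2; [exact: yS|exact: sS.1].
- by apply: (inf_dim_seq bF FV double_inj) => i; apply: (sub_norm_closure bN); exact: VS.
- apply: (inf_codim_seq bF FV doubleS_inj) => i z; apply: (norm_closure_ker bN (bF _)) => u Su.
  exact: FS.
Qed.

End CorePrimal.

(** * Reduction to the two cases *)

Section Reduction.
Variables (R : realType) (X : lmodType R[i]) (N : X -> R).
Hypothesis bN : banach N.
Let sN : seminorm N. Proof. by case: bN. Qed.
Variable T : {linear X -> X}.
Hypothesis bT : bounded_map N T.

Lemma iter_linear (S : {linear X -> X}) j : bounded_map N S ->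
  exists2 L : {linear X -> X}, bounded_map N L & forall x, L x = iter j S x.
Proof.
move=> bS; elim: j => [|j [L bL LE]]; first by exists idfun => //; exact: bounded_map_id.
by exists (S \o L) => [|x /=]; [exact: bounded_map_comp|rewrite LE].
Qed.

Lemma inf_dim_sub (Y Y' : set X) : Y `<=` Y' -> inf_dim N Y -> inf_dim N Y'.
Proof.
by move=> YY' H n; have [v [f [vf Yv]]] := H n; exists v, f; split=> // i /Yv/YY'.
Qed.

Lemma ker_iter_subspace j : lin_subspace [set x | iter j T x = 0].
Proof.
have [L _ LE] := iter_linear j bT; split=> [|a x y /=]; rewrite /= -!LE ?linear0//.
by move=> Lx Ly; rewrite linearP Lx Ly scaler0 addr0.
Qed.

(** [T] maps the kernel of its power [j.+1] into that of its power [j], and the part it kills is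
    finite-dimensional. *)
Lemma ker_iter_findim j : ~ inf_dim N [set x | T x = 0] -> ~ inf_dim N [set x | iter j T x = 0].
Proof.
move=> nk; elim: j => [|j IH].
  apply: (@spanned_not_inf_dim _ _ N _ 0 (fun=> 0)) => y /= ->.
  by exists (fun=> 0); rewrite big_ord0.
pose A := [set x | iter j.+1 T x = 0].
have sA : lin_subspace A := ker_iter_subspace j.+1.
have [|n1 [v1 [f1 [_ _ B1]]]] := @findim_basis _ _ _ bN [set x | T x = 0] _ nk.
  exact: (ker_iter_subspace 1).
have [|H|n2 [v2 [f2 [_ V2 B2]]]] := @findim_basis _ _ _ bN [set T x | x in A].
- split; first by exists 0; [exact: sA.1|rewrite linear0].
  move=> a _ _ [x Ax <-] [y Ay <-]; exists (a *: x + y); first exact: sA.2.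
  by rewrite linearP.
- apply: IH; apply: inf_dim_sub H => _ [x + <-]; by rewrite /A /= -iterSr.
have /choice[a aP] i : exists a, (i < n2)%N -> T a = v2 i.
  have [ilt|_] := ltnP i n2; last by exists 0.
  by have [a _ Ta] := V2 i ilt; exists a.
apply: (@spanned_not_inf_dim _ _ N _ (n1 + n2) (fun i => if (i < n1)%N then v1 i else a (i - n1)%N)).
move=> x Ax; have e := B2 (T x) (ex_intro2 _ _ x Ax erefl).
pose x' := x - \sum_(i < n2) f2 i (T x) *: a i.
have Tx' : T x' = 0.
  rewrite linearB linear_sum {1}e /biorth_proj; apply/eqP; rewrite subr_eq0; apply/eqP.
  by apply: eq_bigr => i _; rewrite linearZ_LR aP.
exists (fun i => if (i < n1)%N then f1 i x' else f2 (i - n1)%N (T x)).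
rewrite big_split_ord /= -[LHS](subrK (\sum_(i < n2) f2 i (T x) *: a i)).
rewrite -/x' {1}(B1 x' Tx') /biorth_proj; congr (_ + _); apply: eq_bigr => i _.
  by rewrite ltn_ord.
by rewrite ltnNge leq_addr /= addKn.
Qed.

Lemma bproj_coords n v (f : nat -> {linear X -> R[i]^o}) x y :
  coords n f x = coords n f y -> biorth_proj n v f x = biorth_proj n v f y.
Proof.
move=> /rowP e; apply: eq_bigr => i _; congr (_ *: _).
by have := e i; rewrite !mxE.
Qed.

(** In coordinates on [D], [T] is multiplication by a square matrix [A]; surjectivity puts every
    unit vector in the row space of [A], so [A] is invertible. *)
Lemma onto_fin_dim_inj (D : set X) : lin_subspace D -> ~ inf_dim N D ->
  (forall y, D y -> exists2 x, D x & T x = y) -> forall x, D x -> T x = 0 -> x = 0.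
Proof.
move=> sD nD onto x Dx Tx0.
have [m [w [g [wg Dw Dg]]]] := findim_basis bN sD nD.
pose A : 'M[R[i]]_m := \matrix_(i, j) g j (T (w i)).
have AE z : D z -> coords m g (T z) = coords m g z *m A.
  move=> Dz; apply/rowP => j; rewrite !mxE {1}(Dg _ Dz) /biorth_proj !linear_sum.
  by apply: eq_bigr => i _; rewrite !mxE (linearZ_LR T) (linearZ_LR (g j)).
have full : row_full A.
  rewrite -sub1mx; apply/row_subP => i.
  have [z Dz Tz] := onto _ (Dw _ (ltn_ord i)).
  rewrite (_ : row i 1%:M = coords m g z *m A) ?submxMl//.
  rewrite -AE// Tz; apply/rowP => j; rewrite !mxE wg.2// eq_sym.
  by [].
have : coords m g x *m A = 0.
  by rewrite -AE// Tx0; apply/rowP => j; rewrite !mxE linear0.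
move=> /(congr1 (fun u => u *m invmx A)); rewrite mulmxK -?row_full_unit// mul0mx.
move=> c0; rewrite (Dg _ Dx); apply: big1 => i _.
by move/rowP/(_ i): c0; rewrite !mxE => ->; rewrite scale0r.
Qed.

Lemma perturbable_at_boundary : ~ ess_regular N T 0 ->
  (forall e, 0 < e -> exists2 l, normc (l - 0) < e & invertible_on N T setT l) ->
  perturbable N T.
Proof.
move=> nreg approx; apply: contrapT => ng.
(* Arguing by contradiction excludes every invariant half-space met on the way. *)
have nohalf Y : half_space N Y -> ~ (forall y, Y y -> Y (T y)).
  by move=> hY TY; apply: ng; exact: perturbable_invariant hY TY.
have /choice[lQ lQP] n : exists lQ : R[i] * {linear X -> X}, normc lQ.1 < half_pow R n /\
    (bounded_map N lQ.2 /\ forall x, T (lQ.2 x) - lQ.1 *: lQ.2 x = x /\ lQ.2 (T x - lQ.1 *: x) = x).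
  have [l ln [S bS SP]] := approx _ (half_pow_gt0 R n); exists (l, S).
  by rewrite subr0 in ln; split=> //; split=> // x; have [] := SP x I.
pose lam n := (lQ n).1; pose Q n := (lQ n).2.
have bQ n : bounded_map N (Q n) by have [_ []] := lQP n.
have TQ n x : T (Q n x) - lam n *: Q n x = x.
  by have [_ [_ h]] := lQP n; have [] := h x.
have QT n x : Q n (T x - lam n *: x) = x.
  by have [_ [_ h]] := lQP n; have [] := h x.
have lam0 : tends (@normc R : R[i]^o -> R) \oo lam 0.
  move=> e e0; have [k ke] := half_pow_lt e0; exists k => // n kn.
  by rewrite /mkset subr0; apply: lt_trans (ke n kn); case: (lQP n).
have [U [UU ooU]] := ultraFilterLemma oo_proper.
have sker : lin_subspace [set x | T x = 0] := ker_iter_subspace 1.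
have nker : ~ inf_dim N [set x | T x = 0].
  move=> iker; have [|Z Zk hZ] := half_space_in bN sker _ iker.
    have [KT KT0 TK] := bounded_map_ge0 bN bT => x Hx; apply/eqP; rewrite -(banach_eq0 bN).
    rewrite eq_le (sn_ge0 sN) andbT; apply/ler_addgt0Pr => e e0; rewrite add0r.
    have [y /= Ty xy] := Hx _ (divr_gt0 e0 KT0).
    rewrite -[T x]subr0 -Ty -linearB (le_trans (TK _))// mulrC -ler_pdivlMr//.
    exact: ltW.
  apply: (nohalf Z hZ) => z /Zk /= ->; by have [[]] := hZ.
have [n [v [f [vf kv kb]]]] := findim_basis bN sker nker.
pose W j := [set y | T y = 0 /\ exists x, y = iter j T x].
have sW j : lin_subspace (W j).
  have [L _ LE] := iter_linear j bT; split.
    by split; [exact: linear0|exists 0; rewrite -LE linear0].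
  move=> a x y [Tx [x' xE]] [Ty [y' yE]]; split; first exact: (sker.2 a x y).
  by exists (a *: x' + y'); rewrite -LE linearP !LE -xE -yE.
have [|||j0 stab] := @descending_subspaces R[i] n (fun j => [set coords n f y | y in W j]).
- by move=> j; exists 0; [exact: (sW j).1|apply/coords_eq0 => i _; exact: linear0].
- move=> j a _ _ [x Wx <-] [y Wy <-]; exists (a *: x + y); first exact: (sW j).2.
  exact: coordsP.
- move=> j _ [y [Ty [x yE]] <-]; exists y => //; split=> //; exists (T x).
  by rewrite yE iterSr.
have {}stab j : (j0 <= j)%N -> W j0 `<=` W j.
  move=> j0j y Wy; have [|y' Wy' e] := stab j j0j (coords n f y); first by exists y.
  rewrite (kb _ Wy.1) -(bproj_coords v e) -(kb _ Wy'.1)//.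
have [[v0 Wv0 /eqP v00]|W0] := pselect (exists2 v0, W j0 v0 & v0 <> 0).
  (* [T] maps [D] onto itself but kills [v0], so [D] is infinite dimensional. *)
  pose D := [set x | forall j, exists z, x = iter j T z].
  have sD : lin_subspace D.
    split=> [j|a x y Dx Dy j]; have [L _ LE] := iter_linear j bT.
      by exists 0; rewrite -LE linear0.
    have [x' ->] := Dx j; have [y' ->] := Dy j.
    by exists (a *: x' + y'); rewrite -!LE linearP.
  have low i j z : (i <= j)%N -> exists z', iter j T z = iter i T z'.
    by move=> ij; exists (iter (j - i) T z); rewrite -iterD subnKC.
  have Dv0 : D v0.
    move=> j; have [jj|/ltnW jj] := leqP j0 j; first by have [_] := stab j jj _ Wv0.
    by have [_ [z ->]] := Wv0; exact: low.
  (* Two preimages of [y] in the range of [iter j0 T], one of them in the range of [iter j T] with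
     [j >= j0], differ by an element of [W j0], hence of [W j]. So the chosen preimage lies in all
     these ranges. *)
  have onto y : D y -> exists2 x, D x & T x = y.
    move=> Dy; have [z yz] := Dy j0.+1; exists (iter j0 T z); last by rewrite yz.
    move=> j; have [jj|/ltnW jj] := leqP j0 j; last exact: low.
    have [z' yz'] := Dy j.+1.
    have : W j0 (iter j0 T z - iter j T z').
      split; first by rewrite linearB -!iterS -yz -yz' subrr.
      have [z'' ->] := low j0 j z' jj; have [L _ LE] := iter_linear j0 bT.
      by exists (z - z''); rewrite -!LE linearB.
    move=> /(stab j jj)[_ [w wE]]; have [L _ LE] := iter_linear j bT.
    by exists (w + z'); rewrite -LE linearD !LE -wE subrK.
  have iD : inf_dim N D.
    apply: contrapT => nD; move/eqP: v00; apply.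
    exact: (onto_fin_dim_inj sD nD onto Dv0 Wv0.1).
  have TD y : norm_closure N D y -> norm_closure N D (T y).
    apply: (norm_closure_map bN bT); first exact: norm_closed_closure.
    move=> z Dz; apply: (sub_norm_closure bN) => j; have [z' ->] := Dz j.
    by exists (T z'); rewrite -iterSr.
  have sM := lin_subspace_closure bN sD.
  have nM : ~ inf_codim N (norm_closure N D).
    move=> jM; apply: (nohalf (norm_closure N D)) TD; split=> //; first exact: norm_closed_closure.
    by apply: inf_dim_sub iD; exact: sub_norm_closure.
  have [m [w [g [wg ME]]]] := fincodim_basis bN sM (norm_closed_closure bN (Y := D)) nM.
  have fM : fin_codim_inv N T (norm_closure N D) by exists m, w, g.
  have [P bP [MP PM]] := fin_codim_inv_proj bN fM.
  apply: ng; apply: (perturbable_dual bN bT lam0 bQ TQ QT UU ooU fM bP MP PM).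
    (* [D] is contained in its image under [T], so a functional annihilating that image annihilates
       [D] and its closure. *)
    move=> psi bpsi psiT; apply: (norm_closure_ker bN bpsi) => y Dy.
    by have [x Dx <-] := onto y Dy; apply: psiT; exact: (sub_norm_closure bN).
  by move=> inv0; apply: nreg; exists (norm_closure N D).
pose Z := [set x | iter j0 T x = 0].
have sZ : lin_subspace Z := ker_iter_subspace j0.
have nZ : ~ inf_dim N Z := @ker_iter_findim j0 nker.
have [m [w [g [wg Zw Zg]]]] := findim_basis bN sZ nZ.
have ZT y : Z y -> Z (T y) by rewrite /Z /= -iterSr /= => ->; exact: linear0.
(* If [T y] is in [Z], then [iter j0 T y] belongs to [W j0], which is zero. *)
have TZ y : Z (T y) -> Z y.
  rewrite /Z /= -iterSr /= => Ty; apply: contrapT => y0; apply: W0.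
  by exists (iter j0 T y) => //; split=> //; exists y.
have ZQ k y : Z y -> Z (Q k y).
  rewrite /Z /= => Zy.
  have -> : iter j0 T (Q k y) = Q k (iter j0 T y).
    by elim: (j0) => //= j ->; rewrite (TQE TQ) (QTE QT).
  by rewrite Zy linear0.
apply: ng; apply: (perturbable_primal bN bT lam0 bQ TQ QT UU ooU wg sZ Zw Zg ZT TZ ZQ).
(* A right inverse modulo [Z] would split [X] into [Z] and the range of [L = T^j0], a closed
   invariant subspace of finite codimension on which [T] would be invertible. *)
move=> [S bS TS]; apply: nreg.
have [L bL LE] := iter_linear j0 bT.
have iterTZ i y : Z y -> Z (iter i T y) by move=> Zy; elim: i => //= i; exact: ZT.
have TiterZ i y : Z (iter i T y) -> Z y.
  by elim: i y => //= i IH y; rewrite -iterS iterSr => /IH/TZ.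
have disj y z : Z y -> y = L z -> y = 0.
  move=> Zy yz; move: (Zy); rewrite /Z /= yz LE => h.
  have : Z (iter j0 T z) by exact: h.
  by move=> /TiterZ; rewrite /Z /=.
have ZA y z : Z y -> Z z -> Z (y + z) by move=> Zy Zz; rewrite -[y]scale1r; exact: sZ.2.
have VS i x : Z (iter i T (iter i S x) - x).
  elim: i x => [|i IH] x; first by rewrite /= subrr; exact: sZ.1.
  rewrite [iter i.+1 S x]iterSr /=.
  have -> : T (iter i T (iter i S (S x))) - x =
      T (iter i T (iter i S (S x)) - S x) + (T (S x) - x).
    by rewrite linearB addrA subrK.
  by apply: ZA => //; apply: ZT; exact: IH.
have [S0 bS0 S0E] := iter_linear j0 bS.
(* [V] turns out to be the projection onto the range of [L] along [Z], and [G] below the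
   complementary one; composing [g] with [G] gives functionals that cut out this range. *)
have [V bV VE] : exists2 V : {linear X -> X}, bounded_map N V & forall x, V x = L (S0 x).
  by exists (L \o S0) => //; exact: bounded_map_comp.
have VZ x : Z (V x - x) by rewrite VE LE S0E; exact: VS.
have [G bG GE] := bounded_map_lin bN (-1) bV (bounded_map_id N).
have {}GE x : G x = x - V x by rewrite GE scaleN1r addrC.
have ZG x : Z (G x).
  by rewrite GE -opprB -sub0r; apply: (subspaceB sZ) => //; exact: sZ.1.
pose h i : {linear X -> R[i]^o} := g i \o G.
have bh i : bounded_fun N (h i).
  have [K K0 gK] := bounded_fun_ge0 bN (wg.1 i); have [K' K'0 GK] := bounded_map_ge0 bN bG.
  by exists (K * K') => x; apply: le_trans (gK _) _; rewrite -mulrA ler_wpM2l.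
have Vfix z : V (L z) = L z.
  have e : V (L z) - L z = L (S0 (L z) - z) by rewrite VE -linearB.
  by have := disj _ _ (VZ (L z)) e => /eqP; rewrite subr_eq0 => /eqP.
have VZ0 y : Z y -> V y = 0.
  move=> Zy; apply: (disj _ (S0 y)) => //.
  by rewrite -[V y](subrK y); exact: ZA.
pose M := [set x | exists z, x = L z].
have ME : M = common_ker m h.
  apply/seteqP; split=> [_ [z ->] i _|x hx].
    by rewrite /h /= GE Vfix subrr linear0.
  exists (S0 x); rewrite -VE; apply/eqP; rewrite -subr_eq0 -GE; apply/eqP.
  rewrite (Zg _ (ZG x)); apply: big1 => i _; rewrite (_ : g i (G x) = 0) ?scale0r//.
  exact: hx.
exists M.
  exists m, w, h; split=> //.
    split=> // i j ilt jlt; rewrite /h /= GE VZ0; last exact: Zw.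
    by rewrite subr0 wg.2.
  by move=> _ [z ->]; exists (T z); rewrite !LE -iterSr.
(* The inverse on [M] is [V S]: the right inverse modulo [Z], projected to [M] along [Z]. *)
exists (L \o (S0 \o S)); first by apply: bounded_map_comp => //; exact: bounded_map_comp.
have TQ0 x : M x -> T (L (S0 (S x))) = x.
  move=> [z xz].
  have comm y : T (L y) = L (T y) by rewrite !LE -iterSr.
  have S0S : S0 (S x) = S (S0 x) by rewrite !S0E -iterSr.
  rewrite comm S0S -[T (S _)](subrK (S0 x)) linearD -VE [in V x]xz Vfix -xz.
  by rewrite LE (TS (S0 x)) add0r.
move=> x Mx /=; rewrite !scale0r !subr0; split.
- by exists (S0 (S x)).
- exact: TQ0.
- have MTx : M (T x) by have [z ->] := Mx; exists (T z); rewrite !LE -iterSr.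
  have [z xz] := Mx.
  apply/eqP; rewrite -subr_eq0; apply/eqP.
  apply: (disj _ (S0 (S (T x)) - z)); last by rewrite linearB -xz.
  apply: TZ; rewrite linearB TQ0// subrr; exact: sZ.1.
Qed.

End Reduction.

(** * Shifting the boundary point to the origin *)

Section Main.
Variables (R : realType) (X : lmodType R[i]) (N : X -> R).
Hypothesis bN : banach N.
Variable T : {linear X -> X}.
Hypothesis bT : bounded_map N T.

Theorem always_perturbable : inf_dim N setT -> perturbable N T.
Proof.
move=> iX; have [l nl approx] := ess_boundary bN bT iX.
have [T' bT' T'E] := bounded_map_lin bN (- l) (bounded_map_id N) bT.
have {}T'E x : T' x = T x - l *: x by rewrite T'E scaleNr addrC.
have shift M l' : invertible_on N T' M (l' - l) <-> invertible_on N T M l'.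
  have e y : T' y - (l' - l) *: y = T y - l' *: y.
    by rewrite T'E scalerBl opprB addrA subrK.
  by split=> -[S bS SP]; exists S => // x Mx; have := SP x Mx; rewrite !e.
have [||F [u [f [Y [bf FE hY TY]]]]] := @perturbable_at_boundary _ _ _ bN T' bT'.
- move=> [M [n [v [f [vf ME MT]]]] invM]; apply: nl; exists M.
    exists n, v, f; split=> // x Mx.
    have sM : lin_subspace M by rewrite ME; exact: lin_subspace_common_ker.
    rewrite -[T x](subrK (l *: x)) -T'E addrC; apply: sM.2 => //; exact: MT.
  by apply/shift; rewrite subrr.
- move=> e e0; have [l' l'e inv'] := approx e e0; exists (l' - l); first by rewrite subr0.
  exact/shift.
exists F, u, f, Y; split=> // y Yy; have [sY _ _ _] := hY.
rewrite -[T y](subrK (l *: y)) -T'E addrAC addrC; apply: sY.2 => //; exact: TY.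
Qed.

End Main.

(** * The theorem *)

Section Submodule.
Variables (R : realType) (V : lmodType R[i]) (Y : set V).
Hypothesis sY : lin_subspace Y.

Definition set_pred : {pred V} := fun x => `[< Y x >].

Fact set_pred_submod : submod_closed set_pred.
Proof.
split; first by apply/asboolP; exact: sY.1.
by move=> a x y /asboolP Yx /asboolP Yy; apply/asboolP; exact: sY.2.
Qed.

Definition submod_of : submodClosed V :=
  HB.pack set_pred (GRing.isSubmodClosed.Build R[i] V set_pred set_pred_submod).

Lemma submod_ofE x : (x \in submod_of) <-> Y x.
Proof. by split=> /asboolP. Qed.

End Submodule.

Lemma pi_quot_sum (K : pzRingType) (V : lmodType K) (Y : submodClosed V) n
    (c : 'I_n -> K) (v : 'I_n -> quot_lmod Y) :
  \sum_(i < n) c i *: v i = (\pi_(quot_lmod Y) (\sum_(i < n) c i *: repr (v i)))%qT.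
Proof.
elim/big_rec2 : _ => [|i x y _ ->]; first by rewrite raddf0.
by rewrite raddfD.
Qed.

Section Glue.
Variables (R : realType) (X : completeNormedModType R[i]).

(** The norm of [X] takes values in [R[i]], where it is real. *)
Definition rnorm (x : X) : R := complex.Re `|x|.

Lemma rnormE (x : X) : `|x| = (rnorm x)%:C.
Proof. by rewrite /rnorm RRe_real// normr_real. Qed.

Lemma banach_rnorm : banach rnorm.
Proof.
split.
- split=> [x y|a x].
    suff : (rnorm (x + y))%:C <= (rnorm x + rnorm y)%:C by rewrite lecR.
    by rewrite rmorphD /= -!rnormE ler_normD.
  apply: (@complexI R); rewrite rmorphM /= -!rnormE normrZ.
  by congr (_ * _).
- by move=> x x0; apply/eqP; rewrite -normr_eq0 rnormE x0.
- move=> F FF FC.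
  have /cauchy_cvgP/cvg_ex[l Fl] : cauchy F.
    apply: cauchy_exP => e; rewrite ltcE /= => /andP[/eqP e0 eR].
    have [v Fv] := FC _ eR; exists v; apply: filterS Fv => w /= wv.
    rewrite -ball_normE /= -normrN opprB rnormE ltcE /= wv.
    by rewrite e0 eqxx.
  exists l => e e0; have eC : 0 < e%:C :> R[i] by rewrite ltcR.
  have := Fl (ball l e%:C) (nbhsx_ballx _ _ eC).
  apply: filterS => w; rewrite -ball_normE /= -normrN opprB rnormE.
  by rewrite ltcR.
Qed.

Lemma infinite_dim_inf_dim : infinite_dim [set: X] -> inf_dim rnorm setT.
Proof.
move=> iX; apply: contrapT => nX.
have [|n [v [f [_ _ B]]]] := findim_basis banach_rnorm _ nX; first by split.
apply: (iX n); exists (fun i : 'I_n => v i) => // x _.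
by exists (fun i : 'I_n => f i x); exact: B.
Qed.

Lemma dim_le_not_inf_dim (Y : set X) n : dim_le Y n -> ~ inf_dim rnorm Y.
Proof.
move=> [v _ vY]; apply: (@spanned_not_inf_dim _ _ rnorm Y n
  (fun i => if insub i is Some j then v j else 0)) => y /vY[c ->].
exists (fun i => if insub i is Some j then c j else 0).
by apply: eq_bigr => i _; rewrite valK.
Qed.

(** If [n] classes spanned the quotient, every vector would be congruent modulo [Y] to one in the
    span [Z] of their representatives. Functionals vanishing on [Y] do not see the change, so [Z]
    would contain biorthogonal systems of every length. *)
Lemma inf_codim_infinite_codim (Y : set X) (sY : lin_subspace Y) :
  inf_codim rnorm Y -> infinite_codim (submod_of sY).
Proof.
move=> iY n [v _ vq].
pose r i := repr (v i).
pose Z := [set x | exists c : 'I_n -> R[i], x = \sum_(i < n) c i *: r i].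
have : dim_le Z n.
  exists r => [i|x [c ->]]; last by exists c.
  exists (fun j => (j == i)%:R); rewrite (bigD1 i)//= eqxx scale1r big1 ?addr0// => j.
  by move=> /negPf ->; rewrite scale0r.
move=> /dim_le_not_inf_dim; apply => m.
have [w [g [[bg wg] gY]]] := iY m.
have /choice[z zP] j : exists z, Z z /\ Y (w j - z).
  have [c wE] := vq (\pi_(quot_lmod (submod_of sY)) (w j))%qT I.
  exists (\sum_(i < n) c i *: r i); split; first by exists c.
  by apply/(submod_ofE sY); rewrite -eq_quot_lmod wE pi_quot_sum.
exists z, g; split; last by move=> i _; case: (zP i).
split=> // i j ilt jlt; rewrite -(wg i j)//; apply/esym/eqP.
by rewrite -subr_eq0 -linearB; apply/eqP/gY => //; case: (zP j).
Qed.

Lemma norm_closed_closed (Y : set X) : norm_closed rnorm Y -> closed Y.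
Proof.
move=> cY x clx; apply: cY => e e0.
have eC : 0 < e%:C :> R[i] by rewrite ltcR.
have [y [Yy]] := clx _ (nbhsx_ballx x _ eC).
by rewrite -ball_normE /= rnormE ltcR => xy; exists y.
Qed.

End Glue.

Theorem theorem1p1 (R : realType) (X : completeNormedModType R[i])
    (T : {linear X -> X}) :
  infinite_dim [set: X] -> bounded_op T ->
  exists F : {linear X -> X},
    [/\ bounded_op F, dim_le (range F) 1 &
      exists Y : submodClosed X,
        [/\ closed [set` Y], infinite_dim [set` Y], infinite_codim Y &
          forall y, y \in Y -> T y + F y \in Y]].
Proof.
move=> /infinite_dim_inf_dim iX [M TM].
have bT : bounded_map (@rnorm R X) T.
  exists (complex.Re M) => x; have := TM x; rewrite !rnormE lecE /= => /andP[_].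
  by case: (M) => a b /=; rewrite !(mulr0, subr0).
have [F [u [f [Y [[K fK] FE [sY cY iY jY] TY]]]]] :=
  always_perturbable (banach_rnorm X) bT iX.
exists F; split.
- exists (K * rnorm u)%:C => x; rewrite !rnormE -rmorphM lecR FE.
  have [sN _ _] := banach_rnorm X.
  by rewrite (snZ sN) mulrAC ler_wpM2r ?(sn_ge0 sN).
(* The spanning vector has to lie in the range: it is 0 if [f] vanishes, and [F x0] with [f x0 != 0]
   otherwise. *)
- have [f0|/existsNP[x0 /eqP fx0]] := pselect (forall x, f x = 0).
    exists (fun=> 0) => [i|_ [x _ <-]]; first by exists 0 => //; rewrite linear0.
    by exists (fun=> 0); rewrite FE f0 big_ord1 !scale0r.
  exists (fun=> F x0) => [i|_ [x _ <-]]; first by exists x0.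
  exists (fun=> f x / f x0); rewrite big_ord1 !FE scalerA.
  by rewrite divfK.
exists (submod_of sY); split.
- rewrite (_ : [set` _] = Y); first exact: norm_closed_closed.
  by apply/seteqP; split=> y /= /(submod_ofE sY).
- move=> n /dim_le_not_inf_dim; apply; apply: inf_dim_sub iY => y Yy /=.
  exact/submod_ofE.
- exact: inf_codim_infinite_codim.
- by move=> y /submod_ofE Yy; apply/submod_ofE; exact: TY.
Qed.
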